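(* There is a constant $\mu_0>0$ (any sufficiently small constant will do) such that the following holds. Let $1/2<\varphi<3/5$ be fixed. Let $\ell=\ell(n)$, $n$ and $m=m(n)$ be integers that satisfy, as $n\to\infty$, $$ \frac{m}{n\ell}<\mu_0,\qquad (\ell+n)^{5-5\varphi}=o\big(\ell\, n\, m^{3-5\varphi}\big), $$ and, for all fixed $K>0$, $\ell\log^K n+n\log^K\ell=o(m)$. Put $s=m/\ell$ and $t=m/n$. Let $\mathfrak{D}$ be the set of sequences $\mathbf{d}=(\mathbf{s},\mathbf{t})$ of non-negative integers, with $\mathbf{s}=(s_a)_{a\in S}$ and $\mathbf{t}=(t_v)_{v\in T}$ of lengths $\ell$ and $n$ respectively, satisfying $\sum_{a\in S}s_a=\sum_{v\in T}t_v=m$, $|s_a-s|\le s^{\varphi}$ for all $a\in S$, and $|t_v-t|\le t^{\varphi}$ for all $v\in T$. Let $\mathcal{G}=\mathcal{G}(\ell,n,m)$ (the bipartite case) or $\mathcal{G}=\vec{\mathcal{G}}(n,m)$ with $\ell=n$ (the digraph case). Let $a\in S$ and $v\in T$, with $v\ne a'$ in the digraph case. Then, uniformly for $\mathbf{d}=(\mathbf{s},\mathbf{t})\in\mathfrak{D}$, the probability that $av$ is an edge of the random graph $G\in\mathcal{G}$, conditional on the event that $\mathcal{D}(G)=\mathbf{d}$, is $$ \frac{s_at_v}{m-\delta^{\mathrm{di}}t}\left(1-\frac{(s_a-s)(t_v-t)}{m-\delta^{\mathrm{di}}t-ts}+\frac{(s_a-s)\sigma^2(\mathbf{t})}{ts(\ell-t)}+\frac{(t_v-t)\sigma^2(\mathbf{s})}{ts(n-s)}+\frac{\delta^{\mathrm{di}}}{n-1}\left(\frac{t_{a'}-t}{t}+\frac{s_{v'}-s}{s}\right)+O\left(\min\{s,t\}^{4\varphi-4}\frac{m}{n\ell}\right)\right).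 $$
   Context: Asymptotic statements are for $n\to\infty$ (the hypotheses force $\ell\to\infty$ too). Vertex sets: $S=[\ell]$, $T=[n+\ell]\setminus[\ell]$. A bipartite graph with bipartition $(S,T)$ has degree sequence $(\mathbf{s},\mathbf{t})$ if each $a\in S$ has degree $s_a$ and each $v\in T$ has degree $t_v$; $\mathcal{D}(G)$ denotes the degree sequence of $G$. When $\ell=n$, for $a\in S$ put $a'=a+n\in T$, and for $v\in T$ put $v'=v-n\in S$. Random graphs: $\mathcal{G}(\ell,n,m)$ is a uniformly random bipartite graph with bipartition $(S,T)$ and exactly $m$ edges. For $\ell=n$, $\vec{\mathcal{G}}(n,m)$ is $\mathcal{G}(n,n,m)$ conditioned on having no edge of the form $aa'$ (equivalently, a uniformly random loopless digraph on $n$ vertices with $m$ arcs; $\mathbf{s}$ is the out-degree sequence and $\mathbf{t}$ the in-degree sequence). Notation: $\delta^{\mathrm{di}}$ is $1$ in the digraph case and $0$ in the bipartite case (in which case terms with the factor $\delta^{\mathrm{di}}$ are absent); $\sigma^2(\mathbf{s})=\frac1\ell\sum_{a\in S}(s_a-s)^2$ and $\sigma^2(\mathbf{t})=\frac1n\sum_{v\in T}(t_v-t)^2$. *)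

(* Defs.v *)
From HB Require Import structures.
From mathcomp Require Import all_boot all_order all_algebra.
From mathcomp Require Import all_classical all_reals all_analysis.
Set Implicit Arguments.
Unset Strict Implicit.
Unset Printing Implicit Defensive.
Import Order.TTheory GRing.Theory Num.Theory.
Import numFieldNormedType.Exports.
Local Open Scope ring_scope.

(* Vertices are numbered from 0 within each side: 'I_l stands for S = [l] and
   'I_n for T = [n + l] \ [l]. For l = n the vertex a' (resp. v') is thus the
   vertex of the opposite side with the same index as a (resp. v). *)
Definition bigraph (l n : nat) : finType := {set 'I_l * 'I_n}.

Definition degrees (l n : nat) : Type :=
  ({ffun 'I_l -> nat} * {ffun 'I_n -> nat})%type.

Definition degree_seq l n (G : bigraph l n) : degrees l n :=
  ([ffun a : 'I_l => #|[set v : 'I_n | (a, v) \in G]%SET|],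
   [ffun v : 'I_n => #|[set a : 'I_l | (a, v) \in G]%SET|]).

Definition no_prime_edge l n (G : bigraph l n) : bool :=
  [forall a : 'I_l, forall v : 'I_n,
     (val a == val v) ==> ((a, v) \notin G)].

(* The support of the uniform random graph: the digraph model if [di] (only
   meant for l = n), the bipartite model otherwise. *)
Definition graph_model (di : bool) l n m : {set bigraph l n} :=
  [set G : bigraph l n | (#|G| == m) && (di ==> no_prime_edge G)]%SET.

Definition unif_prob (R : realType) (T : finType) (Omega E : {set T}) : R :=
  #|(Omega :&: E)%SET|%:R / #|Omega|%:R.

Definition cond_prob (R : realType) (T : finType) (Omega E F : {set T}) : R :=
  unif_prob R Omega (E :&: F)%SET / unif_prob R Omega F.

Definition edge_cond_prob (R : realType) (di : bool) l n m
    (d : degrees l n) (a : 'I_l) (v : 'I_n) : R :=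
  cond_prob R (graph_model di l n m)
    [set G : bigraph l n | (a, v) \in G]%SET
    [set G : bigraph l n | degree_seq G == d]%SET.

Definition near_regular (R : realType) (phi : R) l n m
    (d : degrees l n) : Prop :=
  let s : R := m%:R / l%:R in
  let t : R := m%:R / n%:R in
  [/\ (\sum_a d.1 a)%N = m,
      (\sum_v d.2 v)%N = m,
      forall a, `|(d.1 a)%:R - s| <= s `^ phi
    & forall v, `|(d.2 v)%:R - t| <= t `^ phi].

(* The mean square deviation of f from c; here c is always the mean of f. *)
Definition sigma2 (R : realType) k (f : {ffun 'I_k -> nat}) (c : R) : R :=
  k%:R^-1 * \sum_(i < k) ((f i)%:R - c) ^+ 2.

(* The value of f at a numerical index, 0 if out of range. For l = n this
   reads t_{a'} and s_{v'} off t and s without a cast from 'I_l to 'I_n. *)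
Definition at_index k (f : {ffun 'I_k -> nat}) (i : nat) : nat :=
  oapp f 0%N (insub i).

(* [err] is the O(.) term. *)
Definition edge_formula (R : realType) (di : bool) l n m
    (d : degrees l n) (a : 'I_l) (v : 'I_n) (err : R) : R :=
  let s : R := m%:R / l%:R in
  let t : R := m%:R / n%:R in
  let sa : R := (d.1 a)%:R in
  let tv : R := (d.2 v)%:R in
  let ta' : R := (at_index d.2 a)%:R in
  let sv' : R := (at_index d.1 v)%:R in
  let delta : R := di%:R in
  sa * tv / (m%:R - delta * t) *
  (1 - (sa - s) * (tv - t) / (m%:R - delta * t - t * s)
     + (sa - s) * sigma2 d.2 t / (t * s * (l%:R - t))
     + (tv - t) * sigma2 d.1 s / (t * s * (n%:R - s))
     + delta / (n%:R - 1) * ((ta' - t) / t + (sv' - s) / s)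
     + err).

(* Main.v *)
(* Deleting the edge av, and moving an edge within a column from one row to
   another, express the probabilities of edges av and of paths avb for a degree
   sequence d through those for sequences with one edge less.  In the sparse
   range this recursion contracts errors by a factor O(mu), mu = m/(nl).  Explicit
   functions of the degrees satisfy it up to a relative error O(mu e^4), where
   e = min(s,t)^(phi-1).  Crude switching bounds start the iteration; O(log n)
   steps, which only meet degree sequences O(log n) edges below d, bring the edge
   probabilities to these functions with that precision. *)

(* In the ratio P av / P bv, the edge and path probabilities of shorter sequences occur only inside
   factors 1 - O(mu), so a relative error h in them changes the ratio by O(mu h): this is the
   contraction. Path probabilities inherit the edge error without such a gain, so a round is an edge
   step followed by a path step and uses up two levels of deleted edges. One more edge step at the
   end improves e^4 to mu e^4, the claimed error. Closeness is proved at once for all sequences with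
   a given number of deletions, while the mean squares and the deviations at excluded vertices stay
   frozen at d. Deleting k edges shifts the average deviation by k / m, which has to stay below mu
   e^4; k <= r^(4 phi - 2) with r = min(s, t) ensures it, and the logarithmic hypothesis with K = 1
   / (2 phi - 1) leaves room for the O(log n) rounds. Both models are covered by a relation [fb] of
   forbidden pairs with exactly [dl] pairs, 0 or 1, in each row and column. That the explicit
   functions solve the recursion is a polynomial identity modulo weight 4, checked by computation
   with graded expressions. *)
Require Import Defs.
From mathcomp Require Import all_boot all_order all_algebra.
From mathcomp Require Import all_classical all_reals all_analysis.
From mathcomp Require Import ring lra zify.
Set Implicit Arguments.
Unset Strict Implicit.
Unset Printing Implicit Defensive.
Import Order.TTheory GRing.Theory Num.Theory.
Import numFieldNormedType.Exports.
Local Open Scope ring_scope.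
(** * Expressions graded by powers of a small parameter *)

Section WeightedExpressions.
Variable R : realFieldType.

(* A polynomial expression whose leaf [WLeaf k x] carries a real x known to be
   O(e^k) for the small parameter e. *)
Inductive wexpr : Type :=
| WLeaf of nat & R
| WAdd of wexpr & wexpr
| WOpp of wexpr
| WMul of wexpr & wexpr.

Fixpoint weval (t : wexpr) : R :=
  match t with
  | WLeaf _ x => x
  | WAdd t1 t2 => weval t1 + weval t2
  | WOpp t1 => - weval t1
  | WMul t1 t2 => weval t1 * weval t2
  end.

(* Components are optional so that absent ones drop out of the products. *)
Definition oadd (x y : option R) : option R :=
  match x, y with
  | Some x, Some y => Some (x + y)
  | Some x, None => Some x
  | None, y => y
  end.

Definition omul (x y : option R) : option R :=
  match x, y with
  | Some x, Some y => Some (x * y)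
  | _, _ => None
  end.

Fixpoint wcomp (t : wexpr) (k : nat) : option R :=
  match t with
  | WLeaf j x => if j == k then Some x else None
  | WAdd t1 t2 => oadd (wcomp t1 k) (wcomp t2 k)
  | WOpp t1 => omap -%R (wcomp t1 k)
  | WMul t1 t2 =>
      let c1 := wcomp t1 in let c2 := wcomp t2 in
      match k with
      | 0 => omul (c1 0) (c2 0)
      | 1 => oadd (omul (c1 0) (c2 1)) (omul (c1 1) (c2 0))
      | 2 => oadd (omul (c1 0) (c2 2))
               (oadd (omul (c1 1) (c2 1)) (omul (c1 2) (c2 0)))
      | 3 => oadd (oadd (omul (c1 0) (c2 3)) (omul (c1 1) (c2 2)))
               (oadd (omul (c1 2) (c2 1)) (omul (c1 3) (c2 0)))
      | _ => None
      end%N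
  end.

(** The factor 15 is the number of products left over in [wmul_tail]; a component of weight below 4
    of a product has at most 4 terms. *)
Fixpoint wbound (K : R) (t : wexpr) : R :=
  match t with
  | WLeaf _ _ => K
  | WAdd t1 t2 => wbound K t1 + wbound K t2
  | WOpp t1 => wbound K t1
  | WMul t1 t2 => 15 * (wbound K t1 * wbound K t2)
  end.

Fixpoint wleaves (K e : R) (t : wexpr) : Prop :=
  match t with
  | WLeaf k x => `|x| <= K * e ^+ k
  | WAdd t1 t2 | WMul t1 t2 => wleaves K e t1 /\ wleaves K e t2
  | WOpp t1 => wleaves K e t1
  end.

Let cf t k : R := odflt 0 (wcomp t k).

Let oaddE x y : odflt 0 (oadd x y) = odflt 0 x + odflt 0 y.
Proof. by case: x y => [x|] [y|] //=; rewrite ?addr0 ?add0r. Qed.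
Let omulE x y : odflt 0 (omul x y) = odflt 0 x * odflt 0 y.
Proof. by case: x y => [x|] [y|] //=; rewrite ?mulr0 ?mul0r. Qed.

Let wmul_tail (e A B a0 a1 a2 a3 a b0 b1 b2 b3 b : R) : 0 <= e <= 1 ->
  `|b0| <= B * e ^+ 0 -> `|b1| <= B * e ^+ 1 -> `|b2| <= B * e ^+ 2 ->
  `|b3| <= B * e ^+ 3 -> `|b - (b0 + b1 + b2 + b3)| <= B * e ^+ 4 ->
  `|a0| <= A * e ^+ 0 -> `|a1| <= A * e ^+ 1 -> `|a2| <= A * e ^+ 2 ->
  `|a3| <= A * e ^+ 3 -> `|a - (a0 + a1 + a2 + a3)| <= A * e ^+ 4 ->
  [/\ `|a0 * b0| <= 15 * (A * B) * e ^+ 0,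
      `|a0 * b1 + a1 * b0| <= 15 * (A * B) * e ^+ 1,
      `|a0 * b2 + a1 * b1 + a2 * b0| <= 15 * (A * B) * e ^+ 2 &
      `|a0 * b3 + a1 * b2 + a2 * b1 + a3 * b0| <= 15 * (A * B) * e ^+ 3] /\
  `|a * b - (a0 * b0 + (a0 * b1 + a1 * b0) + (a0 * b2 + a1 * b1 + a2 * b0)
     + (a0 * b3 + a1 * b2 + a2 * b1 + a3 * b0))| <= 15 * (A * B) * e ^+ 4.
Proof.
move=> /andP[e0 e1].
set s := a0 + a1 + a2 + a3; set q := a - s; set r := b - (b0 + b1 + b2 + b3).
move=> h0 h1 h2 h3 hr g0 g1 g2 g3 gq.
have A0 : 0 <= A by move: g0; rewrite expr0 mulr1; apply: le_trans.
have B0 : 0 <= B by move: h0; rewrite expr0 mulr1; apply: le_trans.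
have AB0 : 0 <= A * B by rewrite mulr_ge0.
have p i j k x y : `|x| <= A * e ^+ i -> `|y| <= B * e ^+ j -> (k <= i + j)%N ->
    `|x * y| <= A * B * e ^+ k.
  move=> hx hy ij; rewrite normrM; apply: (le_trans (ler_pM _ _ hx hy)) => //.
  rewrite mulrACA -exprD ler_wpM2l //.
  by rewrite -(subnKC ij) exprD ler_piMr ?exprn_ge0 // exprn_ile1.
have E k : 0 <= A * B * e ^+ k by rewrite mulr_ge0 // exprn_ge0.
have tri (x y c d : R) : `|x| <= c -> `|y| <= d -> `|x + y| <= c + d.
  by move=> ? ?; apply: le_trans (ler_normD _ _) (lerD _ _).
have up n k c : c = n%:R * (A * B * e ^+ k) -> (n <= 15)%N ->
    c <= 15 * (A * B) * e ^+ k.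
  move=> -> n15; rewrite -[leRHS]mulrA ler_wpM2r ?E //.
  by rewrite ler_nat.
split; first split.
- apply: le_trans (p _ _ 0%N _ _ g0 h0 isT) _; apply: (up 1%N) => //; ring.
- apply: le_trans (tri _ _ _ _ (p _ _ 1%N _ _ g0 h1 isT)
    (p _ _ 1%N _ _ g1 h0 isT)) _.
  by apply: (up 2%N) => //; ring.
- apply: le_trans (tri _ _ _ _ (tri _ _ _ _ (p _ _ 2%N _ _ g0 h2 isT)
    (p _ _ 2%N _ _ g1 h1 isT)) (p _ _ 2%N _ _ g2 h0 isT)) _.
  by apply: (up 3%N) => //; ring.
- apply: le_trans (tri _ _ _ _ (tri _ _ _ _ (tri _ _ _ _
    (p _ _ 3%N _ _ g0 h3 isT) (p _ _ 3%N _ _ g1 h2 isT))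
    (p _ _ 3%N _ _ g2 h1 isT)) (p _ _ 3%N _ _ g3 h0 isT)) _.
  by apply: (up 4%N) => //; ring.
(* Six products of components with total weight at least 4, four with the remainder of b, five with
   the remainder of a. *)
have -> : a * b - (a0 * b0 + (a0 * b1 + a1 * b0) + (a0 * b2 + a1 * b1 + a2 * b0)
     + (a0 * b3 + a1 * b2 + a2 * b1 + a3 * b0)) =
  a1 * b3 + a2 * b2 + a3 * b1 + a2 * b3 + a3 * b2 + a3 * b3 +
  a0 * r + a1 * r + a2 * r + a3 * r + q * r +
  q * b0 + q * b1 + q * b2 + q * b3 by rewrite /q /r /s; ring.
apply: le_trans (tri _ _ _ _ (tri _ _ _ _ (tri _ _ _ _ (tri _ _ _ _
  (tri _ _ _ _ (tri _ _ _ _ (tri _ _ _ _ (tri _ _ _ _ (tri _ _ _ _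
  (tri _ _ _ _ (tri _ _ _ _ (tri _ _ _ _ (tri _ _ _ _ (tri _ _ _ _
  (p _ _ 4%N _ _ g1 h3 isT) (p _ _ 4%N _ _ g2 h2 isT)) (p _ _ 4%N _ _ g3 h1 isT))
  (p _ _ 4%N _ _ g2 h3 isT)) (p _ _ 4%N _ _ g3 h2 isT)) (p _ _ 4%N _ _ g3 h3 isT))
  (p _ _ 4%N _ _ g0 hr isT)) (p _ _ 4%N _ _ g1 hr isT)) (p _ _ 4%N _ _ g2 hr isT))
  (p _ _ 4%N _ _ g3 hr isT)) (p _ _ 4%N _ _ gq hr isT)) (p _ _ 4%N _ _ gq h0 isT))
  (p _ _ 4%N _ _ gq h1 isT)) (p _ _ 4%N _ _ gq h2 isT)) (p _ _ 4%N _ _ gq h3 isT)) _.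
by apply: (up 15%N) => //; ring.
Qed.

Lemma wexpr_tail (K e : R) (t : wexpr) : 0 <= K -> 0 <= e <= 1 ->
  wleaves K e t ->
  (forall k, (k < 4)%N -> `|cf t k| <= wbound K t * e ^+ k) /\
  `|weval t - (cf t 0 + cf t 1 + cf t 2 + cf t 3)| <= wbound K t * e ^+ 4.
Proof.
move=> K0 e01; have /andP[e0 e1] := e01; elim: t => [j x|t1 IH1 t2 IH2|t1 IH1|t1 IH1 t2 IH2] /=.
- move=> Hx; split=> [k k4|].
    rewrite /cf /=; case: eqP => [<- //|_] /=.
    by rewrite normr0 mulr_ge0 // exprn_ge0.
  have [j4|j4] := ltnP j 4.
    suff -> : x - (cf (WLeaf j x) 0 + cf (WLeaf j x) 1 + cf (WLeaf j x) 2
      + cf (WLeaf j x) 3) = 0 by rewrite normr0 mulr_ge0 // exprn_ge0.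
    by case: j j4 {Hx} => [|[|[|[|//]]]] _; rewrite /cf /=; ring.
  have -> : x - (cf (WLeaf j x) 0 + cf (WLeaf j x) 1 + cf (WLeaf j x) 2
      + cf (WLeaf j x) 3) = x.
    by case: j j4 {Hx} => [|[|[|[|j]]]] // _; rewrite /cf /=; ring.
  apply: (le_trans Hx); rewrite ler_wpM2l //.
  by rewrite -(subnKC j4) exprD ler_piMr ?exprn_ge0 // exprn_ile1.
- case=> /IH1[c1 r1] /IH2[c2 r2]; split=> [k k4|].
    rewrite /cf /= oaddE mulrDl; apply: (le_trans (ler_normD _ _)).
    by rewrite lerD ?c1 ?c2.
  have cfD k : cf (WAdd t1 t2) k = cf t1 k + cf t2 k by rewrite /cf /= oaddE.
  have -> : weval t1 + weval t2 - (cf (WAdd t1 t2) 0 + cf (WAdd t1 t2) 1 +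
      cf (WAdd t1 t2) 2 + cf (WAdd t1 t2) 3) =
    (weval t1 - (cf t1 0 + cf t1 1 + cf t1 2 + cf t1 3)) +
    (weval t2 - (cf t2 0 + cf t2 1 + cf t2 2 + cf t2 3)) by rewrite !cfD; ring.
  by rewrite mulrDl; apply: le_trans (ler_normD _ _) (lerD r1 r2).
- move/IH1=> [c1 r1].
  have ocf k : cf (WOpp t1) k = - cf t1 k.
    by rewrite /cf /=; case: (wcomp t1 k) => //=; rewrite oppr0.
  split=> [k k4|]; first by rewrite ocf normrN c1.
  by rewrite !ocf -!opprD normrN.
case=> /IH1[c1 r1] /IH2[c2 r2].
have cfM0 : cf (WMul t1 t2) 0 = cf t1 0 * cf t2 0 by rewrite /cf /= omulE.
have cfM1 : cf (WMul t1 t2) 1 = cf t1 0 * cf t2 1 + cf t1 1 * cf t2 0.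
  by rewrite /cf /= !(oaddE, omulE).
have cfM2 : cf (WMul t1 t2) 2 =
    cf t1 0 * cf t2 2 + cf t1 1 * cf t2 1 + cf t1 2 * cf t2 0.
  by rewrite /cf /= !(oaddE, omulE) addrA.
have cfM3 : cf (WMul t1 t2) 3 = cf t1 0 * cf t2 3 + cf t1 1 * cf t2 2
    + cf t1 2 * cf t2 1 + cf t1 3 * cf t2 0.
  by rewrite /cf /= !(oaddE, omulE) !addrA.
move: (c1 0 isT) (c1 1 isT) (c1 2 isT) (c1 3 isT) r1 => {c1 IH1}.
move: (c2 0 isT) (c2 1 isT) (c2 2 isT) (c2 3 isT) r2 => {c2 IH2}.
rewrite cfM0 cfM1 cfM2 cfM3.
move=> b0 b1 b2 b3 br a0 a1 a2 a3 ar.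
have [[h0 h1 h2 h3] hr] :=
  wmul_tail e01 b0 b1 b2 b3 br a0 a1 a2 a3 ar.
split=> // -[|[|[|[|//]]]] _; by rewrite ?cfM0 ?cfM1 ?cfM2 ?cfM3.
Qed.

Lemma wexpr_small (K e : R) (t : wexpr) : 0 <= K -> 0 <= e <= 1 ->
  wleaves K e t ->
  odflt 0 (wcomp t 0) = 0 -> odflt 0 (wcomp t 1) = 0 ->
  odflt 0 (wcomp t 2) = 0 -> odflt 0 (wcomp t 3) = 0 ->
  `|weval t| <= wbound K t * e ^+ 4.
Proof.
move=> K0 e01 Ht t0 t1 t2 t3; have [_] := wexpr_tail K0 e01 Ht.
by rewrite /cf t0 t1 t2 t3 !addr0 subr0.
Qed.

End WeightedExpressions.

(** The weight of an atom is read off a hypothesis bounding its norm, and an inverse is replaced by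
    the local definition that names it. Apart from these only sums, products, opposites and 1 are
    recognised, which is why the identities below are written with [1 + 1] and [y * y]. *)
Ltac wreify t :=
  lazymatch t with
  | GRing.add ?a ?b => let a' := wreify a in let b' := wreify b in
               constr:(WAdd a' b')
  | GRing.mul ?a ?b => let a' := wreify a in let b' := wreify b in
               constr:(WMul a' b')
  | GRing.opp ?a => let a' := wreify a in constr:(WOpp a')
  | GRing.one _ => constr:(WLeaf 0 t)
  | GRing.inv _ => match goal with
         | c := GRing.inv _ |- _ => constr:(WLeaf 0 c)
         end
  | _ => match goal with
         | H : is_true (Order.le (Num.norm t) (GRing.mul _ (GRing.exp _ ?k))) |- _ => constr:(WLeaf k t)
         end
  end.

(* The bound found for a polynomial depends only on its shape and on K, so that
   it can instantiate a constant fixed before the variables. *)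
Ltac wsmall K0 e01 :=
  match goal with
  | |- is_true (Order.le (Num.norm ?X) _) =>
      let t := wreify X in
      refine (le_trans (wexpr_small (t := t) K0 e01 _ _ _ _ _) _);
      [ by rewrite /= ; do ?split | | | | | cbn [wbound]; exact: lexx ]
  end.

(** * Explicit approximations and the identities they satisfy modulo e^4 *)

Section FormalSolution.
Variable R : realFieldType.
Variables mu Sx Sy tau tau' dl : R.

Let c := (1 - mu)^-1.

(* [edge_apx] and [path_apx], multiplied by mu and mu^2, are the conjectured
   probabilities of the edge av and of the path avb: x, xa, xb and y are the
   relative deviations of the degrees of a, b and v from their means, Sx and Sy
   the mean squares of these deviations, z and w the deviations at the vertices
   excluded as neighbours of a (or b) and of v, tau = 1/s and tau' = 1/t. *)
Definition edge_corr (x y z w : R) : R :=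
  c * (- (x * y) + x * Sy + y * Sx) + tau * (z + w).

Definition edge_apx (x y z w : R) : R :=
  (1 + x) * (1 + y) * (1 + mu * edge_corr x y z w).

(** For equal row degrees the neighbourhood of v resembles a uniform set of t_v rows out of l, and
    (1 - 1/t_v) / (1 - 1/l) is 1 + tau' (-(1 - mu) + y) up to weight 4. The term mu (xa + xb) is the
    first correction for unequal rows. *)
Definition path_corr (xa xb y : R) : R :=
  tau' * (- (1 - mu) + y + mu * (xa + xb)).

Definition path_apx (xa xb y za zb w : R) : R :=
  edge_apx xa y za w * edge_apx xb y zb w * (1 + path_corr xa xb y).

(* The expected number of common neighbours of a and b is
   s mu (1 + xa) (1 + xb) (1 + codeg_corr). *)
Definition codeg_corr (xa xb za zb : R) : R :=
  Sy - (1 - mu) * tau' - dl * (mu * tau)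
  - mu * c * (xa + xb) * (Sy - (1 - mu) * tau') - mu * tau * (za + zb).

(* The fraction of the edges at b which cannot be moved to a is mu ratio_loss. *)
Definition ratio_loss (xa xb za zb : R) : R :=
  (1 + xa) * (1 + codeg_corr xa xb za zb) + tau * (dl + za).

End FormalSolution.

Section FormalIdentities.
Variable R : realFieldType.

(** [mu] and [dl] have weight 0, as the identities must hold at a fixed density and powers of mu may
    not count as small. One constant 2 serves all leaves: deviations are at most e for the initial
    sequence and at most 2 e after the deletions. *)
Record small_params (e mu Sx Sy tau tau' dl : R) : Prop := SmallParams {
  sp_e : 0 < e <= 1;
  sp_mu : 0 < mu <= 1 / 2;
  sp_Sx : `|Sx| <= 2 * e ^+ 2;
  sp_Sy : `|Sy| <= 2 * e ^+ 2;
  sp_tau : `|tau| <= 2 * e ^+ 2;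
  sp_tau' : `|tau'| <= 2 * e ^+ 2;
  sp_dl : `|dl| <= 2 * e ^+ 0 }.

Lemma small_params_leaves e mu Sx Sy tau tau' dl :
  small_params e mu Sx Sy tau tau' dl ->
  [/\ 0 <= e <= 1, `|1 : R| <= 2 * e ^+ 0, `|mu| <= 2 * e ^+ 0,
      1 - mu != 0 & `|(1 - mu)^-1| <= 2 * e ^+ 0].
Proof.
case=> /andP[e0 e1] /andP[m0 m1] _ _ _ _ _.
split; first by rewrite ltW.
- by rewrite normr1 expr0; lra.
- by rewrite expr0 mulr1 gtr0_norm //; lra.
- by rewrite subr_eq0 gt_eqF //; lra.
- rewrite expr0 mulr1 gtr0_norm ?invr_gt0 ?subr_gt0; last by lra.
  by rewrite invf_ple ?posrE //; lra.
Qed.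

Ltac intro_params e mu :=
  let H := fresh "H" in
  move=> H; have H2 : 0 <= 2 :> R := ler0n _ _;
  pose c := (1 - mu)^-1;
  have [e01 H1 Hmu mun] := small_params_leaves H; move=> Hc;
  case: H => _ _ HSx HSy Htau Htau' Hdl.

(** Mirrors [path_pr_rec] divided by mu^2: deleting the edge av lowers the deviation of a by [tau]
    and that of v by [tau']. *)
Lemma path_apx_recursion : exists2 C : R, 0 <= C &
  forall e mu Sx Sy tau tau' dl : R, small_params e mu Sx Sy tau tau' dl ->
  forall xa xb y za zb w : R,
  `|xa| <= 2 * e ^+ 1 -> `|xb| <= 2 * e ^+ 1 -> `|y| <= 2 * e ^+ 1 ->
  `|za| <= 2 * e ^+ 1 -> `|zb| <= 2 * e ^+ 1 -> `|w| <= 2 * e ^+ 1 ->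
  let ph := edge_apx mu Sx Sy tau in
  let yh := path_apx mu Sx Sy tau tau' in
  `|yh xa xb y za zb w * (1 - mu * ph (xa - tau) (y - tau') za w)
    - ph xa y za w *
      (ph xb (y - tau') zb w - mu * yh (xa - tau) xb (y - tau') za zb w)|
    <= C * e ^+ 4.
Proof.
eexists; last first.
  move=> e mu Sx Sy tau tau' dl; intro_params e mu.
  move=> xa xb y za zb w Hxa Hxb Hy Hza Hzb Hw.
  rewrite /path_apx /edge_apx /edge_corr /path_corr /=.
  wsmall H2 e01.
  (* The inverse of 1 - mu enters only from weight 2 on, so weights 0 and 1 are ring identities,
     while weights 2 and 3 need [field]. *)
  - rewrite /=; ring.
  - rewrite /=; ring.
  - rewrite /= /c; field; exact: mun.
  - rewrite /= /c; field; exact: mun.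
by rewrite /=; do ![apply: addr_ge0|apply: mulr_ge0|done].
Qed.
(** Prepares the sum over v in [codegree_apx]: as a polynomial in y and w, the path function can be
    summed knowing only the sums of y, y^2 and w. *)
Lemma path_apx_expansion : exists2 C : R, 0 <= C &
  forall e mu Sx Sy tau tau' dl : R, small_params e mu Sx Sy tau tau' dl ->
  forall xa xb y za zb w : R,
  `|xa| <= 2 * e ^+ 1 -> `|xb| <= 2 * e ^+ 1 -> `|y| <= 2 * e ^+ 1 ->
  `|za| <= 2 * e ^+ 1 -> `|zb| <= 2 * e ^+ 1 -> `|w| <= 2 * e ^+ 1 ->
  let kap := mu * (1 - mu)^-1 in
  `|path_apx mu Sx Sy tau tau' xa xb y za zb w
    - (1 + xa) * (1 + xb) *
      (1 + kap * (xa + xb) * Sy + mu * tau * (za + zb) - tau' * (1 - mu)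
         + mu * tau' * (xa + xb)
       + ((1 + 1) - kap * (xa + xb) + (1 + 1) * kap * Sx
          + tau' * ((1 + 1) * mu - 1)) * y
       + (1 - (1 + 1) * kap * (xa + xb)) * (y * y)
       + (1 + 1) * (mu * tau) * w)|
    <= C * e ^+ 4.
Proof.
eexists; last first.
  move=> e mu Sx Sy tau tau' dl; intro_params e mu.
  move=> xa xb y za zb w Hxa Hxb Hy Hza Hzb Hw.
  rewrite /path_apx /edge_apx /edge_corr /path_corr /=.
  wsmall H2 e01.
  - rewrite /=; ring.
  - rewrite /=; ring.
  - rewrite /= /c; field; exact: mun.
  - rewrite /= /c; field; exact: mun.
by rewrite /=; do ![apply: addr_ge0|apply: mulr_ge0|done].
Qed.

(** Mirrors [edge_pr_ratio]: once (1 + xa) (1 + xb) (1 + y) is cancelled, its two sides become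
    [side] and [side] with a and b exchanged. Every factor of [side] is 1 + O(mu), so the
    discrepancy carries a factor mu, on which the contraction relies. *)
Lemma edge_ratio_sym : exists2 C : R, 0 <= C &
  forall e mu Sx Sy tau tau' dl : R, small_params e mu Sx Sy tau tau' dl ->
  forall xa xb y za zb w : R,
  `|xa| <= 2 * e ^+ 1 -> `|xb| <= 2 * e ^+ 1 -> `|y| <= 2 * e ^+ 1 ->
  `|za| <= 2 * e ^+ 1 -> `|zb| <= 2 * e ^+ 1 -> `|w| <= 2 * e ^+ 1 ->
  let side xa xb za zb :=
    (1 + mu * edge_corr mu Sx Sy tau xa y za w)
    * (1 - mu * ratio_loss mu Sy tau tau' dl (xa - tau) xb za zb)
    * (1 - mu * edge_apx mu Sx Sy tau (xb - tau) (y - tau') zb w) in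
  `|side xa xb za zb - side xb xa zb za| <= mu * (C * e ^+ 4).
Proof.
eexists; last first.
  move=> e mu Sx Sy tau tau' dl Hsp.
  have mu0 : 0 < mu by case: Hsp => _ /andP[].
  move: Hsp; intro_params e mu.
  move=> xa xb y za zb w Hxa Hxb Hy Hza Hzb Hw /=.
  (* The factor mu is extracted by hand, because the weights do not see it. *)
  have factor (U V W U1 V1 W1 : R) :
    (1 + mu * U) * (1 - mu * V) * (1 - mu * W)
    - (1 + mu * U1) * (1 - mu * V1) * (1 - mu * W1) =
    mu * (U - V - W + mu * (V * W - U * V - U * W) + mu * mu * (U * V * W)
     - (U1 - V1 - W1 + mu * (V1 * W1 - U1 * V1 - U1 * W1)
        + mu * mu * (U1 * V1 * W1))) by ring.
  rewrite factor normrM (gtr0_norm mu0) ler_pM2l //.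
  rewrite /ratio_loss /codeg_corr /edge_apx /edge_corr /=.
  wsmall H2 e01.
  - rewrite /=; ring.
  - rewrite /=; ring.
  - rewrite /= /c; field; exact: mun.
  - rewrite /= /c; field; exact: mun.
by rewrite /=; do ![apply: addr_ge0|apply: mulr_ge0|done].
Qed.

Definition formal_identities (CA e mu Sx Sy tau tau' dl : R) : Prop :=
  forall xa xb y za zb w : R,
  `|xa| <= 2 * e ^+ 1 -> `|xb| <= 2 * e ^+ 1 -> `|y| <= 2 * e ^+ 1 ->
  `|za| <= 2 * e ^+ 1 -> `|zb| <= 2 * e ^+ 1 -> `|w| <= 2 * e ^+ 1 ->
  [/\ let ph := edge_apx mu Sx Sy tau in
      let yh := path_apx mu Sx Sy tau tau' in
      `|yh xa xb y za zb w * (1 - mu * ph (xa - tau) (y - tau') za w)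
        - ph xa y za w *
          (ph xb (y - tau') zb w - mu * yh (xa - tau) xb (y - tau') za zb w)|
      <= CA * e ^+ 4,
      let kap := mu * (1 - mu)^-1 in
      `|path_apx mu Sx Sy tau tau' xa xb y za zb w
        - (1 + xa) * (1 + xb) *
          (1 + kap * (xa + xb) * Sy + mu * tau * (za + zb) - tau' * (1 - mu)
             + mu * tau' * (xa + xb)
           + ((1 + 1) - kap * (xa + xb) + (1 + 1) * kap * Sx
              + tau' * ((1 + 1) * mu - 1)) * y
           + (1 - (1 + 1) * kap * (xa + xb)) * (y * y)
           + (1 + 1) * (mu * tau) * w)| <= CA * e ^+ 4
    & let side xa xb za zb :=
        (1 + mu * edge_corr mu Sx Sy tau xa y za w)
        * (1 - mu * ratio_loss mu Sy tau tau' dl (xa - tau) xb za zb)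
        * (1 - mu * edge_apx mu Sx Sy tau (xb - tau) (y - tau') zb w) in
      `|side xa xb za zb - side xb xa zb za| <= mu * (CA * e ^+ 4)].

Lemma formal_identities_uniform : exists2 CA : R, 0 <= CA &
  forall e mu Sx Sy tau tau' dl : R, small_params e mu Sx Sy tau tau' dl ->
  formal_identities CA e mu Sx Sy tau tau' dl.
Proof.
have [C1 C10 H1] := path_apx_recursion.
have [C2 C20 H2] := path_apx_expansion.
have [C3 C30 H3] := edge_ratio_sym.
exists (C1 + C2 + C3); first by rewrite !addr_ge0.
move=> e mu Sx Sy tau tau' dl sp xa xb y za zb w h1 h2 h3 h4 h5 h6.
have e40 : 0 <= e ^+ 4 by case: sp => /andP[e0 _] *; rewrite exprn_ge0 // ltW.
have mu0 : 0 <= mu by case: sp => _ /andP[m0 _] *; exact: ltW.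
have mono C C' : C <= C' -> C * e ^+ 4 <= C' * e ^+ 4 by move=> ?; apply: ler_wpM2r.
split.
- apply: le_trans (H1 _ _ _ _ _ _ _ sp _ _ _ _ _ _ h1 h2 h3 h4 h5 h6) _.
  by apply: mono; rewrite -addrA lerDl addr_ge0.
- apply: le_trans (H2 _ _ _ _ _ _ _ sp _ _ _ _ _ _ h1 h2 h3 h4 h5 h6) _.
  by apply: mono; rewrite -addrA addrCA lerDl addr_ge0.
- apply: le_trans (H3 _ _ _ _ _ _ _ sp _ _ _ _ _ _ h1 h2 h3 h4 h5 h6) _.
  by apply: ler_wpM2l => //; apply: mono; rewrite lerDr addr_ge0.
Qed.

End FormalIdentities.

(** * Counting graphs by switchings *)

Section Counting.
Variables (l n : nat) (fb : 'I_l -> 'I_n -> bool).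
Local Open Scope nat_scope.
Implicit Types (G : bigraph l n) (d : degrees l n) (a b : 'I_l) (v u : 'I_n).

Definition incr d a v : degrees l n :=
  ([ffun i => d.1 i + (i == a)], [ffun j => d.2 j + (j == v)]).

Definition decr d a v : degrees l n :=
  ([ffun i => d.1 i - (i == a)], [ffun j => d.2 j - (j == v)]).

Lemma incr_decr d a v : 0 < d.1 a -> 0 < d.2 v -> incr (decr d a v) a v = d.
Proof.
case: d => s t /= sa tv; congr pair; apply/ffunP => i; rewrite !ffunE /=.
- by case: eqP => [->|_]; rewrite ?subnK // subn0 addn0.
- by case: eqP => [->|_]; rewrite ?subnK // subn0 addn0.
Qed.

Lemma degree1E G a : (degree_seq G).1 a = \sum_v ((a, v) \in G).
Proof.
rewrite ffunE -sum1_card big_mkcond /=; apply: eq_bigr => v _.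
by rewrite inE; case: (_ \in _).
Qed.

Lemma degree2E G v : (degree_seq G).2 v = \sum_a ((a, v) \in G).
Proof.
rewrite ffunE -sum1_card big_mkcond /=; apply: eq_bigr => a _.
by rewrite inE; case: (_ \in _).
Qed.

Lemma card_degree1 G : #|G| = \sum_a (degree_seq G).1 a.
Proof.
rewrite (eq_bigr _ (fun a _ => degree1E G a)) pair_big /= -sum1_card.
by rewrite big_mkcond /=; apply: eq_bigr => -[a v] _ /=; case: (_ \in _).
Qed.

Lemma card_degree2 G : #|G| = \sum_v (degree_seq G).2 v.
Proof.
rewrite card_degree1 (eq_bigr _ (fun a _ => degree1E G a)) exchange_big /=.
by apply: eq_bigr => v _; rewrite degree2E.
Qed.

Lemma degree_addE G a v : (a, v) \notin G ->
  degree_seq ((a, v) |: G)%SET = incr (degree_seq G) a v.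
Proof.
move=> avG; rewrite [LHS]surjective_pairing; congr pair; apply/ffunP => i.
- rewrite degree1E ffunE degree1E /=.
  rewrite (bigD1 v) //= [in RHS](bigD1 v) //= !inE !xpair_eqE eqxx andbT.
  rewrite -addnA (eq_bigr (fun j => ((i, j) \in G) : nat)) => [|j /negPf jv].
    have [->|ia] := eqVneq i a; first by rewrite (negPf avG) addnC.
    by rewrite addn0.
  by rewrite !inE xpair_eqE jv andbF.
- rewrite degree2E ffunE degree2E /=.
  rewrite (bigD1 a) //= [in RHS](bigD1 a) //= !inE !xpair_eqE eqxx /=.
  rewrite -addnA (eq_bigr (fun j => ((j, i) \in G) : nat)) => [|j /negPf ja].
    have [->|iv] := eqVneq i v; first by rewrite (negPf avG) addnC.
    by rewrite addn0.
  by rewrite !inE xpair_eqE ja.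
Qed.

Definition admissible G := [forall a, forall v, fb a v ==> ((a, v) \notin G)].

Lemma admissibleP G : reflect (forall a v, (a, v) \in G -> ~~ fb a v)
  (admissible G).
Proof.
apply: (iffP forallP) => [H a v avG|H a].
  by have /forallP/(_ v) := H a; rewrite avG implybF.
by apply/forallP=> v; apply/implyP; apply: contraL => /H.
Qed.

Lemma admissible_add G a v : ~~ fb a v ->
  admissible ((a, v) |: G)%SET = admissible G.
Proof.
move=> fav; apply/admissibleP/admissibleP => H b u; last first.
  by rewrite !inE => /orP[/eqP[-> ->]|/H].
by move=> buG; apply: H; rewrite !inE buG orbT.
Qed.

Lemma admissible_del G a v : admissible G -> admissible (G :\ (a, v))%SET.
Proof. by move/admissibleP => H; apply/admissibleP => b u; rewrite !inE => /andP[_ /H]. Qed.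

Definition realizations d : {set bigraph l n} :=
  [set G : bigraph l n | admissible G & degree_seq G == d]%SET.

Definition count_real d (Q : pred (bigraph l n)) : nat :=
  #|[set G in realizations d | Q G]%SET|.

(** Adding av is a bijection from the realizations of d without av onto those of [incr d a v] with
    av; [Q'] is [Q] transported along it. *)
Lemma count_incr d a v (Q Q' : pred (bigraph l n)) : ~~ fb a v ->
  (forall G, (a, v) \notin G -> Q ((a, v) |: G)%SET = Q' G) ->
  count_real (incr d a v) (fun G => ((a, v) \in G) && Q G) =
  count_real d (fun G => ((a, v) \notin G) && Q' G).
Proof.
move=> fav QQ'; rewrite /count_real.
have inj : {in [set G in realizations d | ((a, v) \notin G) && Q' G]%SET &,
    injective (fun G => (a, v) |: G)%SET}.
  move=> G H; rewrite !inE => /and3P[_ aG _] /and3P[_ aH _] E.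
  by rewrite -(finset.setU1K aG) E finset.setU1K.
rewrite -(card_in_imset inj); apply: eq_card => G; apply/idP/imsetP.
  rewrite !inE => /and3P[/andP[GA /eqP Gd] avG QG].
  have avD : (a, v) \notin (G :\ (a, v))%SET by rewrite !inE eqxx.
  exists (G :\ (a, v))%SET; last by rewrite finset.setD1K.
  rewrite !inE admissible_del //= eqxx /= -QQ' // finset.setD1K // QG andbT.
  apply/eqP; have := degree_addE avD; rewrite finset.setD1K // Gd.
  case: (degree_seq _) => s t; case: d {Gd inj} => s' t' [/ffunP E1 /ffunP E2].
  congr pair; apply/ffunP => i.
    by have := E1 i; rewrite !ffunE => /addIn.
  by have := E2 i; rewrite !ffunE => /addIn.
move=> [H]; rewrite !inE => /and3P[/andP[HA /eqP Hd] avH QH] ->.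
by rewrite admissible_add // HA degree_addE // Hd !inE !eqxx /= QQ'.
Qed.

End Counting.

Section Switchings.
Variables (l n : nat) (fb : 'I_l -> 'I_n -> bool).
Local Open Scope nat_scope.
Implicit Types (G : bigraph l n) (d : degrees l n) (a b : 'I_l) (v u : 'I_n).

Lemma count_realE d Q :
  count_real fb d Q = \sum_(G in realizations fb d) Q G.
Proof.
rewrite /count_real -sum1_card big_mkcond [RHS]big_mkcond /=.
by apply: eq_bigr => G _; rewrite inE; case: (G \in _); case: (Q G).
Qed.

Lemma eq_count_real d Q1 Q2 : Q1 =1 Q2 -> count_real fb d Q1 = count_real fb d Q2.
Proof. by move=> E; rewrite !count_realE; apply: eq_bigr => G _; rewrite E. Qed.

Lemma realizationP d G : G \in realizations fb d ->
  admissible fb G /\ degree_seq G = d.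
Proof. by rewrite inE => /andP[-> /eqP]. Qed.

Lemma count_mem_incr d a v : ~~ fb a v ->
  count_real fb (incr d a v) (fun G => (a, v) \in G) =
  count_real fb d (fun G => (a, v) \notin G).
Proof.
move=> fav; have := @count_incr _ _ fb d a v xpredT xpredT fav (fun _ _ => erefl).
rewrite (eq_count_real _ (fun G => andbT _)) => ->.
by apply: eq_count_real => G; rewrite andbT.
Qed.

Lemma count_mem2_incr d a b v : ~~ fb a v -> b != a ->
  count_real fb (incr d a v) (fun G => ((a, v) \in G) && ((b, v) \in G)) =
  count_real fb d (fun G => ((a, v) \notin G) && ((b, v) \in G)).
Proof.
move=> fav ba; apply: count_incr => // G _.
by rewrite !inE xpair_eqE (negPf ba).
Qed.

Lemma count_memN_incr d a b v : ~~ fb a v -> b != a ->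
  count_real fb (incr d a v) (fun G => ((a, v) \in G) && ((b, v) \notin G)) =
  count_real fb d (fun G => ((a, v) \notin G) && ((b, v) \notin G)).
Proof.
move=> fav ba; apply: count_incr => // G _.
by rewrite !inE xpair_eqE (negPf ba).
Qed.

Lemma count_mem_sum1 d a :
  \sum_v count_real fb d (fun G => (a, v) \in G) =
  #|realizations fb d| * d.1 a.
Proof.
under eq_bigr => v _ do rewrite count_realE.
rewrite exchange_big -sum_nat_const; apply: eq_bigr => G /realizationP[_ <-].
by rewrite degree1E.
Qed.

Lemma count_mem_sum2 d v :
  \sum_a count_real fb d (fun G => (a, v) \in G) =
  #|realizations fb d| * d.2 v.
Proof.
under eq_bigr => a _ do rewrite count_realE.
rewrite exchange_big -sum_nat_const; apply: eq_bigr => G /realizationP[_ <-].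
by rewrite degree2E.
Qed.

Lemma count_mem_fb d a v : fb a v ->
  count_real fb d (fun G => (a, v) \in G) = 0.
Proof.
move=> fav; rewrite count_realE big1 // => G /realizationP[/admissibleP GA _].
by case E: (_ \in _) => //; have := GA _ _ E; rewrite fav.
Qed.

(** The number of ways to choose a realization and an edge of row a that can be moved to row b
    within its column. *)
Definition switchable d a b : nat :=
  \sum_(v | ~~ fb b v) count_real fb d (fun G => ((a, v) \in G) && ((b, v) \notin G)).

Lemma switchable_split d a b :
  #|realizations fb d| * d.1 a = switchable d a b +
  \sum_(v | fb b v) count_real fb d (fun G => (a, v) \in G) +
  \sum_v count_real fb d (fun G => ((a, v) \in G) && ((b, v) \in G)).
Proof.
rewrite -count_mem_sum1 (bigID (fun v => ~~ fb b v)) /=.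
rewrite [\sum_(v : 'I_n) count_real _ _ (fun _ => _ && _)](bigID (fun v => ~~ fb b v)) /=.
rewrite [X in _ = _ + (_ + X)]big1 ?addn0; last first.
  move=> v /negPn fbv; rewrite count_realE big1 // => G /realizationP[/admissibleP GA _].
  by case E: ((b, v) \in G); rewrite ?andbF //; have := GA _ _ E; rewrite fbv.
rewrite addnAC -big_split /=; congr (_ + _); last first.
  by apply: eq_bigl => v; rewrite negbK.
apply: eq_bigr => v _; rewrite !count_realE -big_split /=.
by apply: eq_bigr => G _; case: (_ \in _); case: (_ \in _).
Qed.

(** Moving au to bu turns a realization of d - bv into one of d - av, and moving it back undoes
    this. Column by column, both counts equal the number of graphs with the moving edge deleted and
    neither position occupied. *)
Lemma switchable_sym d a b v : a != b -> 0 < d.1 a -> 0 < d.1 b -> 0 < d.2 v ->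
  switchable (decr d b v) a b = switchable (decr d a v) b a.
Proof.
move=> ab da db dv.
have zero (D : degrees l n) a' b' v' : fb a' v' -> count_real fb D
   (fun G => ((a', v') \in G) && ((b', v') \notin G)) = 0.
  move=> fav; rewrite count_realE big1 // => G /realizationP[/admissibleP GA _].
  by case E: ((a', v') \in G) => //=; have := GA _ _ E; rewrite fav.
(* Columns of degree 0 are set apart because [incr_decr] fails there, subtraction being
   truncated. *)
have zero2 (D : degrees l n) a' b' v' : D.2 v' = 0 -> count_real fb D
   (fun G => ((a', v') \in G) && ((b', v') \notin G)) = 0.
  move=> D0; rewrite count_realE big1 // => G /realizationP[_ GD].
  move: D0; rewrite -GD degree2E => /eqP; rewrite sum_nat_eq0 => /forallP/(_ a').
  by case: ((a', v') \in G).
rewrite /switchable.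
rewrite (bigID (fun v' => ~~ fb a v')) /= [X in _ + X]big1 ?addn0; last first.
  by move=> v' /andP[_ /negPn fav]; exact: zero.
rewrite [in RHS](bigID (fun v' => ~~ fb b v')) /= [X in _ = _ + X]big1 ?addn0; last first.
  by move=> v' /andP[_ /negPn fav]; exact: zero.
apply: eq_big => [v'|v' /andP[fbv fav]]; first by rewrite andbC.
have [D0|Dp] := posnP ((decr d b v).2 v').
  by rewrite !zero2 //; move: D0; rewrite !ffunE.
set h := decr (decr d b v) a v'.
have Ea : decr d b v = incr h a v'.
  by rewrite incr_decr // !ffunE (negPf ab) subn0.
have Eb : decr d a v = incr h b v'.
  move: Dp; rewrite !ffunE => Dp.
  rewrite /h /incr /decr /=; congr pair; apply/ffunP => i; rewrite !ffunE.
    have [->|ib] := eqVneq i b; last by rewrite addn0 subnAC subn0.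
    by rewrite eq_sym (negPf ab) !subn0 subnK.
  by have [->|iv] := eqVneq i v'; rewrite ?subn0 ?addn0 // subnK.
rewrite Ea Eb !count_memN_incr 1?eq_sym //; last by rewrite eq_sym.
by rewrite !count_realE; apply: eq_bigr => G _; rewrite andbC.
Qed.

End Switchings.

(** * Exchanging two edges: crude bounds and existence of realizations *)

Section DoubleSwitchings.
Variables (l n : nat) (fb : 'I_l -> 'I_n -> bool).
Local Open Scope nat_scope.
Implicit Types (G : bigraph l n) (d : degrees l n) (a b c : 'I_l) (v u : 'I_n).
Hypothesis fb1 : forall a, \sum_v fb a v <= 1.
Hypothesis fb2 : forall v, \sum_a fb a v <= 1.

Definition far_edges G a v : {set 'I_l * 'I_n} :=
  [set p in G | [&& (a, p.2) \notin G, ~~ fb a p.2, (p.1, v) \notin G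
                 & ~~ fb p.1 v]]%SET.

(** An edge cu is excluded only if u is adjacent to a or forbidden for a, or c is adjacent to v or
    forbidden for v. The successors account for the at most one forbidden vertex. *)
Lemma card_far_edges G a v Sm Tm :
  (forall b, (degree_seq G).1 b <= Sm) -> (forall u, (degree_seq G).2 u <= Tm) ->
  #|G| <= #|far_edges G a v| + ((degree_seq G).1 a).+1 * Tm
          + ((degree_seq G).2 v).+1 * Sm.
Proof.
move=> GS GT.
have split_sum : #|G| <= #|far_edges G a v|
    + \sum_u ((a, u) \in G) * (degree_seq G).2 u
    + \sum_u (fb a u) * (degree_seq G).2 u
    + \sum_b ((b, v) \in G) * (degree_seq G).1 b
    + \sum_b (fb b v) * (degree_seq G).1 b.
  rewrite -!sum1_card (big_mkcond (fun p => p \in far_edges G a v)).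
  rewrite (big_mkcond (fun p => p \in G)) /=.
  have col (f : 'I_n -> nat) : \sum_u f u * (degree_seq G).2 u =
      \sum_p f p.2 * (p \in G).
    under eq_bigr => u _ do rewrite degree2E big_distrr /=.
    rewrite exchange_big pair_big /=.
    by apply: eq_bigr => -[b u].
  have row (f : 'I_l -> nat) : \sum_b f b * (degree_seq G).1 b =
      \sum_p f p.1 * (p \in G).
    under eq_bigr => u _ do rewrite degree1E big_distrr /=.
    by rewrite pair_big /=; apply: eq_bigr => -[b u].
  rewrite (col (fun u => (a, u) \in G : nat)) (col (fun u => fb a u : nat)).
  rewrite (row (fun b => (b, v) \in G : nat)) (row (fun b => fb b v : nat)).
  rewrite -!big_split /=; apply: leq_sum => -[b u] _ /=.
  rewrite !inE /=; case: (_ \in _) => //; case: (_ \in _) => //.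
  by case: (fb _ _) => //; case: (_ \in _) => //; case: (fb _ _).
apply: (leq_trans split_sum).
have bnd (I : finType) (f g : I -> nat) M : (forall i, g i <= M) ->
    \sum_i f i * g i <= (\sum_i f i) * M.
  by move=> gM; rewrite big_distrl; apply: leq_sum => i _; rewrite leq_mul2l gM orbT.
have b1 := bnd _ (fun u => (a, u) \in G : nat) _ _ GT.
have b2 := bnd _ (fun u => fb a u : nat) _ _ GT.
have b3 := bnd _ (fun b => (b, v) \in G : nat) _ _ GS.
have b4 := bnd _ (fun b => fb b v : nat) _ _ GS.
rewrite -degree1E in b1; rewrite -degree2E in b3.
have {}b2 := leq_trans b2 (leq_mul (fb1 a) (leqnn Tm)).
have {}b4 := leq_trans b4 (leq_mul (fb2 v) (leqnn Sm)).
rewrite mul1n in b2; rewrite mul1n in b4.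
apply: leq_trans (leq_add (leq_add (leq_add (leq_add (leqnn _) b1) b2) b3) b4) _.
by rewrite !mulSn; lia.
Qed.

Lemma switch_edge_degree G a c v u : (a, v) \notin G -> (c, u) \notin G ->
  (a, u) \notin G -> (c, v) \notin G -> a != c ->
  degree_seq ((a, u) |: ((c, v) |: G))%SET =
  degree_seq ((a, v) |: ((c, u) |: G))%SET.
Proof.
move=> av cu au cv ac.
rewrite !degree_addE // ?inE ?xpair_eqE ?(negPf ac) //.
by rewrite /incr /=; congr pair; apply/ffunP => i; rewrite !ffunE addnAC.
Qed.

Lemma card_dep_pairs (A B : finType) (P : pred A) (Q : A -> pred B) :
  #|[set p : A * B | P p.1 && Q p.1 p.2]%SET| = \sum_(x | P x) #|[set y | Q x y]%SET|.
Proof.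
under eq_bigr => x _ do rewrite -sum1dep_card.
by rewrite pair_big_dep /= -sum1dep_card.
Qed.

(* Edges av and cu are replaced by au and cv. *)
Lemma double_switching d a v Sm Tm :
  ~~ fb a v ->
  (forall b, d.1 b <= Sm) -> (forall u, d.2 u <= Tm) ->
  count_real fb d (fun G => (a, v) \in G)
    * (\sum_a d.1 a - (d.1 a).+1 * Tm - (d.2 v).+1 * Sm)
  <= #|realizations fb d| * (d.1 a * d.2 v).
Proof.
move=> fav dS dT.
(* [X] consists of the possible switchings, [Y] of the realizations with a marked neighbour u of a
   and a marked neighbour c of v. The switching keeps the mark (c, u), which makes it injective. *)
set X := [set p : bigraph l n * ('I_l * 'I_n) |
  ((p.1 \in realizations fb d) && ((a, v) \in p.1)) &&
  (p.2 \in far_edges p.1 a v)]%SET.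
set Y := [set p : bigraph l n * ('I_l * 'I_n) | (p.1 \in realizations fb d) &&
  (((a, p.2.2) \in p.1) && ((p.2.1, v) \in p.1))]%SET.
have cardY : #|Y| = #|realizations fb d| * (d.1 a * d.2 v).
  rewrite (card_dep_pairs (mem (realizations fb d))
    (fun G (q : 'I_l * 'I_n) => ((a, q.2) \in G) && ((q.1, v) \in G))).
  rewrite -sum_nat_const; apply: eq_bigr => G /realizationP[_ <-].
  rewrite !ffunE mulnC -cardsX; apply: eq_card => -[c u].
  by rewrite !inE /= andbC.
have leX : count_real fb d (fun G => (a, v) \in G)
    * (\sum_a d.1 a - (d.1 a).+1 * Tm - (d.2 v).+1 * Sm) <= #|X|.
  rewrite (card_dep_pairs (fun G => (G \in realizations fb d) && ((a, v) \in G))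
    (fun G => mem (far_edges G a v))).
  rewrite /count_real -sum_nat_const.
  rewrite [leqLHS](eq_bigl (fun G : bigraph l n =>
    (G \in realizations fb d) && ((a, v) \in G))); last by move=> G; rewrite inE.
  apply: leq_sum => G /andP[/realizationP[GA Gd] avG].
  have := @card_far_edges G a v Sm Tm; rewrite Gd => /(_ dS dT).
  rewrite card_degree1 Gd -subnDA leq_subLR => H.
  apply: (leq_trans H); rewrite -addnA addnC leq_add2l.
  by apply/subset_leq_card/fintype.subsetP => p; rewrite inE.
rewrite -cardY; apply: (leq_trans leX).
(* The part common to the graphs before and after the switching. *)
pose core (p : bigraph l n * ('I_l * 'I_n)) : bigraph l n :=
  (p.1 :\ (a, v) :\ p.2)%SET.
pose f p := (((a, p.2.2) |: ((p.2.1, v) |: core p))%SET, p.2).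
have coreP p : p \in X -> [/\ p.1 = ((a, v) |: (p.2 |: core p))%SET,
    [/\ (a, v) \notin core p, p.2 \notin core p, (a, p.2.2) \notin core p
       & (p.2.1, v) \notin core p], a != p.2.1 & v != p.2.2].
  case: p => G [c u]; rewrite !inE /= => /and3P[/andP[/andP[GA Gd] avG] cuG].
  case/and4P => au fau cv fcv.
  have ac : a != c by apply: contraNneq au => ->.
  have vu : v != u by apply: contraNneq cv => ->.
  split=> //.
    have cuD : (c, u) \in (G :\ (a, v))%SET.
      apply/finset.setD1P; split=> //.
      by apply: contraNneq ac => -[-> _].
    by rewrite /core /= (finset.setD1K cuD) (finset.setD1K avG).
  by split; rewrite ?eqxx ?andbF ?(negPf au) ?(negPf cv) ?andbF.
have injf : {in X &, injective f}.
  move=> p q /coreP[Ep [p1 p2 p3 p4] p5 p6] /coreP[Eq [q1 q2 q3 q4] q5 q6].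
  case=> E E2; rewrite -E2 in q2 q3 q4 q5 q6 Eq *.
  have Ecore : core p = core q.
    apply/setP => -[i j]; have /setP/(_ (i, j)) := E.
    rewrite -E2 !finset.in_setU1; move: p3 p4 q3 q4.
    have [->|_] := eqVneq (i, j) (a, p.2.2).
      by move=> /negPf -> _ /negPf ->.
    have [->|_] := eqVneq (i, j) (p.2.1, v).
      by move=> _ /negPf -> _ /negPf ->.
    by [].
  have E1 : p.1 = q.1 by rewrite Ep Eq Ecore.
  by rewrite [p]surjective_pairing E1 E2 -surjective_pairing.
rewrite -(card_in_imset injf); apply: subset_leq_card.
apply/fintype.subsetP => q /imsetP[p pX ->].
have [Ep [p1 p2 p3 p4] p5 p6] := coreP _ pX.
move: pX; rewrite !inE /= => /and3P[/andP[/andP[GA /eqP Gd] avG] cuG].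
case/and4P => au fau cv fcv.
have coreA : admissible fb (core p).
  by rewrite /core [p.2]surjective_pairing; do 2 apply: admissible_del.
rewrite !eqxx orbT !andbT !admissible_add // coreA /= switch_edge_degree //.
  by rewrite -surjective_pairing -Ep Gd.
by rewrite -surjective_pairing.
Qed.

(* A graph with the largest number of edges among those with degrees at most d
   realizes d: otherwise an edge could be added, possibly after moving one. *)
Lemma realizations_exist d Sm Tm m :
  \sum_a d.1 a = m -> \sum_v d.2 v = m ->
  (forall b, d.1 b <= Sm) -> (forall u, d.2 u <= Tm) ->
  3 * (Sm * Tm) < m -> 0 < #|realizations fb d|.
Proof.
move=> dm1 dm2 dS dT STm.
pose below G := admissible fb G && [forall a, (degree_seq G).1 a <= d.1 a]
  && [forall v, (degree_seq G).2 v <= d.2 v].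
have below0 : below finset.set0.
  rewrite /below -andbA; apply/and3P; split.
  - by apply/admissibleP=> a v; rewrite finset.in_set0.
  - by apply/forallP=> a; rewrite degree1E big1 // => v; rewrite finset.in_set0.
  - by apply/forallP=> v; rewrite degree2E big1 // => a; rewrite finset.in_set0.
have := @arg_maxnP _ finset.set0 below (fun G : bigraph l n => #|G|) below0.
case=> G /andP[/andP[GA /forallP G1] /forallP G2] Gmax.
have Gm : #|G| <= m by rewrite card_degree1 -dm1; apply: leq_sum => a _.
have [mG|Gm'] := leqP m #|G|.
  rewrite card_gt0; apply/finset.set0Pn; exists G; rewrite inE GA /=.
  rewrite [degree_seq G]surjective_pairing [d]surjective_pairing xpair_eqE.
  have tight k (f g : {ffun 'I_k -> nat}) : (forall i, f i <= g i) ->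
      \sum_i g i <= \sum_i f i -> f == g.
    move=> fg sgf; apply/eqP/ffunP => i; apply/eqP.
    have : \sum_i (g i - f i) == 0 by rewrite sumnB // subn_eq0.
    by rewrite sum_nat_eq0 => /forallP/(_ i); rewrite /= subn_eq0 eqn_leq fg.
  by rewrite !tight // ?dm1 ?dm2 -?card_degree1 -?card_degree2.
have deficient k (f g : {ffun 'I_k -> nat}) : (forall i, f i <= g i) ->
    \sum_i f i < \sum_i g i -> exists i, f i < g i.
  move=> fg sfg; apply/existsP; apply: contraLR sfg => /existsPn H.
  by rewrite -leqNgt; apply: leq_sum => i _; rewrite leqNgt H.
have [a da] : exists a, (degree_seq G).1 a < d.1 a.
  by apply: deficient => //; rewrite -card_degree1 dm1.
have incr_below v H : (degree_seq G).2 v < d.2 v -> admissible fb H ->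
    degree_seq H = incr (degree_seq G) a v -> False.
  move=> dv HA Hd; have : #|H| = #|G|.+1.
    rewrite !card_degree1 Hd /= (eq_bigr (fun i => (degree_seq G).1 i + (i == a))).
      rewrite big_split /= [X in _ + X](_ : _ = 1) ?addn1 //.
      by rewrite (bigD1 a) //= eqxx big1 // => i /negPf ->.
    by move=> i _; rewrite ffunE.
  move=> cH; suff /Gmax /(leq_trans (eq_leq (esym cH))) : below H by rewrite ltnn.
  rewrite /below HA Hd /=; apply/andP; split; apply/forallP=> i; rewrite ffunE.
    by have [->|_] := eqVneq i a; rewrite ?addn1 // addn0.
  by have [->|_] := eqVneq i v; rewrite ?addn1 // addn0.
(* A column below its target must be adjacent to a or forbidden for a, otherwise adding au would
   enlarge G. As a is itself below its target there are at most [Sm] such columns, each lacking at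
   most [Tm] edges. *)
have saturated u : (degree_seq G).2 u < d.2 u -> ((a, u) \in G) || fb a u.
  move=> du; apply: contraT; rewrite negb_or => /andP[auG fau]; exfalso.
  apply: (incr_below u ((a, u) |: G)%SET du); first by rewrite admissible_add.
  by rewrite degree_addE.
have aS : (degree_seq G).1 a < Sm by apply: leq_trans (dS a).
have deficit : m <= #|G| + Sm * Tm.
  have H : m <= \sum_u ((degree_seq G).2 u + (((a, u) \in G) + fb a u) * Tm).
    rewrite -dm2; apply: leq_sum => u _.
    have [du|] := ltnP ((degree_seq G).2 u) (d.2 u); last first.
      by move=> ?; apply: leq_trans (leq_addr _ _).
    apply: leq_trans (leq_addl _ _); apply: leq_trans (dT u) _.
    by move: (saturated u du); case: (_ \in _); case: (fb _ _) => //= _;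
      rewrite -1?[leqLHS]mul1n leq_mul2r ?orbT.
  apply: (leq_trans H); rewrite big_split /= -card_degree2 leq_add2l.
  rewrite -big_distrl leq_mul2r; apply/orP; right.
  rewrite big_split /= -degree1E; apply: leq_trans aS.
  by rewrite -addn1 leq_add2l fb1.
have [v dv] : exists v, (degree_seq G).2 v < d.2 v.
  by apply: deficient => //; rewrite -card_degree2 dm2.
have vT : (degree_seq G).2 v < Tm by apply: leq_trans (dT v).
(* The deficit costs one product [Sm * Tm] and the edges that are not far cost two, whence the
   constant 3 in the hypothesis. *)
have : 0 < #|far_edges G a v|.
  have := @card_far_edges G a v Sm Tm (fun b => leq_trans (G1 b) (dS b))
    (fun u => leq_trans (G2 u) (dT u)).
  have := leq_mul aS (leqnn Tm); have := leq_mul vT (leqnn Sm).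
  rewrite [Tm * Sm]mulnC; move: deficit STm.
  set X := (_ a).+1 * _; set Y := (_ v).+1 * _; set Z := Sm * Tm.
  by clearbody X Y Z; move: #|_| #|_| => p q; lia.
rewrite card_gt0 => /finset.set0Pn[[c u]]; rewrite inE /=.
move=> /andP[cuG /and4P[auG fau cvG fcv]].
have ac : a != c by apply: contraNneq auG => ->.
pose K : bigraph l n := (G :\ (c, u))%SET.
have GK : G = ((c, u) |: K)%SET by rewrite finset.setD1K.
have auK : (a, u) \notin K by rewrite finset.in_setD1 (negPf auG) andbF.
have cvK : (c, v) \notin K by rewrite finset.in_setD1 (negPf cvG) andbF.
have cuK : (c, u) \notin K by rewrite finset.in_setD1 eqxx.
exfalso; apply: (incr_below v ((a, u) |: ((c, v) |: K))%SET dv).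
  by rewrite !admissible_add // admissible_del.
rewrite GK !degree_addE //; last by rewrite finset.in_setU1 xpair_eqE (negPf ac).
by rewrite /incr /=; congr pair; apply/ffunP => i; rewrite !ffunE addnAC.
Qed.


End DoubleSwitchings.

(** * Edge and path probabilities *)

Section EdgeProbabilities.
Variables (R : realFieldType) (l n : nat) (fb : 'I_l -> 'I_n -> bool).
Implicit Types (d : degrees l n) (a b : 'I_l) (v u : 'I_n).

Let N d : R := #|realizations fb d|%:R.

Definition edge_pr d a v : R :=
  (count_real fb d (fun G => (a, v) \in G))%:R / #|realizations fb d|%:R.

Definition path_pr d a b v : R :=
  (count_real fb d (fun G => ((a, v) \in G) && ((b, v) \in G)))%:R
  / #|realizations fb d|%:R.

Lemma count_real_le d Q : (count_real fb d Q <= #|realizations fb d|)%N.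
Proof.
by apply: subset_leq_card; apply/fintype.subsetP => G; rewrite inE => /andP[].
Qed.

(** Also true when d has no realization: the division by 0 yields 0, and the count is 0 as well. *)
Let count_ratioK d Q : (count_real fb d Q)%:R / N d * N d = (count_real fb d Q)%:R.
Proof.
have [N0|N0] := eqVneq (N d) 0; last by rewrite divfK.
rewrite N0 mulr0; apply/esym/eqP; rewrite pnatr_eq0 -leqn0.
by apply: leq_trans (count_real_le _ _) _; rewrite leqn0 -(pnatr_eq0 R) -/(N d) N0.
Qed.

Lemma edge_pr_ge0 d a v : 0 <= edge_pr d a v.
Proof. by rewrite divr_ge0. Qed.

Lemma path_pr_ge0 d a b v : 0 <= path_pr d a b v.
Proof. by rewrite divr_ge0. Qed.

Lemma edge_pr_le1 d a v : edge_pr d a v <= 1.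
Proof.
rewrite /edge_pr; have [->|N0] := posnP #|realizations fb d|.
  by rewrite invr0 mulr0.
by rewrite ler_pdivrMr ?ltr0n // mul1r ler_nat count_real_le.
Qed.

Lemma path_pr_le d a b v : path_pr d a b v <= edge_pr d b v.
Proof.
rewrite /path_pr /edge_pr; apply: ler_wpM2r; first by rewrite invr_ge0.
rewrite ler_nat !count_realE; apply: leq_sum => G _.
by case: (_ \in _); case: (_ \in _).
Qed.

Lemma path_prC d a b v : path_pr d a b v = path_pr d b a v.
Proof.
congr (_%:R / _); apply: eq_count_real => G; exact: andbC.
Qed.

Lemma edge_pr_fb d a v : fb a v -> edge_pr d a v = 0.
Proof. by move=> fav; rewrite /edge_pr count_mem_fb // mul0r. Qed.

Lemma path_pr_fb d a b v : fb a v -> path_pr d a b v = 0.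
Proof.
move=> fav; rewrite /path_pr count_realE big1 ?mul0r // => G.
move=> /realizationP[/admissibleP GA _].
by case E: ((a, v) \in G) => //=; have := GA _ _ E; rewrite fav.
Qed.

Lemma edge_pr_sum2 d v : (0 < #|realizations fb d|)%N ->
  \sum_a edge_pr d a v = (d.2 v)%:R.
Proof.
move=> Nd; rewrite /edge_pr -mulr_suml -natr_sum count_mem_sum2 natrM mulrAC divff ?mul1r //.
by rewrite pnatr_eq0 -lt0n.
Qed.

Let count_compl d (Q Q' : pred (bigraph l n)) :
  (count_real fb d (fun G => ~~ Q G && Q' G))%:R =
  (count_real fb d Q')%:R - (count_real fb d (fun G => Q G && Q' G))%:R :> R.
Proof.
apply/esym/eqP; rewrite subr_eq -natrD; apply/eqP; congr _%:R.
rewrite !count_realE -big_split /=; apply: eq_bigr => G _.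
by case: (Q G); case: (Q' G).
Qed.

(** The realizations of d containing av correspond to those of d - av avoiding it. *)
Let edge_pr_decr d a v : ~~ fb a v -> (0 < d.1 a)%N -> (0 < d.2 v)%N ->
  edge_pr d a v * N d = N (decr d a v) * (1 - edge_pr (decr d a v) a v).
Proof.
move=> fav da dv; rewrite mulrBr mulr1 [X in _ - X]mulrC.
rewrite /edge_pr !count_ratioK -{1}(incr_decr da dv) count_mem_incr //.
rewrite (_ : N _ = (count_real fb (decr d a v) xpredT)%:R); last first.
  by rewrite count_realE sum1_card.
rewrite -(eq_count_real _ _ (fun G => andbT ((a, v) \in G))) -count_compl.
by congr _%:R; apply: eq_count_real => G; rewrite andbT.
Qed.

(** Deleting av expresses both the paths avb and the edges av of d through realizations of d - av;
    cross multiplication cancels the number of the latter, so only d has to be realizable. *)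
Lemma path_pr_rec d a b v : ~~ fb a v -> b != a -> (0 < d.1 a)%N ->
  (0 < d.2 v)%N -> (0 < #|realizations fb d|)%N ->
  path_pr d a b v * (1 - edge_pr (decr d a v) a v) =
  edge_pr d a v * (edge_pr (decr d a v) b v - path_pr (decr d a v) a b v).
Proof.
move=> fav ba da dv Nd.
have N0 : N d != 0 by rewrite pnatr_eq0 -lt0n.
have H1 := edge_pr_decr fav da dv.
have H2 : path_pr d a b v * N d = N (decr d a v) *
    (edge_pr (decr d a v) b v - path_pr (decr d a v) a b v).
  rewrite mulrBr ![N (decr _ _ _) * _]mulrC /path_pr /edge_pr !count_ratioK.
  by rewrite -{1}(incr_decr da dv) count_mem2_incr // count_compl.
apply: (mulIf N0); rewrite mulrAC H2 [in RHS]mulrAC H1; ring.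
Qed.

(** Over the uniform realizations of d, [codegree] is the expected number of common neighbours of a
    and b, and [blocked] the expected number of edges at a whose column is forbidden for b. *)
Definition codegree d a b : R := \sum_v path_pr d a b v.
Definition blocked d a b : R := \sum_(v | fb b v) edge_pr d a v.

(* Both sides count the moves of an edge in one column from row a to row b. *)
Lemma edge_pr_ratio d a b v : ~~ fb a v -> ~~ fb b v -> a != b ->
  (0 < d.1 a)%N -> (0 < d.1 b)%N -> (0 < d.2 v)%N ->
  (0 < #|realizations fb (decr d a v)|)%N ->
  (0 < #|realizations fb (decr d b v)|)%N ->
  edge_pr d a v * ((d.1 b)%:R - blocked (decr d a v) b a - codegree (decr d a v) a b)
    * (1 - edge_pr (decr d b v) b v) =
  edge_pr d b v * ((d.1 a)%:R - blocked (decr d b v) a b - codegree (decr d b v) a b)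
    * (1 - edge_pr (decr d a v) a v).
Proof.
move=> fav fbv ab da db dv Na Nb.
have Na0 : N (decr d a v) != 0 by rewrite pnatr_eq0 -lt0n.
have Nb0 : N (decr d b v) != 0 by rewrite pnatr_eq0 -lt0n.
have Ha := edge_pr_decr fav da dv; have Hb := edge_pr_decr fbv db dv.
have split D a' b' : N D * (D.1 a')%:R =
    (switchable fb D a' b')%:R + N D * blocked D a' b' + N D * codegree D a' b'.
  rewrite -natrM (switchable_split fb D a' b') !natrD !natr_sum.
  by congr (_ + _ + _); rewrite big_distrr; apply: eq_bigr => u _;
    rewrite [RHS]mulrC count_ratioK.
have sab : N (decr d b v) *
    ((d.1 a)%:R - blocked (decr d b v) a b - codegree (decr d b v) a b) =
    N (decr d a v) *
    ((d.1 b)%:R - blocked (decr d a v) b a - codegree (decr d a v) a b).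
  have Sa := split (decr d b v) a b; have Sb := split (decr d a v) b a.
  have := @switchable_sym _ _ fb d a b v ab da db dv.
  move: Sa Sb => + + E; rewrite E !ffunE (negPf ab) (eq_sym b) (negPf ab) !subn0.
  have -> : codegree (decr d a v) b a = codegree (decr d a v) a b.
    by apply: eq_bigr => u _; exact: path_prC.
  by rewrite !mulrBr => -> ->; ring.
apply: (mulfI Na0); apply: (mulfI Nb0).
transitivity (edge_pr d a v * (N (decr d a v) *
    ((d.1 b)%:R - blocked (decr d a v) b a - codegree (decr d a v) a b))
   * (N (decr d b v) * (1 - edge_pr (decr d b v) b v))); first by ring.
rewrite -sab -Hb.
transitivity (edge_pr d b v * (N (decr d b v) *
    ((d.1 a)%:R - blocked (decr d b v) a b - codegree (decr d b v) a b))
   * (N (decr d a v) * (1 - edge_pr (decr d a v) a v))); last by ring.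
by rewrite -Ha; ring.
Qed.

Lemma edge_pr_bound d a v (Sm Tm m : nat) :
  (forall a, \sum_v fb a v <= 1)%N -> (forall v, \sum_a fb a v <= 1)%N ->
  (forall b, d.1 b <= Sm)%N -> (forall u, d.2 u <= Tm)%N ->
  (\sum_a d.1 a = m)%N -> (0 < #|realizations fb d|)%N ->
  edge_pr d a v * (m%:R - Sm.+1%:R * Tm%:R - Tm.+1%:R * Sm%:R) <=
  Sm%:R * Tm%:R.
Proof.
move=> fb1 fb2 dS dT dm Nd.
have [fav|fav] := boolP (fb a v).
  by rewrite edge_pr_fb // mul0r mulr_ge0.
have H := double_switching fb1 fb2 fav dS dT.
have N0 : 0 < N d by rewrite ltr0n.
have dST : (d.1 a * d.2 v <= Sm * Tm)%N by rewrite leq_mul.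
have subn_ge (x y z : nat) : x%:R - y%:R - z%:R <= (x - y - z)%N%:R :> R.
  have le1 (p q : nat) : p%:R - q%:R <= (p - q)%N%:R :> R.
    have [qp|pq] := leqP q p; first by rewrite natrB.
    by rewrite lerBlDr -natrD ler_nat; lia.
  by apply: le_trans (le1 _ _); rewrite lerD2r.
rewrite dm in H; set k := (_ - _ - _)%N in H.
apply: (@le_trans _ _ (edge_pr d a v * k%:R)).
  rewrite ler_wpM2l ?edge_pr_ge0 //.
  apply: le_trans (subn_ge _ _ _); rewrite -!natrM -!addrA lerD2l -!opprD lerN2.
  by rewrite -!natrD ler_nat leq_add // leq_mul2r ltnS ?dS ?dT orbT.
rewrite /edge_pr mulrAC ler_pdivrMr // -!natrM ler_nat; apply: leq_trans H _.
by rewrite mulnC leq_mul2r dST orbT.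
Qed.

End EdgeProbabilities.

(** * Propagation of errors through sums and products *)

Section ApproximateArithmetic.
Variable R : realFieldType.
Implicit Types a b x y e f : R.

Lemma apx_add a a' b b' e f : `|a - a'| <= e -> `|b - b'| <= f ->
  `|(a + b) - (a' + b')| <= e + f.
Proof.
move=> ha hb; rewrite opprD addrACA.
by apply: le_trans (ler_normD _ _) (lerD ha hb).
Qed.

Lemma apx_sub a a' b b' e f : `|a - a'| <= e -> `|b - b'| <= f ->
  `|(a - b) - (a' - b')| <= e + f.
Proof. by move=> ha hb; apply: apx_add => //; rewrite -opprD normrN. Qed.

Lemma apx_mul a a' b b' A B e f : `|a - a'| <= e -> `|b - b'| <= f ->
  `|a'| <= A -> `|b| <= B -> `|a * b - a' * b'| <= e * B + A * f.
Proof.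
move=> ha hb hA hB.
have -> : a * b - a' * b' = (a - a') * b + a' * (b - b') by ring.
by apply: le_trans (ler_normD _ _) _; rewrite !normrM; apply: lerD; apply: ler_pM.
Qed.

Lemma apx_sum (I : finType) (P : pred I) (f g : I -> R) e :
  (forall i, P i -> `|f i - g i| <= e) -> 0 <= e ->
  `|\sum_(i | P i) f i - \sum_(i | P i) g i| <= #|I|%:R * e.
Proof.
move=> H e0; rewrite -sumrB; apply: le_trans (ler_norm_sum _ _ _) _.
apply: (@le_trans _ _ (\sum_(i | P i) e)); first exact: ler_sum.
by rewrite sumr_const -[leLHS]mulr_natl ler_wpM2r // ler_nat max_card.
Qed.

Lemma norm_mul_le a b A B : `|a| <= A -> `|b| <= B -> `|a * b| <= A * B.
Proof. by move=> ha hb; rewrite normrM ler_pM. Qed.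

Lemma norm_add_le a b A B : `|a| <= A -> `|b| <= B -> `|a + b| <= A + B.
Proof. by move=> ha hb; apply: le_trans (ler_normD _ _) (lerD ha hb). Qed.

Lemma norm_sub_le a b A B : `|a| <= A -> `|b| <= B -> `|a - b| <= A + B.
Proof. by move=> ha hb; apply: le_trans (ler_normB _ _) (lerD ha hb). Qed.

Lemma mean_sq_le (q : nat) (f : 'I_q -> R) c : 0 < q%:R :> R -> 0 <= c ->
  (forall i, `|f i| <= c) -> 0 <= q%:R^-1 * \sum_i f i ^+ 2 <= c ^+ 2.
Proof.
move=> q0 c0 fc.
rewrite mulr_ge0 ?invr_ge0 ?sumr_ge0 //=; last by move=> i _; rewrite sqr_ge0.
rewrite ler_pdivrMl //; apply: (@le_trans _ _ (\sum_(i < q) c ^+ 2)).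
  apply: ler_sum => i _; rewrite -(ger0_norm (sqr_ge0 (f i))) normrX.
  by rewrite lerXn2r ?nnegrE.
by rewrite sumr_const card_ord mulr_natl.
Qed.

End ApproximateArithmetic.

(* Only the inequalities moved to the goal are passed on to [lra]. *)
Ltac lra_only := repeat match goal with H : is_true _ |- _ => clear H end; lra.

(** * The recursion for edge and path probabilities *)

Section Recursion.
Variables (R : realFieldType) (l n m dl k : nat) (fb : 'I_l -> 'I_n -> bool).
Variables (d0 : degrees l n) (s t mu tau tau' e CA : R).


Implicit Types (d : degrees l n) (a b : 'I_l) (v u : 'I_n) (j : nat).

Definition row_dev d a : R := (d.1 a)%:R * tau - 1.
Definition col_dev d v : R := (d.2 v)%:R * tau' - 1.
Notation X := row_dev.
Notation Y := col_dev.
Definition row_msq : R := l%:R^-1 * \sum_a X d0 a ^+ 2.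
Definition col_msq : R := n%:R^-1 * \sum_v Y d0 v ^+ 2.
(** For [dl] = 1 this is the deviation of the one vertex forbidden for a, for [dl] = 0 it is 0.
    Taking it at [d0] keeps it constant along the recursion. *)
Definition row_twin a : R := \sum_(v | fb a v) Y d0 v.
Definition col_twin v : R := \sum_(a | fb a v) X d0 a.
Notation Sx := row_msq.
Notation Sy := col_msq.
Notation z := row_twin.
Notation w := col_twin.

(* mu is the edge density, k bounds the number of edges that may be deleted from
   d0, and e is the size of the relative degree deviations. *)
Record regime : Prop := Regime {
  rg_fb1 : forall a, (\sum_v fb a v)%N = dl;
  rg_fb2 : forall v, (\sum_a fb a v)%N = dl;
  rg_dl1 : (dl <= 1)%N;
  rg_d0m1 : (\sum_a d0.1 a)%N = m;
  rg_d0m2 : (\sum_v d0.2 v)%N = m;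
  rg_ls : l%:R * s = m%:R;
  rg_nt : n%:R * t = m%:R;
  rg_stau : s * tau = 1;
  rg_ttau : t * tau' = 1;
  rg_mun : mu * (n%:R - dl%:R) = s;
  rg_mul : mu * (l%:R - dl%:R) = t;
  rg_e_range : 0 < e <= 1 / 100;
  rg_mu_range : 0 < mu <= 1 / 1000;
  rg_tau_le : 0 < tau <= e ^+ 2;
  rg_tau'_le : 0 < tau' <= e ^+ 2;
  rg_X0_le : forall a, `|X d0 a| <= e;
  rg_Y0_le : forall v, `|Y d0 v| <= e;
  rg_k_tau : k%:R * tau <= e;
  rg_k_tau' : k%:R * tau' <= e;
  rg_k_m : k%:R <= m%:R * (mu * e ^+ 4);
  rg_k_tau2 : k%:R * (tau * tau') <= e ^+ 4;
  rg_CA_nonneg : 0 <= CA;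
  rg_identities : formal_identities CA e mu Sx Sy tau tau' dl%:R }.

Hypothesis HR : regime.
Notation fb1 := (rg_fb1 HR).
Notation fb2 := (rg_fb2 HR).
Notation dl1 := (rg_dl1 HR).
Notation d0m1 := (rg_d0m1 HR).
Notation d0m2 := (rg_d0m2 HR).
Notation ls := (rg_ls HR).
Notation nt := (rg_nt HR).
Notation stau := (rg_stau HR).
Notation ttau := (rg_ttau HR).
Notation mun := (rg_mun HR).
Notation mul := (rg_mul HR).
Notation e_range := (rg_e_range HR).
Notation mu_range := (rg_mu_range HR).
Notation tau_le := (rg_tau_le HR).
Notation tau'_le := (rg_tau'_le HR).
Notation X0_le := (rg_X0_le HR).
Notation Y0_le := (rg_Y0_le HR).
Notation k_tau := (rg_k_tau HR).
Notation k_tau' := (rg_k_tau' HR).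
Notation k_m := (rg_k_m HR).
Notation k_tau2 := (rg_k_tau2 HR).

(* [lowered j d] : d arises from d0 by deleting j edges. *)
Definition lowered j d : Prop :=
  [/\ forall a, (d.1 a <= d0.1 a)%N, forall v, (d.2 v <= d0.2 v)%N,
      (\sum_a d.1 a + j = m)%N & (\sum_v d.2 v + j = m)%N].

Lemma e_gt0 : 0 < e. Proof. by case/andP: e_range. Qed.
Lemma e_le : e <= 1 / 100. Proof. by case/andP: e_range. Qed.
Lemma mu_gt0 : 0 < mu. Proof. by case/andP: mu_range. Qed.
Lemma mu_le : mu <= 1 / 1000. Proof. by case/andP: mu_range. Qed.
Lemma tau_gt0 : 0 < tau. Proof. by case/andP: tau_le. Qed.
Lemma tau'_gt0 : 0 < tau'. Proof. by case/andP: tau'_le. Qed.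
Lemma s_gt0 : 0 < s. Proof. by rewrite -(pmulr_lgt0 _ tau_gt0) stau. Qed.
Lemma t_gt0 : 0 < t. Proof. by rewrite -(pmulr_lgt0 _ tau'_gt0) ttau. Qed.
Lemma n_gt0 : 0 < n%:R :> R.
Proof.
have : 0 < n%:R - dl%:R :> R by rewrite -(pmulr_rgt0 _ mu_gt0) mun s_gt0.
by have : 0 <= dl%:R :> R by []; lra.
Qed.
Lemma l_gt0 : 0 < l%:R :> R.
Proof.
have : 0 < l%:R - dl%:R :> R by rewrite -(pmulr_rgt0 _ mu_gt0) mul t_gt0.
by have : 0 <= dl%:R :> R by []; lra.
Qed.
#[local] Hint Resolve e_gt0 mu_gt0 tau_gt0 tau'_gt0 s_gt0 t_gt0 n_gt0 l_gt0 : core.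
Lemma dl_le1R : dl%:R <= 1 :> R. Proof. by rewrite lern1 dl1. Qed.
Lemma m_tau : m%:R * tau = l%:R :> R. Proof. by rewrite -ls -mulrA stau mulr1. Qed.
Lemma m_tau' : m%:R * tau' = n%:R :> R. Proof. by rewrite -nt -mulrA ttau mulr1. Qed.

Lemma CA_ge0 : 0 <= CA. Proof. exact: (rg_CA_nonneg HR). Qed.
#[local] Hint Resolve dl_le1R CA_ge0 : core.

Lemma sum_row_dev j d : lowered j d -> \sum_a X d a = - (j%:R * tau).
Proof.
case=> _ _ H _; rewrite sumrB -mulr_suml sumr_const card_ord -natr_sum.
have -> : (\sum_a d.1 a)%N%:R = m%:R - j%:R :> R by rewrite -H natrD addrK.
by rewrite mulrBl m_tau addrAC subrr add0r.
Qed.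

Lemma sum_col_dev j d : lowered j d -> \sum_v Y d v = - (j%:R * tau').
Proof.
case=> _ _ _ H; rewrite sumrB -mulr_suml sumr_const card_ord -natr_sum.
have -> : (\sum_v d.2 v)%N%:R = m%:R - j%:R :> R by rewrite -H natrD addrK.
by rewrite mulrBl m_tau' addrAC subrr add0r.
Qed.

Lemma lowered0 : lowered 0 d0.
Proof. by split=> //; rewrite addn0 ?d0m1 ?d0m2. Qed.

Lemma leq_term (I : finType) (f : I -> nat) (i : I) : (f i <= \sum_j f j)%N.
Proof. by rewrite (bigD1 i) //= leq_addr. Qed.

Lemma row_dev_shift j d a : lowered j d -> 0 <= X d0 a - X d a <= j%:R * tau.
Proof.
case=> h1 _ H _; rewrite /row_dev opprB addrA subrK -mulrBl -natrB //.
apply/andP; split; first by rewrite mulr_ge0 // ltW.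
apply: ler_wpM2r; [exact: ltW | rewrite ler_nat].
have := @leq_term _ (fun a => d0.1 a - d.1 a)%N a; rewrite sumnB // d0m1.
by rewrite -H addKn.
Qed.

Lemma col_dev_shift j d v : lowered j d -> 0 <= Y d0 v - Y d v <= j%:R * tau'.
Proof.
case=> _ h1 _ H; rewrite /col_dev opprB addrA subrK -mulrBl -natrB //.
apply/andP; split; first by rewrite mulr_ge0 // ltW.
apply: ler_wpM2r; [exact: ltW | rewrite ler_nat].
have := @leq_term _ (fun v => d0.2 v - d.2 v)%N v; rewrite sumnB // d0m2.
by rewrite -H addKn.
Qed.

Lemma level_mul_le (j : nat) (c : R) : (j <= k)%N -> 0 <= c -> j%:R * c <= k%:R * c.
Proof. by move=> jk c0; rewrite ler_wpM2r // ler_nat. Qed.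

Lemma row_dev_le j d a : lowered j d -> (j <= k)%N -> `|X d a| <= 2 * e.
Proof.
move=> Hd jlek; have H := row_dev_shift a Hd; have := level_mul_le jlek (ltW tau_gt0).
by move: H (X0_le a) k_tau; rewrite !ler_norml; lra.
Qed.

Lemma col_dev_le j d v : lowered j d -> (j <= k)%N -> `|Y d v| <= 2 * e.
Proof.
move=> Hd jlek; have H := col_dev_shift v Hd; have := level_mul_le jlek (ltW tau'_gt0).
by move: H (Y0_le v) k_tau'; rewrite !ler_norml; lra.
Qed.

(** Deletions only lower the deviations, so the change of the squares is controlled by the total
    change of the deviations, which depends on the number of deleted edges and not on where they
    lie. *)
Lemma sum_sq_shift (I : finType) (f g : I -> R) (c : R) : 0 <= c ->
  (forall i, 0 <= f i - g i) -> (forall i, `|f i| <= c) -> (forall i, `|g i| <= c) ->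
  `|\sum_i g i ^+ 2 - \sum_i f i ^+ 2| <= 2 * c * (\sum_i f i - \sum_i g i).
Proof.
move=> c0 fg fc gc; rewrite -sumrB -sumrB mulr_sumr.
apply: le_trans (ler_norm_sum _ _ _) _; apply: ler_sum => i _.
rewrite subr_sqr normrM mulrC; apply: ler_pM => //.
  by apply: le_trans (ler_normD _ _) _; have := fc i; have := gc i; lra.
by rewrite distrC ger0_norm.
Qed.

Lemma sum_row_dev_sq j d : lowered j d -> (j <= k)%N ->
  `|\sum_a X d a ^+ 2 - l%:R * Sx| <= 4 * e * (j%:R * tau).
Proof.
move=> Hd jlek; have -> : l%:R * Sx = \sum_a X d0 a ^+ 2.
  by rewrite /Sx mulrA divff ?gt_eqF // mul1r.
have -> : 4 * e * (j%:R * tau) = 2 * (2 * e) * (\sum_a X d0 a - \sum_a X d a).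
  by rewrite (sum_row_dev Hd) (sum_row_dev lowered0); ring.
apply: sum_sq_shift; first by have := e_gt0; lra.
- by move=> a; case/andP: (row_dev_shift a Hd).
- by move=> a; apply: row_dev_le lowered0 _.
- by move=> a; apply: row_dev_le Hd _.
Qed.

Lemma sum_col_dev_sq j d : lowered j d -> (j <= k)%N ->
  `|\sum_v Y d v ^+ 2 - n%:R * Sy| <= 4 * e * (j%:R * tau').
Proof.
move=> Hd jlek; have -> : n%:R * Sy = \sum_v Y d0 v ^+ 2.
  by rewrite /Sy mulrA divff ?gt_eqF // mul1r.
have -> : 4 * e * (j%:R * tau') = 2 * (2 * e) * (\sum_v Y d0 v - \sum_v Y d v).
  by rewrite (sum_col_dev Hd) (sum_col_dev lowered0); ring.
apply: sum_sq_shift; first by have := e_gt0; lra.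
- by move=> a; case/andP: (col_dev_shift a Hd).
- by move=> a; apply: col_dev_le lowered0 _.
- by move=> a; apply: col_dev_le Hd _.
Qed.

Lemma Sx_range : 0 <= Sx <= e ^+ 2.
Proof. by apply: mean_sq_le => //; [exact: ltW | exact: X0_le]. Qed.
Lemma Sy_range : 0 <= Sy <= e ^+ 2.
Proof. by apply: mean_sq_le => //; [exact: ltW | exact: Y0_le]. Qed.

Lemma fb_sum1 a : \sum_v (fb a v)%:R = dl%:R :> R. Proof. by rewrite -natr_sum fb1. Qed.
Lemma fb_sum2 v : \sum_a (fb a v)%:R = dl%:R :> R. Proof. by rewrite -natr_sum fb2. Qed.

Lemma sum_cond (I : finType) (P : pred I) (f : I -> R) :
  \sum_(i | P i) f i = \sum_i (P i)%:R * f i.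
Proof.
rewrite big_mkcond; apply: eq_bigr => i _.
by case: (P i); rewrite ?mul1r ?mul0r.
Qed.

Lemma cond_sum_le (I : finType) (P : pred I) (f : I -> R) (c : R) :
  \sum_i (P i)%:R = dl%:R :> R -> (forall i, P i -> `|f i| <= c) -> 0 <= c ->
  `|\sum_(i | P i) f i| <= dl%:R * c.
Proof.
move=> H fc c0; apply: le_trans (ler_norm_sum _ _ _) _.
rewrite -H mulr_suml sum_cond; apply: ler_sum => i _.
by case E: (P i); rewrite ?mul0r // !mul1r fc.
Qed.

Lemma z_le a : `|z a| <= e.
Proof.
have := @cond_sum_le _ (fb a) (Y d0) e (fb_sum1 a) (fun v _ => Y0_le v) (ltW e_gt0).
by move/le_trans; apply; have := e_gt0; have := dl_le1R; nra.
Qed.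

Lemma w_le v : `|w v| <= e.
Proof.
have := @cond_sum_le _ (fun a => fb a v) (X d0) e (fb_sum2 v)
  (fun a _ => X0_le a) (ltW e_gt0).
by move/le_trans; apply; have := e_gt0; have := dl_le1R; nra.
Qed.

Lemma sum_z : \sum_a z a = 0.
Proof.
rewrite (exchange_big_dep predT) //=.
rewrite (eq_bigr (fun v => dl%:R * Y d0 v)) => [|v _].
  by rewrite -mulr_sumr (sum_col_dev lowered0) mul0r oppr0 mulr0.
by rewrite sum_cond -mulr_suml fb_sum2.
Qed.

Lemma sum_w : \sum_v w v = 0.
Proof.
rewrite (exchange_big_dep predT) //=.
rewrite (eq_bigr (fun a => dl%:R * X d0 a)) => [|a _].
  by rewrite -mulr_sumr (sum_row_dev lowered0) mul0r oppr0 mulr0.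
by rewrite sum_cond -mulr_suml fb_sum1.
Qed.


Notation ph d a v := (edge_apx mu Sx Sy tau (X d a) (Y d v) (z a) (w v)).
Notation yh d a b v :=
  (path_apx mu Sx Sy tau tau' (X d a) (X d b) (Y d v) (z a) (z b) (w v)).

Notation ok a v := (~~ fb a v).

Lemma fb_disjoint a b v : a != b -> ~~ (fb a v && fb b v).
Proof.
move=> ab; apply/negP => /andP[fa fB]; have := fb2 v.
rewrite (bigD1 a) //= fa (bigD1 b) 1?eq_sym //= fB => H.
by move: dl1; rewrite -H /= !add1n.
Qed.


Lemma two_e (x : R) : `|x| <= 2 * e -> `|x| <= 2 * e ^+ 1. Proof. by rewrite expr1. Qed.
Lemma one_e (x : R) : `|x| <= e -> `|x| <= 2 * e.
Proof. by move/le_trans; apply; have := e_gt0; lra. Qed.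

Let kap := mu * (1 - mu)^-1.
Lemma kap_mu : kap * (1 - mu) = mu.
Proof. by rewrite /kap divfK // subr_eq0 gt_eqF //; have := mu_le; lra. Qed.
Lemma kap_range : 0 <= kap <= 2 * mu.
Proof. by have := kap_mu; have := mu_le; have := mu_gt0; nra. Qed.

Lemma e_mul_le (q : R) : 0 <= q -> e * q <= q / 100.
Proof. by move=> q0; rewrite mulrC ler_wpM2l //; have := e_le; lra. Qed.
Lemma mu_mul_le (q : R) : 0 <= q -> mu * q <= q / 1000.
Proof. by move=> q0; rewrite mulrC ler_wpM2l //; have := mu_le; lra. Qed.
Lemma mu_n : mu * n%:R = s + dl%:R * mu. Proof. by rewrite -mun; ring. Qed.
Lemma mu_s : mu <= s.
Proof.
have : 0 < n%:R - dl%:R :> R by rewrite -(pmulr_rgt0 _ mu_gt0) mun s_gt0.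
rewrite subr_gt0 ltr_nat => H; rewrite -mun -[leLHS]mulr1 ler_pM2l //.
by rewrite lerBrDr addrC natr1 ler_nat.
Qed.
Lemma mu_n_le : mu * n%:R <= 2 * s.
Proof. by rewrite mu_n; have := mu_s; have := dl_le1R; have := mu_gt0; nra. Qed.

(** Sums [path_apx_expansion] over the columns allowed for both rows: the deviations sum to -j tau',
    their squares to nearly n [Sy], and w to 0, while each forbidden column removes about 1 + 2
    y. *)
Lemma codegree_apx j d a b : lowered j d -> (j <= k)%N -> a != b ->
  `|\sum_(v | ok a v && ok b v) (mu ^+ 2 * yh d a b v)
    - s * (mu * ((1 + X d a) * (1 + X d b) *
        (1 + codeg_corr mu Sy tau tau' dl%:R (X d a) (X d b) (z a) (z b))))|
  <= s * (mu * ((2 * CA + 84) * e ^+ 4)).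
Proof.
move=> Hd jlek ab.
have e20 : 0 <= e ^+ 2 := sqr_ge0 e.
have xa2 := row_dev_le a Hd jlek; have xb2 := row_dev_le b Hd jlek.
have za1 := z_le a; have zb1 := z_le b.
set xa := X d a in xa2 *; set xb := X d b in xb2 *.
set K := (1 + xa) * (1 + xb); set S := xa + xb; set Z := z a + z b.
set nu := mu * tau.
pose k0 := 1 + kap * S * Sy + nu * Z - tau' * (1 - mu) + mu * tau' * S.
pose k1 := (1 + 1) - kap * S + (1 + 1) * kap * Sx + tau' * ((1 + 1) * mu - 1).
pose k2 := 1 - (1 + 1) * kap * S.
pose q v := k0 + k1 * Y d v + k2 * (Y d v * Y d v) + (1 + 1) * nu * w v.
have step1 : `|\sum_(v | ok a v && ok b v) yh d a b v
    - \sum_(v | ok a v && ok b v) (K * q v)| <= n%:R * (CA * e ^+ 4).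
  rewrite -[n in n%:R]card_ord; apply: apx_sum => [v _|].
    have [_ H _] := rg_identities HR (two_e xa2) (two_e xb2)
      (two_e (col_dev_le v Hd jlek)) (two_e (one_e za1)) (two_e (one_e zb1))
      (two_e (one_e (w_le v))).
    exact: H.
  by rewrite mulr_ge0 // exprn_ge0 // ltW.
have step2 : \sum_(v | ok a v && ok b v) q v =
    \sum_v q v - \sum_(v | fb a v) q v - \sum_(v | fb b v) q v.
  rewrite [LHS]sum_cond [X in _ - X - _]sum_cond [X in _ - X]sum_cond.
  rewrite -!sumrB; apply: eq_bigr => v _.
  have := fb_disjoint v ab.
  by case: (fb a v); case: (fb b v) => //= _; ring.
have [Sx0 Sx1] := andP Sx_range; have [Sy0 Sy1] := andP Sy_range.
have [kap0 kap1] := andP kap_range.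
have S4 : `|S| <= 4 * e by apply: le_trans (ler_normD _ _) _; move: xa2 xb2; lra_only.
have Z2 : `|Z| <= 2 * e by apply: le_trans (ler_normD _ _) _; move: za1 zb1; lra_only.
have kS : `|kap * S| <= e / 50.
  apply: (@le_trans _ _ (2 * mu * (4 * e))).
    by apply: norm_mul_le => //; rewrite ger0_norm.
  by have := mu_mul_le (ltW e_gt0); have := e_gt0; lra_only.
have k2_le : `|k2| <= 2.
  rewrite /k2 -mulrA; move: kS; rewrite !ler_norml; have := e_le; lra_only.
have [tau'a tau'b] := andP tau'_le.
have nu_range : 0 <= nu <= e ^+ 2 / 1000.
  apply/andP; split; first by rewrite mulr_ge0 // ltW.
  have := mu_mul_le (ltW tau_gt0); case/andP: tau_le => _; rewrite /nu.
  by lra_only.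
have [nu0 nu1] := andP nu_range.
have e2 : e ^+ 2 <= e / 100 by rewrite expr2; apply: e_mul_le; exact: ltW.
have k1_le : `|k1 - 2| <= e.
  rewrite /k1.
  have h1 : `|(1 + 1) * kap * Sx| <= e / 50.
    have kSx : `|kap * Sx| <= 1 / 500 * e ^+ 2.
      by apply: norm_mul_le; rewrite ger0_norm //; move: kap1 mu_le; lra_only.
    have -> : (1 + 1) * kap * Sx = 2 * (kap * Sx) by ring.
    by move: kSx e2 e20; rewrite !ler_norml; lra_only.
  have h2 : `|tau' * ((1 + 1) * mu - 1)| <= e / 100.
    rewrite normrM gtr0_norm // -[leRHS]mulr1; apply: ler_pM => //; first exact: ltW.
      exact: le_trans e2.
    by rewrite ler_norml; have := mu_le; have := mu_gt0; lra_only.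
  move: kS h1 h2; rewrite !ler_norml; have := e_gt0; lra_only.
have k0_le : `|k0 - 1| <= 2 * e ^+ 2.
  rewrite /k0.
  have h1 : `|kap * S * Sy| <= e ^+ 2 / 50.
    apply: (@le_trans _ _ (e / 50 * e ^+ 2)).
      by apply: norm_mul_le; rewrite // ger0_norm.
    by have := e_mul_le e20; move: e20; lra_only.
  have h2 : `|nu * Z| <= e ^+ 2 / 50.
    apply: (@le_trans _ _ (e ^+ 2 / 1000 * (2 * e))).
      by apply: norm_mul_le; rewrite // ger0_norm.
    by have := e_mul_le e20; move: e20; lra_only.
  have h3 : `|tau' * (1 - mu)| <= e ^+ 2.
    rewrite normrM gtr0_norm // -[leRHS]mulr1; apply: ler_pM => //; first exact: ltW.
    by rewrite ler_norml; have := mu_le; have := mu_gt0; lra_only.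
  have h4 : `|mu * tau' * S| <= e ^+ 2 / 50.
    apply: (@le_trans _ _ (1 / 1000 * e ^+ 2 * (4 * e))).
      by apply: norm_mul_le => //; apply: norm_mul_le; rewrite gtr0_norm // ?mu_le.
    by have := e_mul_le e20; move: e20; lra_only.
  move: h1 h2 h3 h4 e20; rewrite !ler_norml; lra_only.
set J := j%:R * tau'.
have J0 : 0 <= J by rewrite mulr_ge0 // ltW.
have Yd v : `|Y d v| <= 2 * e by exact: col_dev_le jlek.
have step3 : `|\sum_v q v - n%:R * (k0 + k2 * Sy)| <= 4 * J.
  have -> : \sum_v q v - n%:R * (k0 + k2 * Sy) =
      - (k1 * J) + k2 * (\sum_v Y d v ^+ 2 - n%:R * Sy).
    have lin p0 p1 p2 p3 : \sum_v (p0 + p1 * Y d v + p2 * (Y d v * Y d v) + p3 * w v)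
        = n%:R * p0 + p1 * \sum_v Y d v + p2 * \sum_v Y d v ^+ 2
          + p3 * \sum_v w v.
      rewrite !mulr_sumr mulr_natl -[n in p0 *+ n]card_ord -sumr_const -!big_split.
      by apply: eq_bigr => v _; rewrite expr2.
    rewrite /q lin.
    by rewrite sum_w (sum_col_dev Hd) /J; ring.
  have h1 : `|- (k1 * J)| <= 3 * J.
    rewrite normrN normrM (ger0_norm J0) ler_wpM2r //.
    by move: k1_le; rewrite !ler_norml; have := e_le; lra_only.
  have h2 : `|k2 * (\sum_v Y d v ^+ 2 - n%:R * Sy)| <= J.
    apply: le_trans (norm_mul_le k2_le (sum_col_dev_sq Hd jlek)) _.
    by rewrite -/J; have := e_mul_le J0; move: J0; lra_only.
  apply: le_trans (norm_add_le h1 h2) _; lra_only.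
(* A forbidden column is about 1/n of the whole sum and 1/n is O(e^2), so an error O(e^2) in q is
   affordable here and only its terms of weight 0 and 1 are kept. *)
have step4 c : `|\sum_(v | fb c v) q v - (dl%:R + 2 * z c)| <= 15 * e ^+ 2 + 2 * J.
  have -> : \sum_(v | fb c v) q v - (dl%:R + 2 * z c) =
      \sum_(v | fb c v) (q v - 1 - 2 * Y d0 v).
    rewrite !sumrB -mulr_sumr -/(z c) (sum_cond _ (fun=> 1)).
    by under [X in _ = _ - X - _]eq_bigr do rewrite mulr1; rewrite fb_sum1; ring.
  have B0 : 0 <= 15 * e ^+ 2 + 2 * J by move: e20 J0; lra_only.
  have := @cond_sum_le _ (fb c) (fun v => q v - 1 - 2 * Y d0 v) _ (fb_sum1 c) _ B0.
  move=> H; apply: (le_trans (H _)); last first.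
    by rewrite ler_piMl.
  move=> v _.
  have -> : q v - 1 - 2 * Y d0 v = (k0 - 1) + (k1 - 2) * Y d v
      - 2 * (Y d0 v - Y d v) + k2 * (Y d v * Y d v) + (1 + 1) * nu * w v.
    by rewrite /q; ring.
  have h1 := norm_mul_le k1_le (Yd v).
  have h2 : `|2 * (Y d0 v - Y d v)| <= 2 * J.
    have [? ?] := andP (col_dev_shift v Hd).
    by rewrite ger0_norm ?mulr_ge0 // ler_wpM2l.
  have h3 := norm_mul_le k2_le (norm_mul_le (Yd v) (Yd v)).
  have h4 : `|(1 + 1) * nu * w v| <= e ^+ 2.
    have : `|(1 + 1) * nu * w v| <= 2 * nu * 1.
      apply: norm_mul_le; first by rewrite ger0_norm // mulr_ge0.
      by apply: le_trans (w_le v) _; have := e_le; lra_only.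
    move: nu1 e20; lra_only.
  apply: le_trans (norm_add_le (norm_add_le (norm_sub_le
    (norm_add_le k0_le h1) h2) h3) h4) _.
  have -> : 2 * (2 * e * (2 * e)) = 8 * e ^+ 2 by ring.
  have -> : e * (2 * e) = 2 * e ^+ 2 by ring.
  by move: e20 J0; lra_only.
set Q := \sum_(v | ok a v && ok b v) q v in step2.
have step5 : `|Q - (n%:R * (k0 + k2 * Sy) - 2 * dl%:R - 2 * Z)| <= 8 * J + 30 * e ^+ 2.
  have -> : Q - (n%:R * (k0 + k2 * Sy) - 2 * dl%:R - 2 * Z) =
     (\sum_v q v - n%:R * (k0 + k2 * Sy)) -
     (\sum_(v | fb a v) q v - (dl%:R + 2 * z a)) -
     (\sum_(v | fb b v) q v - (dl%:R + 2 * z b)) by rewrite step2 /Z; ring.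
  apply: le_trans (norm_sub_le (norm_sub_le step3 (step4 a)) (step4 b)) _.
  by move: e20 J0; lra_only.
rewrite -mulr_sumr; rewrite -mulr_sumr -/Q in step1.
set A := \sum_(v | _) _ in step1 *.
set cc := codeg_corr _ _ _ _ _ _ _ _ _.
(* [codeg_corr] is read off from this identity. Of the 2 [dl] removed columns one [dl] is
   compensated by mu n = s + [dl] mu; the leftover term is small since mu e^2 <= s e^4. *)
have main : mu * (n%:R * (k0 + k2 * Sy) - 2 * dl%:R - 2 * Z) =
    s * (1 + cc) + dl%:R * mu * (k0 + k2 * Sy - 1).
  have snu : s * nu = mu by rewrite /nu mulrCA stau mulr1.
  rewrite mulrBr mulrBr mulrA mu_n.
  have -> : 1 + cc = k0 + k2 * Sy - dl%:R * nu - 2 * (nu * Z).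
    rewrite /cc /codeg_corr /k0 /k2 -/kap -/nu -/xa -/xb -/S -/Z.
    apply/eqP; rewrite -subr_eq0; apply/eqP.
    transitivity ((kap * (1 - mu) - mu) * tau' * S); first by ring.
    by rewrite kap_mu subrr !mul0r.
  by rewrite -snu; ring.
have -> : mu ^+ 2 * A - s * (mu * (K * (1 + cc))) = mu ^+ 2 * (A - K * Q)
    + mu * (K * (mu * (Q - (n%:R * (k0 + k2 * Sy) - 2 * dl%:R - 2 * Z))
       + dl%:R * mu * (k0 + k2 * Sy - 1))).
  have -> : s * (mu * (K * (1 + cc))) = mu * (K * (s * (1 + cc))) by ring.
  by have := main; move/(congr1 (fun x => x - dl%:R * mu * (k0 + k2 * Sy - 1)));
     rewrite addrK => <-; ring.
have K2 : `|K| <= 2.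
  have -> : 2 = (1 + 1 / 3) * (3 / 2) :> R by field.
  apply: norm_mul_le; move: xa2 xb2; rewrite !ler_norml; have := e_le; lra_only.
have e40 : 0 <= e ^+ 4 by rewrite exprn_ge0 // ltW.
have muss : mu * e ^+ 2 <= s * e ^+ 4.
  have -> : mu * e ^+ 2 = s * (nu * e ^+ 2).
    by transitivity (s * tau * (mu * e ^+ 2)); [rewrite stau mul1r | rewrite /nu; ring].
  apply: ler_wpM2l; first exact: ltW.
  rewrite (exprD e 2 2); apply: ler_wpM2r => //; move: nu1 e20; lra_only.
have muJ : mu * J <= s * e ^+ 4.
  have -> : mu * J = s * (mu * (j%:R * (tau * tau'))).
    by rewrite /J; transitivity (s * tau * (mu * (j%:R * tau'))); [rewrite stau mul1r; ring | ring].
  apply: ler_wpM2l; first exact: ltW.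
  have := level_mul_le jlek (ltW (mulr_gt0 tau_gt0 tau'_gt0)); have := k_tau2.
  have jt0 := mulr_ge0 (ler0n R j) (ltW (mulr_gt0 tau_gt0 tau'_gt0)).
  by move: (mu_mul_le jt0) (jt0); lra_only.
have part1 : `|mu ^+ 2 * (A - K * Q)| <= s * (mu * (2 * CA * e ^+ 4)).
  rewrite normrM ger0_norm ?sqr_ge0 //.
  apply: (@le_trans _ _ (mu ^+ 2 * (n%:R * (CA * e ^+ 4)))).
    by apply: ler_wpM2l => //; exact: sqr_ge0.
  have -> : mu ^+ 2 * (n%:R * (CA * e ^+ 4)) = mu * n%:R * (mu * (CA * e ^+ 4)) by ring.
  have -> : s * (mu * (2 * CA * e ^+ 4)) = 2 * s * (mu * (CA * e ^+ 4)) by ring.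
  apply: ler_wpM2r; last exact: mu_n_le.
  by rewrite !mulr_ge0 // ltW.
have k02 : `|k0 + k2 * Sy - 1| <= 4 * e ^+ 2.
  rewrite addrAC; apply: le_trans (ler_normD _ _) _.
  have := norm_mul_le k2_le (_ : `|Sy| <= e ^+ 2); rewrite ger0_norm // => /(_ Sy1).
  by move: k0_le; lra_only.
have part2 : `|mu * (Q - (n%:R * (k0 + k2 * Sy) - 2 * dl%:R - 2 * Z))
       + dl%:R * mu * (k0 + k2 * Sy - 1)| <= 42 * (s * e ^+ 4).
  apply: (@le_trans _ _ (mu * (8 * J + 30 * e ^+ 2) + 1 * mu * (4 * e ^+ 2))).
    apply: norm_add_le; apply: norm_mul_le => //; first by rewrite gtr0_norm.
    by apply: norm_mul_le; rewrite ?ger0_norm // ltW.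
  by move: muss muJ; lra_only.
have mu_norm : `|mu| <= mu by rewrite gtr0_norm.
have part3 := norm_mul_le mu_norm (norm_mul_le K2 part2).
apply: le_trans (norm_add_le part1 part3) _.
have -> : s * (mu * (2 * CA * e ^+ 4)) + mu * (2 * (42 * (s * e ^+ 4))) =
   s * (mu * ((2 * CA + 84) * e ^+ 4)) by ring.
by [].
Qed.
(* If dl = 0 then w v = 0, and if dl = 1 then l = n and s = t. *)
Lemma t_twin v : t * tau * w v = w v.
Proof.
have [dl0|dlp] := posnP dl.
  suff -> : w v = 0 by rewrite mulr0.
  rewrite /w big1 // => a fav; have := fb2 v.
  by rewrite dl0 (bigD1 a) //= fav.
have nl : n%:R = l%:R :> R.
  have h : (n%:R - l%:R) * (dl%:R * mu) = 0 :> R.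
    have : l%:R * (mu * (n%:R - dl%:R)) = n%:R * (mu * (l%:R - dl%:R)).
      by rewrite mun mul ls nt.
    by move=> E; transitivity (l%:R * (mu * (n%:R - dl%:R)) - n%:R * (mu * (l%:R - dl%:R)));
      [ring | rewrite E subrr].
  move/eqP: h; rewrite mulf_eq0 subr_eq0 => /orP[/eqP //|].
  by rewrite gt_eqF // mulr_gt0 // ltr0n.
have -> : t = s by rewrite -mul -mun nl.
by rewrite stau mul1r.
Qed.

Lemma mu_l_le : mu * l%:R <= 2 * t.
Proof.
have : 0 < l%:R - dl%:R :> R by rewrite -(pmulr_rgt0 _ mu_gt0) mul t_gt0.
rewrite subr_gt0 ltr_nat => H.
have h : mu <= t.
  rewrite -mul -[leLHS]mulr1 ler_pM2l //.
  by rewrite lerBrDr addrC natr1 ler_nat.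
have -> : mu * l%:R = t + dl%:R * mu by rewrite -mul; ring.
by have := dl_le1R; have := mu_gt0; move: h; nra.
Qed.

(** This sum normalises the ratios in [edge_step], so its relative error has to be mu e^4 and not
    just e^4. The term [y * Sx] of [edge_corr] is there for this: it cancels the average of -x y (1
    + x) over the rows and leaves [Sx * Sy], of weight 4. *)
Lemma col_sum_apx j d v : lowered j d -> (j <= k)%N ->
  `|\sum_(a | ok a v) mu * ph d a v - t * (1 + Y d v)|
  <= t * (mu * (34 * e ^+ 4)).
Proof.
move=> Hd jlek.
have e20 : 0 <= e ^+ 2 := sqr_ge0 e.
have e40 : 0 <= e ^+ 4 by rewrite exprn_ge0 // ltW.
have y2 := col_dev_le v Hd jlek; set y := Y d v in y2 *.
have w1 := w_le v.
have [Sx0 Sx1] := andP Sx_range; have [Sy0 Sy1] := andP Sy_range.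
have [kap0 kap1] := andP kap_range.
have ee : e * e ^+ 2 <= e ^+ 2 / 100 := e_mul_le e20.
set J := j%:R * tau.
have J0 : 0 <= J by rewrite mulr_ge0 // ltW.
have Jm : J <= l%:R * (mu * e ^+ 4).
  rewrite /J -m_tau mulrAC; apply: ler_wpM2r; first exact: ltW.
  by apply: le_trans k_m; rewrite ler_nat.
have munorm : `|mu| <= mu by rewrite gtr0_norm.
have kapnorm : `|kap| <= 2 * mu by rewrite ger0_norm.
have taunorm : `|tau| <= e ^+ 2 by rewrite gtr0_norm //; case/andP: tau_le.
have Sxn : `|Sx| <= e ^+ 2 by rewrite ger0_norm.
have Syn : `|Sy| <= e ^+ 2 by rewrite ger0_norm.
have Jn : `|J| <= J by rewrite ger0_norm.
pose f a := (1 + X d a) * (1 + mu * edge_corr mu Sx Sy tau (X d a) y (z a) (w v)).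
have fE a : f a = 1 + kap * (y * Sx) + mu * tau * w v
    + (1 + kap * (Sy - y + y * Sx) + mu * tau * w v) * X d a
    + kap * (Sy - y) * X d a ^+ 2 + mu * tau * z a + mu * tau * (X d a * z a).
  by rewrite /f /edge_corr /kap; ring.
have all_sum : `|\sum_a f a - (l%:R + mu * tau * l%:R * w v)|
    <= 3 * J + 4 * (mu * (l%:R * e ^+ 4)).
  have lin p0 p1 p2 p3 p4 : \sum_a (p0 + p1 * X d a + p2 * X d a ^+ 2 + p3 * z a
      + p4 * (X d a * z a)) = l%:R * p0 + p1 * \sum_a X d a
      + p2 * \sum_a X d a ^+ 2 + p3 * \sum_a z a + p4 * \sum_a (X d a * z a).
    by rewrite !mulr_sumr mulr_natl -[l in p0 *+ l]card_ord -sumr_const -!big_split.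
  rewrite (eq_bigr _ (fun a _ => fE a)) lin sum_z (sum_row_dev Hd) -/J.
  set XX := \sum_a X d a ^+ 2; set XZ := \sum_a (X d a * z a).
  have hXX : `|XX - l%:R * Sx| <= 4 * e * J := sum_row_dev_sq Hd jlek.
  have hXZ : `|XZ| <= l%:R * (2 * e * e).
    have B a : `|X d a * z a - 0| <= 2 * e * e.
      by rewrite subr0; apply: norm_mul_le; [exact: row_dev_le jlek | exact: z_le].
    have := @apx_sum R _ xpredT (fun a => X d a * z a) (fun=> 0) _ (fun a _ => B a).
    by rewrite card_ord big1_eq subr0; apply; rewrite !mulr_ge0 // ltW.
  have -> : l%:R * (1 + kap * (y * Sx) + mu * tau * w v)
    + (1 + kap * (Sy - y + y * Sx) + mu * tau * w v) * - J + kap * (Sy - y) * XX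
    + mu * tau * 0 + mu * tau * XZ - (l%:R + mu * tau * l%:R * w v) =
    - (1 + kap * (y * Sx) + mu * tau * w v) * J + kap * (Sy - y) * (XX - l%:R * Sx - J)
    + kap * (Sy * (l%:R * Sx)) + mu * tau * XZ by ring.
  have yb : `|y| <= 1 / 50 by apply: (le_trans y2); have := e_le; lra_only.
  have e2b : e ^+ 2 <= 1 / 10000.
    by have := e_mul_le (ltW e_gt0); rewrite expr2; have := e_le; lra_only.
  have h1 : `|- (1 + kap * (y * Sx) + mu * tau * w v) * J| <= 3 / 2 * J.
    apply: norm_mul_le => //; rewrite normrN.
    have a1 := norm_mul_le kapnorm (norm_mul_le yb Sxn).
    have a2 := norm_mul_le (norm_mul_le munorm taunorm) w1.
    have a3 : `|1 : R| <= 1 by rewrite normr1.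
    apply: le_trans (norm_add_le (norm_add_le a3 a1) a2) _.
    have := mu_mul_le e20; have := mu_mul_le (mulr_ge0 e20 (ltW e_gt0)).
    by move: e2b ee; lra_only.
  have h2 : `|kap * (Sy - y) * (XX - l%:R * Sx - J)| <= 1 / 2 * J.
    have a1 := norm_mul_le kapnorm (norm_sub_le Syn yb).
    have a2 := norm_mul_le a1 (norm_sub_le hXX Jn).
    apply: (le_trans a2).
    have -> : 2 * mu * (e ^+ 2 + 1 / 50) * (4 * e * J + J) =
      (2 * mu * (e ^+ 2 + 1 / 50) * (4 * e + 1)) * J by ring.
    apply: ler_wpM2r => //.
    have b1 : `|2 * mu| <= 1 / 500.
      by rewrite ger0_norm ?mulr_ge0 ?(ltW mu_gt0) //; have := mu_le; lra_only.
    have b2 : `|e ^+ 2 + 1 / 50| <= 1.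
      by move: e2b e20; rewrite ler_norml; lra_only.
    have b3 : `|4 * e + 1| <= 2.
      by move: e_le e_gt0; rewrite ler_norml; lra_only.
    apply: le_trans (ler_norm _) _.
    by apply: le_trans (norm_mul_le (norm_mul_le b1 b2) b3) _; lra_only.
  have h3 : `|kap * (Sy * (l%:R * Sx))| <= 2 * (mu * (l%:R * e ^+ 4)).
    have ln : `|l%:R : R| <= l%:R by rewrite ger0_norm.
    apply: le_trans (norm_mul_le kapnorm (norm_mul_le Syn (norm_mul_le ln Sxn))) _.
    by rewrite (exprD e 2 2); lra_only.
  have h4 : `|mu * tau * XZ| <= 2 * (mu * (l%:R * e ^+ 4)).
    apply: le_trans (norm_mul_le (norm_mul_le munorm taunorm) hXZ) _.
    by rewrite (exprD e 2 2) [e ^+ 2]expr2; lra_only.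
  apply: le_trans (norm_add_le (norm_add_le (norm_add_le h1 h2) h3) h4) _.
  by move: J0; lra_only.
have fb_sum : `|\sum_(a | fb a v) f a - (dl%:R + w v)| <= J + 40 * (mu * e ^+ 2).
  have -> : \sum_(a | fb a v) f a - (dl%:R + w v) =
      \sum_(a | fb a v) (f a - 1 - X d0 a).
    rewrite sumrB -/(w v) sumrB (sum_cond _ (fun=> 1)).
    by under [X in _ = _ - X - _]eq_bigr do rewrite mulr1; rewrite fb_sum2; ring.
  have B0 : 0 <= J + 40 * (mu * e ^+ 2) by rewrite addr_ge0 ?mulr_ge0 // ltW.
  have := @cond_sum_le _ (fun a => fb a v) (fun a => f a - 1 - X d0 a) _ (fb_sum2 v) _ B0.
  move=> H; apply: (le_trans (H _)); last by rewrite ler_piMl.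
  move=> a _.
  have x2 := row_dev_le a Hd jlek.
  have -> : f a - 1 - X d0 a = mu * ((1 + X d a) * edge_corr mu Sx Sy tau (X d a) y (z a) (w v))
     - (X d0 a - X d a) by rewrite /f; ring.
  have h1 : `|X d0 a - X d a| <= J.
    by have [? ?] := andP (row_dev_shift a Hd); rewrite ger0_norm.
  have cn : `|(1 - mu)^-1| <= 2.
    rewrite ger0_norm ?invr_ge0; last by have := mu_le; lra_only.
    by rewrite invf_ple ?posrE; have := mu_le; lra_only.
  have h2 : `|edge_corr mu Sx Sy tau (X d a) y (z a) (w v)| <= 20 * e ^+ 2.
    rewrite /edge_corr.
    have a1 : `|- (X d a * y)| <= 2 * e * (2 * e) by rewrite normrN; exact: norm_mul_le.
    have a2 := norm_mul_le cn (norm_add_le (norm_add_le a1 (norm_mul_le x2 Syn))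
      (norm_mul_le y2 Sxn)).
    have a3 := norm_mul_le taunorm (norm_add_le (z_le a) w1).
    apply: le_trans (norm_add_le a2 a3) _.
    by move: ee e20; lra_only.
  have h3 : `|1 + X d a| <= 2.
    by move: x2 e_le; rewrite !ler_norml; lra_only.
  apply: le_trans (norm_sub_le (norm_mul_le munorm (norm_mul_le h3 h2)) h1) _.
  by lra_only.
have ok_sum : `|\sum_(a | ok a v) f a - (l%:R - dl%:R)|
    <= 4 * J + 4 * (mu * (l%:R * e ^+ 4)) + 41 * (mu * e ^+ 2).
  have -> : \sum_(a | ok a v) f a = \sum_a f a - \sum_(a | fb a v) f a.
    by rewrite [in RHS](bigID (fun a => fb a v)) /= addrC addrK.
  have mul_l : mu * l%:R = t + dl%:R * mu by rewrite -mul; ring.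
  (* Omitting the forbidden row contributes -[w v], and the term [tau * w] of [edge_corr], summed
     over all rows, contributes [mu * tau * l * w v]. By [t_twin] they cancel up to
     [dl * mu * tau * w v]. *)
  have -> : \sum_a f a - \sum_(a | fb a v) f a - (l%:R - dl%:R) =
      (\sum_a f a - (l%:R + mu * tau * l%:R * w v))
      - (\sum_(a | fb a v) f a - (dl%:R + w v)) + dl%:R * (mu * tau * w v).
    have : mu * tau * l%:R * w v - w v = dl%:R * (mu * tau * w v).
      rewrite -{2}[w v]t_twin.
      by transitivity ((mu * l%:R - t) * (tau * w v)); [ring | rewrite mul_l; ring].
    by move=> <-; ring.
  have dln : `|dl%:R : R| <= 1 by rewrite ger0_norm.
  have h1 : `|dl%:R * (mu * tau * w v)| <= mu * e ^+ 2.
    apply: le_trans (norm_mul_le dln (norm_mul_le (norm_mul_le munorm taunorm) w1)) _.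
    have := mulr_ge0 (ltW mu_gt0) (mulr_ge0 e20 (ltW e_gt0)).
    have := ler_wpM2l (ltW mu_gt0) ee; have := mulr_ge0 (ltW mu_gt0) e20.
    by lra_only.
  apply: le_trans (norm_add_le (norm_sub_le all_sum fb_sum) h1) _.
  by lra_only.
have -> : \sum_(a | ok a v) mu * ph d a v - t * (1 + y) =
    (1 + y) * (mu * (\sum_(a | ok a v) f a - (l%:R - dl%:R))).
  have -> : \sum_(a | ok a v) mu * ph d a v = (1 + y) * (mu * \sum_(a | ok a v) f a).
    by rewrite !mulr_sumr; apply: eq_bigr => a _; rewrite /edge_apx /f -/y; ring.
  by rewrite -mul; ring.
have y1 : `|1 + y| <= 2 by move: y2 e_le; rewrite !ler_norml; lra_only.
apply: le_trans (norm_mul_le y1 (norm_mul_le munorm ok_sum)) _.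
have me : mu * e ^+ 2 <= t * (mu * e ^+ 4).
  have -> : mu * e ^+ 2 = t * (mu * (tau' * e ^+ 2)).
    by transitivity (t * tau' * (mu * e ^+ 2)); [rewrite ttau mul1r | ring].
  apply: ler_wpM2l; first exact: ltW.
  apply: ler_wpM2l; first exact: ltW.
  by rewrite (exprD e 2 2); apply: ler_wpM2r => //; case/andP: tau'_le.
have me2 := ler_wpM2l (ltW mu_gt0) me.
have ml := ler_wpM2r (mulr_ge0 (ltW mu_gt0) e40) mu_l_le.
have mJ := ler_wpM2l (ltW mu_gt0) Jm.
have tm := mulr_ge0 (ltW t_gt0) (mulr_ge0 (ltW mu_gt0) e40).
have := mu_mul_le tm; move: tm.
move: me2 ml mJ; lra_only.
Qed.

End Recursion.

(** * One round of the recursion and its iteration *)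

Section Steps.
Variables (R : realFieldType) (l n m dl k : nat) (fb : 'I_l -> 'I_n -> bool).
Variables (d0 : degrees l n) (s t mu tau tau' e CA : R).
Hypothesis HR : regime m dl k fb d0 s t mu tau tau' e CA.
Hypothesis HE : forall j d, lowered m d0 j d -> (j <= k)%N ->
  (0 < #|realizations fb d|)%N.

Implicit Types (d : degrees l n) (a b : 'I_l) (v u : 'I_n) (j : nat).
Notation X := (row_dev tau).
Notation Y := (col_dev tau').
Notation Sx := (row_msq d0 tau).
Notation Sy := (col_msq d0 tau').
Notation z := (row_twin fb d0 tau').
Notation w := (col_twin fb d0 tau).
Notation ok a v := (~~ fb a v).
Notation ph d a v := (edge_apx mu Sx Sy tau (X d a) (Y d v) (z a) (w v)).
Notation yh d a b v :=
  (path_apx mu Sx Sy tau tau' (X d a) (X d b) (Y d v) (z a) (z b) (w v)).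
Notation P := (edge_pr R fb).
Notation PP := (path_pr R fb).
Notation low := (lowered m d0).

Lemma e_pos : 0 < e. Proof. exact: e_gt0 HR. Qed.
Lemma mu_pos : 0 < mu. Proof. exact: mu_gt0 HR. Qed.
Lemma tau_pos : 0 < tau. Proof. exact: tau_gt0 HR. Qed.
Lemma tau'_pos : 0 < tau'. Proof. exact: tau'_gt0 HR. Qed.
Lemma s_pos : 0 < s. Proof. exact: s_gt0 HR. Qed.
Lemma t_pos : 0 < t. Proof. exact: t_gt0 HR. Qed.
#[local] Hint Resolve e_pos mu_pos tau_pos tau'_pos s_pos t_pos : core.

Lemma degree1_gt0 j d a : low j d -> (j <= k)%N -> (0 < d.1 a)%N.
Proof.
move=> Hd jk; have := row_dev_le HR a Hd jk.
rewrite lt0n /row_dev; apply: contraTneq => ->.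
by rewrite mul0r sub0r normrN normr1 -ltNge; have := e_le HR; lra_only.
Qed.

Lemma degree2_gt0 j d v : low j d -> (j <= k)%N -> (0 < d.2 v)%N.
Proof.
move=> Hd jk; have := col_dev_le HR v Hd jk.
rewrite lt0n /col_dev; apply: contraTneq => ->.
by rewrite mul0r sub0r normrN normr1 -ltNge; have := e_le HR; lra_only.
Qed.

Lemma lowered_decr j d a v : low j d -> (j <= k)%N -> low j.+1 (decr d a v).
Proof.
move=> Hd jk; have da := degree1_gt0 a Hd jk; have dv := degree2_gt0 v Hd jk.
have dec_sum q (f : {ffun 'I_q -> nat}) i : (0 < f i)%N ->
    (\sum_j (f j - (j == i)%N) + 1 = \sum_j f j)%N.
  move=> fi; rewrite (bigD1 i) //= [in RHS](bigD1 i) //= eqxx addnAC subnK //.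
  by congr (_ + _)%N; apply: eq_bigr => i' /negPf ->; rewrite subn0.
case: Hd => h1 h2 h3 h4; split.
- by move=> b; rewrite ffunE; apply: leq_trans (leq_subr _ _) (h1 b).
- by move=> u; rewrite ffunE; apply: leq_trans (leq_subr _ _) (h2 u).
- rewrite -h3 -(dec_sum _ _ _ da) -add1n addnA; congr (_ + _ + _)%N.
  by apply: eq_bigr => b _; rewrite ffunE.
- rewrite -h4 -(dec_sum _ _ _ dv) -add1n addnA; congr (_ + _ + _)%N.
  by apply: eq_bigr => b _; rewrite ffunE.
Qed.

Lemma row_dev_decr j d a v b : low j d -> (j <= k)%N ->
  X (decr d a v) b = X d b - (b == a)%:R * tau.
Proof.
move=> Hd jk; have da := degree1_gt0 a Hd jk; rewrite /row_dev ffunE.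
have [->|_] := eqVneq b a; last by rewrite subn0 mul0r subr0.
by rewrite natrB // mulrBl mul1r addrAC.
Qed.

Lemma col_dev_decr j d a v u : low j d -> (j <= k)%N ->
  Y (decr d a v) u = Y d u - (u == v)%:R * tau'.
Proof.
move=> Hd jk; have da := degree2_gt0 v Hd jk; rewrite /col_dev ffunE.
have [->|_] := eqVneq u v; last by rewrite subn0 mul0r subr0.
by rewrite natrB // mulrBl mul1r addrAC.
Qed.

Lemma e2_small : e ^+ 2 <= e / 100 /\ e ^+ 2 <= 1 / 10000.
Proof.
have h := e_mul_le HR (ltW e_pos); rewrite expr2; split=> //.
by apply: le_trans h _; have := e_le HR; lra_only.
Qed.

Lemma edge_corr_le x y za ww : `|x| <= 2 * e -> `|y| <= 2 * e ->
  `|za| <= 2 * e -> `|ww| <= 2 * e ->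
  `|edge_corr mu Sx Sy tau x y za ww| <= 20 * e ^+ 2.
Proof.
move=> hx hy hz hw.
have [Sx0 Sx1] := andP (Sx_range HR); have [Sy0 Sy1] := andP (Sy_range HR).
have e_sq_ge0 : 0 <= e ^+ 2 := sqr_ge0 e.
have ee : e * e ^+ 2 <= e ^+ 2 / 100 := e_mul_le HR e_sq_ge0.
have Sxn : `|Sx| <= e ^+ 2 by rewrite ger0_norm.
have Syn : `|Sy| <= e ^+ 2 by rewrite ger0_norm.
have taun : `|tau| <= e ^+ 2.
  by rewrite gtr0_norm //; case/andP: (rg_tau_le HR).
have cn : `|(1 - mu)^-1| <= 2.
  have ml := mu_le HR.
  rewrite ger0_norm ?invr_ge0; last by move: ml; lra_only.
  by rewrite invf_ple ?posrE; move: ml; lra_only.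
rewrite /edge_corr.
have a1 : `|- (x * y)| <= 2 * e * (2 * e) by rewrite normrN; exact: norm_mul_le.
have a2 := norm_mul_le cn (norm_add_le (norm_add_le a1 (norm_mul_le hx Syn))
  (norm_mul_le hy Sxn)).
have a3 := norm_mul_le taun (norm_add_le hz hw).
apply: le_trans (norm_add_le a2 a3) _.
by move: ee e_sq_ge0; lra_only.
Qed.

Lemma edge_apx_le x y za ww : `|x| <= 2 * e -> `|y| <= 2 * e ->
  `|za| <= 2 * e -> `|ww| <= 2 * e ->
  `|edge_apx mu Sx Sy tau x y za ww - (1 + x) * (1 + y)| <= 40 * (mu * e ^+ 2) /\
  `|edge_apx mu Sx Sy tau x y za ww| <= 3 / 2.
Proof.
move=> hx hy hz hw; have hu := edge_corr_le hx hy hz hw.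
have [h1 h2] := e2_small; have el := e_le HR.
have hx1 : `|1 + x| <= 11 / 10 by move: hx el; rewrite !ler_norml; lra_only.
have hy1 : `|1 + y| <= 11 / 10 by move: hy el; rewrite !ler_norml; lra_only.
have mn : `|mu| <= mu by rewrite gtr0_norm.
have e_sq_ge0 : 0 <= e ^+ 2 := sqr_ge0 e.
have me := mu_mul_le HR e_sq_ge0.
have D : `|edge_apx mu Sx Sy tau x y za ww - (1 + x) * (1 + y)| <= 40 * (mu * e ^+ 2).
  rewrite /edge_apx.
  have -> : (1 + x) * (1 + y) * (1 + mu * edge_corr mu Sx Sy tau x y za ww)
     - (1 + x) * (1 + y) =
     (1 + x) * (1 + y) * (mu * edge_corr mu Sx Sy tau x y za ww) by ring.
  apply: le_trans (norm_mul_le (norm_mul_le hx1 hy1) (norm_mul_le mn hu)) _.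
  by move: (mulr_ge0 (ltW mu_pos) e_sq_ge0); lra_only.
split=> //; rewrite -[X in `|X|](subrK ((1 + x) * (1 + y))).
apply: le_trans (norm_add_le D (norm_mul_le hx1 hy1)) _.
by move: me h2; lra_only.
Qed.

Lemma path_apx_le xa xb y za zb ww : `|xa| <= 2 * e -> `|xb| <= 2 * e ->
  `|y| <= 2 * e -> `|za| <= 2 * e -> `|zb| <= 2 * e -> `|ww| <= 2 * e ->
  `|path_apx mu Sx Sy tau tau' xa xb y za zb ww| <= 5.
Proof.
move=> ha hb hy hza hzb hw.
have [_ h1] := edge_apx_le ha hy hza hw; have [_ h2] := edge_apx_le hb hy hzb hw.
have [g1 g2] := e2_small; have el := e_le HR; have ml := mu_le HR.
have mn : `|mu| <= 1 by rewrite gtr0_norm //; move: ml; lra_only.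
have tn : `|tau'| <= 1 / 10000.
  rewrite gtr0_norm //; apply: le_trans g2.
  by case/andP: (rg_tau'_le HR).
have h3 : `|1 + path_corr mu tau' xa xb y| <= 2.
  rewrite /path_corr.
  have n1 : `|1 : R| <= 1 by rewrite normr1.
  have a1 : `|- (1 - mu)| <= 1 by rewrite normrN ler_norml; move: ml mu_pos; lra_only.
  have a2 := norm_mul_le mn (norm_add_le ha hb).
  apply: le_trans (norm_add_le n1 (norm_mul_le tn (norm_add_le (norm_add_le a1 hy) a2))) _.
  by move: el; lra_only.
apply: le_trans (norm_mul_le (norm_mul_le h1 h2) h3) _.
lra_only.
Qed.

Definition edge_close j h := forall d a v, low j d -> ok a v ->
  `|P d a v - mu * ph d a v| <= mu * h.
Definition path_close j h := forall d a b v, low j d -> a != b ->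
  ok a v -> ok b v -> `|PP d a b v - mu ^+ 2 * yh d a b v| <= mu ^+ 2 * h.

Lemma mu_norm_le : `|mu| <= mu. Proof. by rewrite gtr0_norm. Qed.
Lemma e_sq_ge0 : 0 <= e ^+ 2. Proof. exact: sqr_ge0. Qed.
Lemma e_pow4_ge0 : 0 <= e ^+ 4. Proof. by rewrite exprn_ge0 // ltW. Qed.
#[local] Hint Resolve mu_norm_le e_sq_ge0 e_pow4_ge0 : core.

Lemma z_le2 a : `|z a| <= 2 * e. Proof. exact/(one_e HR)/(z_le HR). Qed.
Lemma w_le2 v : `|w v| <= 2 * e. Proof. exact/(one_e HR)/(w_le HR). Qed.

Lemma ratio_loss_le xa xb za zb : `|xa| <= 3 * e -> `|xb| <= 2 * e ->
  `|za| <= 2 * e -> `|zb| <= 2 * e ->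
  `|ratio_loss mu Sy tau tau' dl%:R xa xb za zb| <= 2.
Proof.
move=> ha hb hza hzb.
have [g1 g2] := e2_small; have el := e_le HR; have ml := mu_le HR.
have [Sy0 Sy1] := andP (Sy_range HR); have [kap0 kap1] := andP (kap_range HR).
have mn : `|mu| <= 1 by rewrite gtr0_norm //; move: ml; lra_only.
have tn : `|tau| <= 1 / 1000.
  rewrite gtr0_norm //; have [_ h] := andP (rg_tau_le HR); move: h g2; lra_only.
have t'n : `|tau'| <= 1 / 1000.
  rewrite gtr0_norm //; have [_ h] := andP (rg_tau'_le HR); move: h g2; lra_only.
have Sn : `|Sy| <= 1 / 1000 by rewrite ger0_norm //; move: Sy1 g2; lra_only.
have kn : `|mu * (1 - mu)^-1| <= 1 by rewrite ger0_norm //; move: kap1 ml; lra_only.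
have dn : `|dl%:R : R| <= 1 by rewrite ger0_norm // (dl_le1R HR).
have m1 : `|1 - mu| <= 1 by rewrite ler_norml; move: ml mu_pos; lra_only.
have q1 := norm_mul_le m1 t'n.
have q2 := norm_mul_le dn (norm_mul_le mn tn).
have q3 := norm_mul_le (norm_mul_le kn (norm_add_le ha hb)) (norm_sub_le Sn q1).
have q4 := norm_mul_le (norm_mul_le mn tn) (norm_add_le hza hzb).
have hcc : `|codeg_corr mu Sy tau tau' dl%:R xa xb za zb| <= 1 / 10.
  rewrite /codeg_corr.
  apply: le_trans (norm_sub_le (norm_sub_le (norm_sub_le (norm_sub_le Sn q1) q2) q3) q4) _.
  by move: el; lra_only.
have n1 : `|1 : R| <= 1 by rewrite normr1.
have r1 := norm_mul_le (norm_add_le n1 ha) (norm_add_le n1 hcc).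
have r2 := norm_mul_le tn (norm_add_le dn hza).
rewrite /ratio_loss; apply: le_trans (norm_add_le r1 r2) _.
by move: el; lra_only.
Qed.

(** Estimates the bracket of [edge_pr_ratio] scaled by tau = 1/s. Blocked edges and common
    neighbours make up only a fraction O(mu) of the edges at b, which turns an error h into mu h.
    The constant 89 is 84 from [codegree_apx], 3 from the blocked edges, and 2 from the n path
    errors, as mu n <= 2 s. *)
Lemma switch_apx j h d a b v : low j d -> (j < k)%N -> a != b ->
  edge_close j.+1 h -> path_close j.+1 h -> 0 <= h ->
  `|tau * ((d.1 b)%:R - blocked R fb (decr d a v) b a
           - codegree R fb (decr d a v) a b)
    - (1 + X d b) * (1 - mu * ratio_loss mu Sy tau tau' dl%:R
          (X d a - tau) (X d b) (z a) (z b))|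
  <= mu * ((2 * CA + 89) * (h + e ^+ 4)).
Proof.
move=> Hd jk ab EC PC h0; have jk' := ltnW jk.
set d1 := decr d a v.
have Hd1 : low j.+1 d1 by exact: lowered_decr.
have xa1 : X d1 a = X d a - tau by rewrite (row_dev_decr _ _ _ Hd jk') eqxx mul1r.
have xb1 : X d1 b = X d b.
  by rewrite (row_dev_decr _ _ _ Hd jk') eq_sym (negPf ab) mul0r subr0.
have [_ tle] := andP (rg_tau_le HR).
have [g1 g2] := e2_small; have el := e_le HR; have ml := mu_le HR.
have tn : `|tau| <= tau by rewrite gtr0_norm.
have tn1 : tau <= 1 by move: tle g2; lra_only.
have hb1 := row_dev_le HR b Hd jk'.
have hb1' : `|1 + X d b| <= 2 by move: hb1 el; rewrite !ler_norml; lra_only.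
pose T1 := \sum_(u | fb a u) (mu * ((1 + X d b) * (1 + Y d0 u))).
have T1E : T1 = mu * ((1 + X d b) * (dl%:R + z a)).
  rewrite /T1 -mulr_sumr -mulr_sumr big_split /= -/(row_twin _ _ _ a).
  by rewrite -(fb_sum1 HR a) sum_cond; congr (_ * (_ * (_ + _)));
    apply: eq_bigr => u _; rewrite mulr1.
have blk : `|tau * blocked R fb d1 b a - tau * T1| <= mu * (3 * (h + e ^+ 4)).
  rewrite -mulrBr /blocked /T1 -sumrB.
  pose B := h + 2 * (j.+1%:R * tau') + 40 * (mu * e ^+ 2).
  have B0 : 0 <= mu * B.
    by rewrite mulr_ge0 ?addr_ge0 ?mulr_ge0 // ltW.
  have term u : fb a u -> `|P d1 b u - mu * ((1 + X d b) * (1 + Y d0 u))| <= mu * B.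
    move=> fau; have obu : ok b u by have := fb_disjoint HR u ab; rewrite fau.
    have hy := col_dev_le HR u Hd1 jk.
    have [h1 _] := edge_apx_le hb1 hy (z_le2 b) (w_le2 u).
    have h2 := EC d1 b u Hd1 obu; rewrite xb1 in h2.
    have [s1 s2] := andP (col_dev_shift HR u Hd1).
    have -> : P d1 b u - mu * ((1 + X d b) * (1 + Y d0 u)) =
      (P d1 b u - mu * edge_apx mu Sx Sy tau (X d b) (Y d1 u) (z b) (w u)) +
      mu * (edge_apx mu Sx Sy tau (X d b) (Y d1 u) (z b) (w u) -
             (1 + X d b) * (1 + Y d1 u)) -
      mu * ((1 + X d b) * (Y d0 u - Y d1 u)) by ring.
    have s3 : `|Y d0 u - Y d1 u| <= j.+1%:R * tau' by rewrite ger0_norm.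
    apply: le_trans (norm_sub_le (norm_add_le h2 (norm_mul_le mu_norm_le h1))
      (norm_mul_le mu_norm_le (norm_mul_le hb1' s3))) _.
    rewrite /B -!mulrDr; apply: ler_wpM2l; first exact: ltW.
    have J0 : 0 <= j.+1%:R * tau' by rewrite mulr_ge0 // ltW.
    by move: J0 (mulr_ge0 (ltW mu_pos) e_sq_ge0); lra_only.
  have cs := cond_sum_le (f := fun u => P d1 b u - mu * ((1 + X d b) * (1 + Y d0 u)))
    (fb_sum1 HR a) term B0.
  apply: le_trans (norm_mul_le tn cs) _.
  have -> : tau * (dl%:R * (mu * B)) = mu * (dl%:R * (tau * B)) by ring.
  apply: ler_wpM2l; first exact: ltW.
  apply: (@le_trans _ _ (tau * B)).
    rewrite ler_piMl ?(dl_le1R HR) // mulr_ge0 // ?(ltW tau_pos) //.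
    by rewrite -(pmulr_rge0 _ mu_pos).
  have J2 : tau * (j.+1%:R * tau') <= e ^+ 4.
    apply: le_trans (rg_k_tau2 HR); rewrite mulrCA; apply: ler_wpM2r.
      by rewrite mulr_ge0 // ltW.
    by rewrite ler_nat.
  have th : tau * h <= h by rewrite ler_piMl.
  have te : tau * e ^+ 2 <= e ^+ 4.
    by rewrite (exprD e 2 2); apply: ler_wpM2r.
  have te0 : 0 <= tau * e ^+ 2 by rewrite mulr_ge0 // ltW.
  have mte := mu_mul_le HR te0.
  have -> : tau * B = tau * h + 2 * (tau * (j.+1%:R * tau')) + 40 * (mu * (tau * e ^+ 2)).
    by rewrite /B; ring.
  by move: J2 th te mte h0 e_pow4_ge0; lra_only.
pose F u := mu ^+ 2 * path_apx mu Sx Sy tau tau' (X d1 a) (X d1 b) (Y d1 u) (z a) (z b) (w u).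
have cod : `|tau * codegree R fb d1 a b - tau * \sum_(u | ok a u && ok b u) F u|
    <= mu * (2 * h).
  have -> : codegree R fb d1 a b = \sum_(u | ok a u && ok b u) PP d1 a b u.
    rewrite /codegree [RHS]big_mkcond; apply: eq_bigr => u _.
    have [au|au] := boolP (fb a u); first by rewrite path_pr_fb.
    by have [bu|//] := boolP (fb b u); rewrite path_prC path_pr_fb.
  rewrite -mulrBr.
  have cs := @apx_sum R _ (fun u => ok a u && ok b u) (PP d1 a b) F (mu ^+ 2 * h) _ _.
  apply: le_trans (norm_mul_le tn (cs _ _)) _.
  - by move=> u /andP[oa ob]; exact: PC.
  - by rewrite mulr_ge0 // sqr_ge0.
  rewrite card_ord.
  have -> : tau * (n%:R * (mu ^+ 2 * h)) = mu * (tau * (mu * n%:R) * h) by ring.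
  apply: ler_wpM2l; first exact: ltW.
  apply: ler_wpM2r => //.
  apply: le_trans (ler_wpM2l (ltW tau_pos) (mu_n_le HR)) _.
  by rewrite mulrCA [tau * s]mulrC (rg_stau HR) mulr1.
have main := codegree_apx HR Hd1 jk ab.
rewrite xa1 xb1 in main.
set G := (1 + (X d a - tau)) * (1 + X d b) *
  (1 + codeg_corr mu Sy tau tau' dl%:R (X d a - tau) (X d b) (z a) (z b)) in main.
have cod2 : `|tau * \sum_(u | ok a u && ok b u) F u - mu * G| <= mu * ((2 * CA + 84) * e ^+ 4).
  have -> : mu * G = tau * (s * (mu * G)).
    by rewrite [RHS]mulrA [tau * s]mulrC (rg_stau HR) mul1r.
  rewrite -mulrBr /F xa1 xb1; apply: le_trans (norm_mul_le tn main) _.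
  by rewrite [leLHS]mulrA [tau * s]mulrC (rg_stau HR) mul1r.
have sb : tau * (d.1 b)%:R = 1 + X d b by rewrite /row_dev addrC subrK mulrC.
have -> : tau * ((d.1 b)%:R - blocked R fb d1 b a - codegree R fb d1 a b)
    - (1 + X d b) * (1 - mu * ratio_loss mu Sy tau tau' dl%:R
          (X d a - tau) (X d b) (z a) (z b)) =
  - (tau * blocked R fb d1 b a - tau * T1)
  - (tau * codegree R fb d1 a b - tau * \sum_(u | ok a u && ok b u) F u)
  - (tau * \sum_(u | ok a u && ok b u) F u - mu * G).
  rewrite !mulrBr sb T1E /ratio_loss /G; ring.
rewrite -normrN in blk.
apply: le_trans (norm_sub_le (norm_sub_le blk cod) cod2) _.
rewrite -!mulrDr; apply: ler_wpM2l; first exact: ltW.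
have := mulr_ge0 (CA_ge0 HR) h0; move: h0 e_pow4_ge0; lra_only.
Qed.

Lemma codegreeC d a b : codegree R fb d a b = codegree R fb d b a.
Proof. by apply: eq_bigr => u _; exact: path_prC. Qed.

Lemma edge_decr_apx j h d b v : low j d -> (j < k)%N -> ok b v ->
  edge_close j.+1 h ->
  `|1 - P (decr d b v) b v
    - (1 - mu * edge_apx mu Sx Sy tau (X d b - tau) (Y d v - tau') (z b) (w v))|
  <= mu * h.
Proof.
move=> Hd jk ob EC; have jk' := ltnW jk.
have := EC (decr d b v) b v (lowered_decr b v Hd jk') ob.
rewrite (row_dev_decr _ _ _ Hd jk') (col_dev_decr _ _ _ Hd jk') !eqxx !mul1r.
by rewrite -normrN; congr (`|_| <= _); ring.
Qed.

(** [B] adds to the 89 of [switch_apx] the bound 4 of [prod_le], which multiplies the error of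
    [edge_decr_apx]. [Q] is twice the constant of [edge_pair_apx], because mu l <= 2 t, plus the 34
    of [col_sum_apx]. *)
Let B : R := 2 * CA + 93.
Let Q : R := 64 * CA + 32 * B + 34.

(** By [edge_pr_ratio], P av A = P bv A' where A and A' are known up to O(mu (h + e^4)). Multiplying
    the difference by A' and substituting leaves P av times an expression that [edge_ratio_sym]
    makes small. The bound is proportional to P av, whose order of magnitude is only settled in
    [edge_step]. *)
Lemma edge_pair_apx j h d a b v : low j d -> (j < k)%N -> a != b ->
  ok a v -> ok b v -> edge_close j.+1 h -> path_close j.+1 h -> 0 <= h ->
  mu * (B * (h + e ^+ 4)) <= 1 / 4 ->
  `|P d a v * (mu * ph d b v) - P d b v * (mu * ph d a v)|
  <= P d a v * (mu ^+ 2 * ((32 * CA + 16 * B) * (h + e ^+ 4))).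
Proof.
move=> Hd jk ab oa ob EC PC h0 Bsmall; have jk' := ltnW jk.
set eta := h + e ^+ 4 in Bsmall *.
have ba : b != a by rewrite eq_sym.
have CA0 := CA_ge0 HR.
have B0 : 0 <= B by rewrite /B; move: CA0; lra_only.
have eta0 : 0 <= eta by rewrite addr_ge0.
have xa := row_dev_le HR a Hd jk'; have xb := row_dev_le HR b Hd jk'.
have yv := col_dev_le HR v Hd jk'.
have hza := z_le2 a; have hzb := z_le2 b; have hw := w_le2 v.
have [g1 g2] := e2_small; have el := e_le HR; have ml := mu_le HR.
have tn : `|tau| <= e by rewrite gtr0_norm //; have [_ h1] := andP (rg_tau_le HR);
  move: h1 g1 e_pos; lra_only.
have t'n : `|tau'| <= e by rewrite gtr0_norm //; have [_ h1] := andP (rg_tau'_le HR);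
  move: h1 g1 e_pos; lra_only.
set al := tau * ((d.1 b)%:R - blocked R fb (decr d a v) b a
           - codegree R fb (decr d a v) a b).
set be := tau * ((d.1 a)%:R - blocked R fb (decr d b v) a b
           - codegree R fb (decr d b v) a b).
have hal := switch_apx v Hd jk ab EC PC h0; rewrite -/al -/eta in hal.
have hbe := switch_apx v Hd jk ba EC PC h0; rewrite codegreeC -/be -/eta in hbe.
have hWb := edge_decr_apx Hd jk ob EC; have hWa := edge_decr_apx Hd jk oa EC.
set Wb := 1 - P (decr d b v) b v in hWb *; set Wa := 1 - P (decr d a v) a v in hWa *.
set wb := mu * edge_apx _ _ _ _ _ _ _ _ in hWb; set wa := mu * edge_apx _ _ _ _ _ _ _ _ in hWa.
set va := mu * ratio_loss _ _ _ _ _ _ _ _ _ in hal.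
set vb := mu * ratio_loss _ _ _ _ _ _ _ _ _ in hbe.
have ratio : P d a v * (al * Wb) = P d b v * (be * Wa).
  have := @edge_pr_ratio R _ _ fb d a b v oa ob ab (degree1_gt0 a Hd jk')
    (degree1_gt0 b Hd jk') (degree2_gt0 v Hd jk')
    (HE (lowered_decr a v Hd jk') jk) (HE (lowered_decr b v Hd jk') jk).
  rewrite -/Wb -/Wa => E; transitivity (tau * (P d a v * ((d.1 b)%:R -
    blocked R fb (decr d a v) b a - codegree R fb (decr d a v) a b) * Wb)).
    by rewrite /al; ring.
  by rewrite E /be; ring.
have WB c : `|1 - P (decr d c v) c v| <= 1.
  rewrite ler_norml; have := edge_pr_ge0 R fb (decr d c v) c v.
  by have := edge_pr_le1 R fb (decr d c v) c v; lra_only.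
have shx x : `|x| <= 2 * e -> `|x - tau| <= 3 * e.
  by move=> hx; apply: le_trans (norm_sub_le hx tn) _; lra_only.
have vsm xc xd zc zd : `|xc| <= 2 * e -> `|xd| <= 2 * e -> `|zc| <= 2 * e ->
  `|zd| <= 2 * e ->
  `|mu * ratio_loss mu Sy tau tau' dl%:R (xc - tau) xd zc zd| <= 1 / 500.
  move=> hc hd hzc hzd.
  apply: le_trans (norm_mul_le mu_norm_le (ratio_loss_le (shx _ hc) hd hzc hzd)) _.
  by move: ml; lra_only.
have va_le : `|va| <= 1 / 500 by exact: vsm.
have vb_le : `|vb| <= 1 / 500 by exact: vsm.
have x1 x : `|x| <= 2 * e -> `|1 + x - 1| <= 1 / 50.
  by rewrite !ler_norml; move: el; lra_only.
have prod_le x q : `|x| <= 2 * e -> `|q| <= 1 / 500 -> `|(1 + x) * (1 - q)| <= 4.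
  move=> hx hq; rewrite (_ : 4 = 2 * 2 :> R); last by ring.
  apply: norm_mul_le; [move: hx | move: hq]; rewrite !ler_norml; move: el; lra_only.
have side_apx x q W ww al' : `|x| <= 2 * e -> `|q| <= 1 / 500 -> `|W| <= 1 ->
  `|al' - (1 + x) * (1 - q)| <= mu * ((2 * CA + 89) * eta) ->
  `|W - (1 - ww)| <= mu * h ->
  `|al' * W - (1 + x) * (1 - q) * (1 - ww)| <= mu * (B * eta).
  move=> hx hq hW h1 h2.
  apply: le_trans (apx_mul h1 h2 (prod_le x q hx hq) hW) _.
  have -> : mu * ((2 * CA + 89) * eta) * 1 + 4 * (mu * h) =
    mu * ((2 * CA + 89) * eta + 4 * h) by ring.
  by apply: ler_wpM2l; rewrite ?(ltW mu_pos) // /B /eta; move: e_pow4_ge0; lra_only.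
have hA := side_apx _ _ _ _ _ xb va_le (WB b) hal hWb.
have hA' := side_apx _ _ _ _ _ xa vb_le (WB a) hbe hWa.
set A := al * Wb in hA ratio; set A' := be * Wa in hA' ratio.
have [_ pha] := edge_apx_le xa yv hza hw; have [_ phb] := edge_apx_le xb yv hzb hw.
have pp : `|mu * ph d a v * A - mu * ph d b v * A'| <= mu ^+ 2 * ((8 * CA + 4 * B) * eta).
  have -> : mu * ph d a v * A - mu * ph d b v * A' =
     mu * (ph d a v * (A - (1 + X d b) * (1 - va) * (1 - wb)))
     - mu * (ph d b v * (A' - (1 + X d a) * (1 - vb) * (1 - wa)))
     + mu * ((1 + X d a) * (1 + X d b) * (1 + Y d v) *
     ((1 + mu * edge_corr mu Sx Sy tau (X d a) (Y d v) (z a) (w v)) * (1 - va) * (1 - wb)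
     - (1 + mu * edge_corr mu Sx Sy tau (X d b) (Y d v) (z b) (w v)) * (1 - vb) * (1 - wa))).
    by rewrite /edge_apx; ring.
  have r1 := norm_mul_le mu_norm_le (norm_mul_le pha hA).
  have r2 := norm_mul_le mu_norm_le (norm_mul_le phb hA').
  have two x : `|x| <= 2 * e -> `|1 + x| <= 2.
    by rewrite !ler_norml; move: el; lra_only.
  have [_ _ sd] := rg_identities HR (two_e xa) (two_e xb) (two_e yv) (two_e hza) (two_e hzb) (two_e hw).
  have r3 := norm_mul_le mu_norm_le (norm_mul_le (norm_mul_le (norm_mul_le (two _ xa) (two _ xb)) (two _ yv)) sd).
  apply: le_trans (norm_add_le (norm_sub_le r1 r2) r3) _.
  have -> : mu * (3 / 2 * (mu * (B * eta))) + mu * (3 / 2 * (mu * (B * eta))) +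
    mu * (2 * 2 * 2 * (mu * (CA * e ^+ 4))) =
    mu ^+ 2 * (3 * (B * eta) + 8 * (CA * e ^+ 4)) by field.
  apply: ler_wpM2l; first exact: sqr_ge0.
  have := mulr_ge0 B0 eta0; have := mulr_ge0 CA0 h0.
  by rewrite /eta; lra_only.
(* A' is close to 1; dividing by it with this lower bound turns 8 [CA] + 4 [B] into 32 [CA] + 16
   [B]. *)
have A'ge : 1 / 4 <= A'.
  have Hda := lowered_decr a v Hd jk'.
  have [_ pa] := edge_apx_le (row_dev_le HR a Hda jk) (col_dev_le HR v Hda jk) hza hw.
  have pb := norm_mul_le mu_norm_le pa.
  have muh : mu * h <= 1 / 300.
    have r : mu * (93 * h) <= mu * (B * eta).
      apply: ler_wpM2l; first exact: ltW.
      apply: ler_pM => //; last by rewrite /eta; move: e_pow4_ge0; lra_only.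
      by rewrite /B; move: CA0; lra_only.
    by move: r Bsmall; lra_only.
  have Wge : 9 / 10 <= Wa.
    have := EC _ a v Hda oa; move: pb; rewrite /Wa !ler_norml.
    by move: muh ml; lra_only.
  have bege : 1 / 2 <= be.
    have r : mu * ((2 * CA + 89) * eta) <= mu * (B * eta).
      apply: ler_wpM2l; first exact: ltW.
      by apply: ler_wpM2r => //; rewrite /B; lra_only.
    have f1 : 97 / 100 <= (1 + X d a) * (1 - vb).
      apply: (@le_trans _ _ (98 / 100 * (499 / 500))); first by lra_only.
      apply: ler_pM; [lra_only | lra_only | |].
        by move: xa el; rewrite ler_norml; lra_only.
      by move: vb_le; rewrite ler_norml; lra_only.
    by move: hbe; rewrite ler_norml; move: r f1 Bsmall; lra_only.
  apply: (@le_trans _ _ (1 / 2 * (9 / 10))); first by lra_only.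
  by apply: ler_pM => //; lra_only.
have P0 := edge_pr_ge0 R fb d a v.
have E : (P d a v * (mu * ph d b v) - P d b v * (mu * ph d a v)) * A' =
    - (P d a v * (mu * ph d a v * A - mu * ph d b v * A')).
  transitivity (P d a v * (mu * ph d b v) * A' - (P d b v * A') * (mu * ph d a v)).
    by ring.
  by rewrite -ratio; ring.
have A'0 : 0 < A' by move: A'ge; lra_only.
rewrite -(ler_pM2r A'0) -{1}(gtr0_norm A'0) -normrM E normrN.
have Pn : `|P d a v| <= P d a v by rewrite ger0_norm.
apply: le_trans (norm_mul_le Pn pp) _.
have c0 : 0 <= (32 * CA + 16 * B) * eta by rewrite mulr_ge0 // addr_ge0 ?mulr_ge0.
have -> : P d a v * (mu ^+ 2 * ((8 * CA + 4 * B) * eta)) =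
    P d a v * (mu ^+ 2 * ((32 * CA + 16 * B) * eta)) * (1 / 4) by field.
by apply: ler_wpM2l => //; rewrite mulr_ge0 // mulr_ge0 // sqr_ge0.
Qed.

Lemma Q_ge0 : 0 <= Q.
Proof. by rewrite /Q /B; have := CA_ge0 HR; lra_only. Qed.

(* The ratios P av / P bv determine P av up to the factor t_v / (sum of the
   conjectured values), which col_sum_apx controls. *)
Lemma edge_step j h : (j < k)%N -> edge_close j.+1 h -> path_close j.+1 h ->
  0 <= h -> mu * (8 * Q * (h + e ^+ 4)) <= 1 ->
  edge_close j (8 * Q * (mu * (h + e ^+ 4))).
Proof.
move=> jk EC PC h0 small d a v Hd oa; have jk' := ltnW jk.
set eta := h + e ^+ 4 in small *.
have CA0 := CA_ge0 HR; have Q0 := Q_ge0.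
have eta0 : 0 <= eta by rewrite addr_ge0.
have meta0 : 0 <= mu * eta by rewrite mulr_ge0 // ltW.
have QE : Q = 2 * (32 * CA + 16 * B) + 34 by rewrite /Q; ring.
have el := e_le HR; have ml := mu_le HR.
have B0 : 0 <= B by rewrite /B; move: CA0; lra_only.
have Bsmall : mu * (B * eta) <= 1 / 4.
  have CAm := mulr_ge0 CA0 meta0; have Bm := mulr_ge0 B0 meta0.
  by move: small; rewrite QE; move: CAm Bm meta0; lra_only.
have P0 := edge_pr_ge0 R fb d a v.
set K := 32 * CA + 16 * B in QE.
have K0 : 0 <= K by rewrite /K; move: CA0 B0; lra_only.
have Nd := HE Hd jk'.
have yv := col_dev_le HR v Hd jk'.
have tv : (d.2 v)%:R = t * (1 + Y d v) :> R.
  by rewrite /col_dev addrC subrK mulrCA (rg_ttau HR) mulr1.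
have sumP : \sum_(b | ok b v) P d b v = t * (1 + Y d v).
  rewrite -tv -(edge_pr_sum2 R v Nd) [RHS](bigID (fun b => ok b v)) /=.
  by rewrite [X in _ = _ + X]big1 ?addr0 // => b /negPn fbv; exact: edge_pr_fb.
set S := \sum_(b | ok b v) mu * ph d b v.
have S_apx : `|S - t * (1 + Y d v)| <= t * (mu * (34 * e ^+ 4)) := col_sum_apx HR v Hd jk'.
have sum_apx : `|P d a v * S - t * (1 + Y d v) * (mu * ph d a v)|
    <= l%:R * (P d a v * (mu ^+ 2 * (K * eta))).
  rewrite -sumP mulr_suml mulr_sumr -[l in l%:R]card_ord.
  apply: apx_sum => [b ob|]; last by rewrite !mulr_ge0 ?sqr_ge0 // ?ltW.
  have [<-|ab] := eqVneq a b.
    by rewrite subrr normr0 !mulr_ge0 ?sqr_ge0 // ?ltW.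
  exact: edge_pair_apx jk ab oa ob EC PC h0 Bsmall.
have main : `|(t * (1 + Y d v)) * (P d a v - mu * ph d a v)| <=
    t * (P d a v * (mu * (Q * eta))).
  have -> : (t * (1 + Y d v)) * (P d a v - mu * ph d a v) =
     (P d a v * S - t * (1 + Y d v) * (mu * ph d a v))
     - P d a v * (S - t * (1 + Y d v)) by ring.
  have Pn : `|P d a v| <= P d a v by rewrite ger0_norm.
  apply: le_trans (norm_sub_le sum_apx (norm_mul_le Pn S_apx)) _.
  have -> : l%:R * (P d a v * (mu ^+ 2 * (K * eta))) =
    mu * l%:R * (P d a v * (mu * (K * eta))) by ring.
  have Z0 : 0 <= P d a v * (mu * (K * eta)) by rewrite !mulr_ge0 // ltW.
  have r := ler_wpM2r Z0 (mu_l_le HR).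
  have W0 : 0 <= t * (P d a v * (mu * h)) by rewrite !mulr_ge0 // ltW.
  by move: r W0; rewrite QE /eta; lra_only.
have y1 : 1 / 2 <= 1 + Y d v by move: yv el; rewrite ler_norml; lra_only.
have rel : `|P d a v - mu * ph d a v| <= P d a v * (2 * (mu * (Q * eta))).
  have y0 : 0 < 1 + Y d v by move: y1; lra_only.
  have t1 : 0 < t * (1 + Y d v) by rewrite mulr_gt0.
  rewrite -(ler_pM2l t1) -{1}(gtr0_norm t1) -normrM; apply: (le_trans main).
  have Z0 : 0 <= t * (P d a v * (mu * (Q * eta))) by rewrite !mulr_ge0 // ltW.
  have -> : t * (1 + Y d v) * (P d a v * (2 * (mu * (Q * eta)))) =
    t * (P d a v * (mu * (Q * eta))) * (2 * (1 + Y d v)) by ring.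
  by rewrite ler_peMr //; move: y1; lra_only.
have [_ pha] := edge_apx_le (row_dev_le HR a Hd jk') yv (z_le2 a) (w_le2 v).
(* By [rel] and the smallness assumption, P differs from mu [ph] by at most P / 4, and mu [ph] is at
   most 3/2 mu. This converts the error relative to P into one in units of mu. *)
have P2 : P d a v <= 2 * mu.
  have q1 : P d a v * (2 * (mu * (Q * eta))) <= P d a v * (1 / 4).
    by apply: ler_wpM2l => //; move: small; lra_only.
  have := norm_mul_le mu_norm_le pha; move: rel q1; rewrite !ler_norml.
  by move: mu_pos; lra_only.
apply: (le_trans rel).
have Z0 : 0 <= 2 * (mu * (Q * eta)) by rewrite !mulr_ge0 // ltW.
have := ler_wpM2r Z0 P2.
have : 0 <= mu * (mu * (Q * eta)) by rewrite !mulr_ge0 // ltW.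
lra_only.
Qed.

(** Compares [path_pr_rec] with [path_apx_recursion]. The path error h comes back with a factor mu,
    but the edge error g does not, so g should be the error already improved by [edge_step]. *)
Lemma path_step j g h : (j < k)%N -> edge_close j g -> edge_close j.+1 g ->
  path_close j.+1 h -> 0 <= g <= 1 -> 0 <= h ->
  path_close j (12 * g + 4 * (mu * h) + 2 * CA * e ^+ 4).
Proof.
move=> jk EC EC1 PC /andP[g0 g1] h0 d a b v Hd ab oa ob; have jk' := ltnW jk.
have ba : b != a by rewrite eq_sym.
have el := e_le HR; have ml := mu_le HR; have CA0 := CA_ge0 HR.
set d1 := decr d a v; have Hd1 : low j.+1 d1 by exact: lowered_decr.
have xa := row_dev_le HR a Hd jk'; have xb := row_dev_le HR b Hd jk'.
have yv := col_dev_le HR v Hd jk'.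
have xa1 : X d1 a = X d a - tau by rewrite (row_dev_decr _ _ _ Hd jk') eqxx mul1r.
have xb1 : X d1 b = X d b.
  by rewrite (row_dev_decr _ _ _ Hd jk') (negPf ba) mul0r subr0.
have y1 : Y d1 v = Y d v - tau' by rewrite (col_dev_decr _ _ _ Hd jk') eqxx mul1r.
have rec := path_pr_rec R oa ba (degree1_gt0 a Hd jk') (degree2_gt0 v Hd jk') (HE Hd jk').
rewrite -/d1 in rec.
have E1 := EC d a v Hd oa; have E3 := EC1 d1 a v Hd1 oa; have E2 := EC1 d1 b v Hd1 ob.
have E4 := PC d1 a b v Hd1 ab oa ob.
have [formula _ _] := rg_identities HR (two_e xa) (two_e xb) (two_e yv) (two_e (z_le2 a))
  (two_e (z_le2 b)) (two_e (w_le2 v)).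
rewrite /= in formula.
have [_ p1b] := edge_apx_le xa yv (z_le2 a) (w_le2 v).
have [_ p2b] := edge_apx_le (row_dev_le HR b Hd1 jk) (col_dev_le HR v Hd1 jk) (z_le2 b) (w_le2 v).
have [_ p3b] := edge_apx_le (row_dev_le HR a Hd1 jk) (col_dev_le HR v Hd1 jk) (z_le2 a) (w_le2 v).
have yb := path_apx_le xa xb yv (z_le2 a) (z_le2 b) (w_le2 v).
rewrite xa1 y1 in E3 p3b; rewrite xb1 y1 in E2 p2b; rewrite xa1 xb1 y1 in E4.
move: formula E1 E2 E3 E4 p1b p2b p3b yb rec.
set p1 := edge_apx mu Sx Sy tau (X d a) (Y d v) (z a) (w v).
set p2 := edge_apx mu Sx Sy tau (X d b) (Y d v - tau') (z b) (w v).
set p3 := edge_apx mu Sx Sy tau (X d a - tau) (Y d v - tau') (z a) (w v).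
set Yf := path_apx mu Sx Sy tau tau' (X d a) (X d b) (Y d v) (z a) (z b) (w v).
set Yf1 := path_apx mu Sx Sy tau tau' (X d a - tau) (X d b) (Y d v - tau') (z a) (z b) (w v).
move=> formula E1 E2 E3 E4 p1b p2b p3b yb rec.
have P30 := edge_pr_ge0 R fb d1 a v.
have YP := path_pr_le R fb d1 a b v; have Y10 := path_pr_ge0 R fb d1 a b v.
have mg : mu * g <= mu by rewrite ler_piMr // ltW.
have diff : `|P d1 b v - PP d1 a b v| <= mu * (5 / 2).
  have := norm_mul_le mu_norm_le p2b; move: E2 mg; rewrite !ler_norml.
  by move: YP Y10 mu_pos; lra_only.
have T1 := apx_mul E1 (apx_sub E2 E4) (norm_mul_le mu_norm_le p1b) diff.
have mu2n : `|mu ^+ 2| <= mu ^+ 2 by rewrite ger0_norm // sqr_ge0.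
have T2 := norm_mul_le mu2n formula.
have T3 := norm_mul_le mu2n (norm_mul_le yb E3).
have W : 1 / 2 <= 1 - P d1 a v.
  have := norm_mul_le mu_norm_le p3b; move: E3 mg; rewrite !ler_norml.
  by move: ml; lra_only.
have W0 : 0 < 1 - P d1 a v by move: W; lra_only.
have key : `|(PP d a b v - mu ^+ 2 * Yf) * (1 - P d1 a v)| <=
   mu ^+ 2 * (6 * g + 2 * (mu * h) + CA * e ^+ 4).
  have -> : (PP d a b v - mu ^+ 2 * Yf) * (1 - P d1 a v) =
    (P d a v * (P d1 b v - PP d1 a b v) - mu * p1 * (mu * p2 - mu ^+ 2 * Yf1))
    - mu ^+ 2 * (Yf * (1 - mu * p3) - p1 * (p2 - mu * Yf1))
    + mu ^+ 2 * (Yf * (P d1 a v - mu * p3)).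
    by rewrite mulrBl rec; ring.
  apply: le_trans (norm_add_le (norm_sub_le T1 T2) T3) _.
  have -> : mu * g * (mu * (5 / 2)) + mu * (3 / 2) * (mu * g + mu ^+ 2 * h)
    + mu ^+ 2 * (CA * e ^+ 4) + mu ^+ 2 * (5 * (mu * g)) =
    mu ^+ 2 * (4 * g + 3 / 2 * (mu * h) + CA * e ^+ 4 + 5 * (mu * g)) by field.
  apply: ler_wpM2l; first exact: sqr_ge0.
  have := mu_mul_le HR g0; have := mulr_ge0 (ltW mu_pos) h0.
  by move: g0; lra_only.
rewrite normrM (gtr0_norm W0) in key.
rewrite -(ler_pM2r W0); apply: (le_trans key).
set q := 6 * g + _ + _.
have -> : mu ^+ 2 * (12 * g + 4 * (mu * h) + 2 * CA * e ^+ 4) * (1 - P d1 a v) =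
   mu ^+ 2 * q * (2 * (1 - P d1 a v)) by rewrite /q; ring.
have q0 : 0 <= q by rewrite /q !addr_ge0 ?mulr_ge0 // ?ltW.
have mq0 : 0 <= mu ^+ 2 * q by rewrite mulr_ge0 // sqr_ge0.
by rewrite ler_peMr //; move: W; lra_only.
Qed.

Definition close_at j h := edge_close j h /\ path_close j h.

(** A path step at level j uses edges at levels j and j + 1, and improving the latter uses level j +
    2: hence two levels for each halving. The constant 96 [Q] + 4 collects 12 times 8 [Q] and 4 from
    the two steps. *)
Lemma close_step j h : (j.+1 < k)%N -> (forall i, (i <= j.+2)%N -> close_at i h) ->
  0 <= h -> mu * ((96 * Q + 4) * (h + 1)) <= 1 / 2 ->
  forall i, (i <= j)%N -> close_at i (h / 2 + (2 * CA + 1) * e ^+ 4).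
Proof.
move=> jk H h0 small i ij.
have CA0 := CA_ge0 HR; have Q0 := Q_ge0.
have e41 : e ^+ 4 <= 1.
  by rewrite exprn_ile1 //; [exact: ltW | have := e_le HR; lra_only].
set g := 8 * Q * (mu * (h + e ^+ 4)).
have meta : 0 <= mu * (h + e ^+ 4) by rewrite mulr_ge0 ?addr_ge0 // ltW.
have Qmeta := mulr_ge0 Q0 meta.
have mh1 : mu * (h + e ^+ 4) <= mu * (h + 1).
  by apply: ler_wpM2l; [exact: ltW | move: e41; lra_only].
have Qmh1 := ler_wpM2l Q0 mh1.
have mh0 : 0 <= mu * h by rewrite mulr_ge0 // ltW.
have g01 : 0 <= g <= 1.
  by rewrite /g; move: small Qmeta Qmh1 mh0 mu_pos; lra_only.
have small8 : mu * (8 * Q * (h + e ^+ 4)) <= 1.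
  by move: g01; rewrite /g; lra_only.
have EC i' : (i' <= j.+1)%N -> edge_close i' g.
  move=> i'j; apply: edge_step => //.
  - exact: leq_ltn_trans i'j jk.
  - by have [] := H i'.+1 i'j.
  - by have [] := H i'.+1 i'j.
have cmp : 12 * g + 4 * (mu * h) + 2 * CA * e ^+ 4 <= h / 2 + (2 * CA + 1) * e ^+ 4.
  have : (96 * Q + 4) * mu * h <= h / 2 /\ (96 * Q + 4) * mu * e ^+ 4 <= e ^+ 4.
    have c : (96 * Q + 4) * mu <= 1 / 2.
      have : 0 <= mu * ((96 * Q + 4) * h).
        by rewrite !mulr_ge0 ?addr_ge0 ?mulr_ge0 // ltW.
      by move: small; lra_only.
    split; first by have := ler_wpM2r h0 c; lra_only.
    by have := ler_wpM2r e_pow4_ge0 c; move: e_pow4_ge0; lra_only.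
  have : 0 <= mu * e ^+ 4 by rewrite mulr_ge0 // ltW.
  by move=> me [c1 c2]; move: me c1 c2; rewrite /g; lra_only.
have gle : g <= h / 2 + (2 * CA + 1) * e ^+ 4.
  have : 0 <= CA * e ^+ 4 by rewrite mulr_ge0.
  by move: cmp mh0 g01; lra_only.
split.
  move=> d a v Hd oa; apply: le_trans (EC i (leqW ij) d a v Hd oa) _.
  by apply: ler_wpM2l => //; exact: ltW.
have ik : (i < k)%N by apply: leq_ltn_trans ij (ltnW jk).
move=> d a b v Hd ab oa ob.
have [_ PC] := H i.+1 (leqW (ij : (i.+1 <= j.+1)%N)).
apply: le_trans (path_step ik (EC i (leqW ij)) (EC i.+1 ij) PC g01 h0 Hd ab oa ob) _.
by apply: ler_wpM2l => //; exact: sqr_ge0.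
Qed.

(** (4 [CA] + 2) e^4 is the fixed point of the map h -> h / 2 + (2 [CA] + 1) e^4 of [close_step]. *)
Lemma close_iter q j h : (forall i, (i <= j + q.*2)%N -> close_at i h) ->
  (j + q.*2 <= k)%N -> 0 <= h -> mu * ((96 * Q + 4) * (h + (4 * CA + 3))) <= 1 / 2 ->
  forall i, (i <= j)%N -> close_at i (h / 2 ^+ q + (4 * CA + 2) * e ^+ 4).
Proof.
elim: q j => [|q IH] j H jk h0 small i ij.
  have [E1 E2] := H i (leq_trans ij (leq_addr _ _)); rewrite expr0 divr1.
  have le : h <= h + (4 * CA + 2) * e ^+ 4.
    by rewrite lerDl mulr_ge0 // addr_ge0 ?mulr_ge0 // (CA_ge0 HR).
  split=> [d a v Hd oa | d a b v Hd ab oa ob].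
    by apply: le_trans (E1 _ _ _ Hd oa) _; apply: ler_wpM2l => //; exact: ltW.
  by apply: le_trans (E2 _ _ _ _ Hd ab oa ob) _; apply: ler_wpM2l => //; exact: sqr_ge0.
have jq : (j.+2 + q.*2 = j + q.+1.*2)%N by rewrite doubleS !addnS !addSn.
have CA0 := CA_ge0 HR; have Q0 := Q_ge0.
set h' := h / 2 ^+ q + (4 * CA + 2) * e ^+ 4.
have two_q : 1 <= 2 ^+ q :> R by apply: exprn_ege1; lra_only.
have two_q0 : 0 < 2 ^+ q :> R by apply: lt_le_trans two_q.
have hq : 0 <= h / 2 ^+ q <= h.
  by rewrite divr_ge0 ?(ltW two_q0) //= ler_pdivrMr // ler_peMr.
have e41 : e ^+ 4 <= 1.
  by rewrite exprn_ile1 //; [exact: ltW | have := e_le HR; lra_only].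
have c0 : 0 <= (4 * CA + 2) * e ^+ 4 <= 4 * CA + 2.
  have d0' : 0 <= 4 * CA + 2 by move: CA0; lra_only.
  by rewrite mulr_ge0 // ler_piMr.
have h'0 : 0 <= h' by rewrite /h'; move: hq c0; lra_only.
have H' i' : (i' <= j.+2)%N -> close_at i' h'.
  by apply: IH; rewrite ?jq.
have -> : h / 2 ^+ q.+1 + (4 * CA + 2) * e ^+ 4 = h' / 2 + (2 * CA + 1) * e ^+ 4.
  by rewrite /h' exprS; field; rewrite gt_eqF.
apply: close_step ij => //.
  by apply: leq_trans jk; rewrite -jq addSn ltnS leq_addr.
apply: le_trans small; apply: ler_wpM2l; first exact: ltW.
apply: ler_wpM2l; first by rewrite addr_ge0 ?mulr_ge0.
by rewrite /h'; move: hq c0; lra_only.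
Qed.

End Steps.

(** * From crude bounds to the estimate for a single degree sequence *)

Section EdgeEstimate.
Variables (R : realFieldType) (l n m dl k : nat) (fb : 'I_l -> 'I_n -> bool).
Variables (d0 : degrees l n) (s t mu tau tau' e CA : R).
Hypothesis HR : regime m dl k fb d0 s t mu tau tau' e CA.

Implicit Types (d : degrees l n) (a b : 'I_l) (v u : 'I_n) (j : nat).
Notation X := (row_dev tau).
Notation Y := (col_dev tau').
Notation low := (lowered m d0).

Let Sm : nat := (\max_a d0.1 a)%N.
Let Tm : nat := (\max_v d0.2 v)%N.

Lemma row_max_le : Sm%:R <= 101 / 100 * s.
Proof.
have l0 : (0 < #|'I_l|)%N by rewrite card_ord -(ltr0n R) (l_gt0 HR).
rewrite /Sm; have [a ->] := bigop.eq_bigmax (fun a => d0.1 a) l0.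
have -> : (d0.1 a)%:R = s * (1 + X d0 a).
  by rewrite /row_dev addrC subrK mulrCA (rg_stau HR) mulr1.
rewrite mulrC; apply: ler_wpM2r; first exact: ltW (s_gt0 HR).
by move: (rg_X0_le HR a) (e_le HR); rewrite ler_norml; lra_only.
Qed.

Lemma col_max_le : Tm%:R <= 101 / 100 * t.
Proof.
have n0 : (0 < #|'I_n|)%N by rewrite card_ord -(ltr0n R) (n_gt0 HR).
rewrite /Tm; have [v ->] := bigop.eq_bigmax (fun v => d0.2 v) n0.
have -> : (d0.2 v)%:R = t * (1 + Y d0 v).
  by rewrite /col_dev addrC subrK mulrCA (rg_ttau HR) mulr1.
rewrite mulrC; apply: ler_wpM2r; first exact: ltW (t_gt0 HR).
by move: (rg_Y0_le HR v) (e_le HR); rewrite ler_norml; lra_only.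
Qed.

Lemma t_le_l : t <= l%:R.
Proof.
rewrite -(rg_mul HR); apply: (@le_trans _ _ (1 * (l%:R - dl%:R))).
  apply: ler_wpM2r; last by have := mu_le HR; lra_only.
  by rewrite -(pmulr_rge0 _ (mu_gt0 HR)) (rg_mul HR) ltW ?(t_gt0 HR).
by rewrite mul1r gerBl.
Qed.

Lemma s_le_n : s <= n%:R.
Proof.
rewrite -(rg_mun HR); apply: (@le_trans _ _ (1 * (n%:R - dl%:R))).
  apply: ler_wpM2r; last by have := mu_le HR; lra_only.
  by rewrite -(pmulr_rge0 _ (mu_gt0 HR)) (rg_mun HR) ltW ?(s_gt0 HR).
by rewrite mul1r gerBl.
Qed.

Lemma size_bounds j : (j <= k)%N ->
  [/\ Sm%:R * Tm%:R <= 103 / 100 * (mu * m%:R),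
      Sm%:R <= m%:R / 100 :> R, Tm%:R <= m%:R / 100 :> R, j%:R <= m%:R / 100 :> R
    & 0 < m%:R :> R].
Proof.
move=> jk; have hS := row_max_le; have hT := col_max_le.
have s0 := s_gt0 HR; have t0 := t_gt0 HR; have mu0 := mu_gt0 HR.
have [_ g2] := e2_small HR; have ml := mu_le HR.
have big (x y : R) : 0 < x -> x * y = 1 -> 0 < y <= e ^+ 2 -> 10000 <= x.
  move=> x0 xy /andP[y0 ye]; rewrite -(ler_pM2r y0) xy.
  by move: ye g2; lra_only.
have sb := big _ _ s0 (rg_stau HR) (rg_tau_le HR).
have tb := big _ _ t0 (rg_ttau HR) (rg_tau'_le HR).
have l0 := l_gt0 HR; have n0 := n_gt0 HR.
have m0 : 0 < m%:R :> R by rewrite -(rg_ls HR) mulr_gt0.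
have st : s * t <= mu * m%:R.
  have -> : m%:R = n%:R * t :> R by rewrite (rg_nt HR).
  rewrite mulrA; apply: ler_wpM2r; first exact: ltW.
  by rewrite -(rg_mun HR); apply: ler_wpM2l; [exact: ltW | rewrite gerBl].
have lb : 10000 <= l%:R :> R.
  by move: t_le_l tb; lra_only.
have nb : 10000 <= n%:R :> R.
  by move: s_le_n sb; lra_only.
have sm : 10000 * s <= m%:R by rewrite -(rg_ls HR); apply: ler_wpM2r => //; exact: ltW.
have tm : 10000 * t <= m%:R by rewrite -(rg_nt HR); apply: ler_wpM2r => //; exact: ltW.
split=> //.
- apply: (@le_trans _ _ (101 / 100 * s * (101 / 100 * t))).
    by apply: ler_pM.
  have := mulr_ge0 (ltW s0) (ltW t0).
  by move: st; lra_only.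
- by move: hS sm s0; lra_only.
- by move: hT tm t0; lra_only.
- apply: (@le_trans _ _ k%:R); first by rewrite ler_nat.
  apply: le_trans (rg_k_m HR) _; apply: ler_wpM2l; first exact: ltW.
  have e41 : e ^+ 4 <= 1.
    by rewrite exprn_ile1 //; [exact: ltW (e_gt0 HR) | have := e_le HR; lra_only].
  have := ler_wpM2l (ltW mu0) e41; move: ml; lra_only.
Qed.

Lemma lowered_max j d : low j d ->
  (forall b, d.1 b <= Sm)%N /\ (forall u, d.2 u <= Tm)%N.
Proof.
case=> h1 h2 _ _; split=> [b|u].
  by apply: leq_trans (h1 b) _; exact: bigop.leq_bigmax.
by apply: leq_trans (h2 u) _; exact: bigop.leq_bigmax.
Qed.

(** The maximal degrees exceed the means by at most 1 percent, so their product is at most 1.03 mu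
    m, far below a third of the remaining m - j edges. *)
Lemma lowered_real j d : low j d -> (j <= k)%N ->
  (0 < #|realizations fb d|)%N.
Proof.
move=> Hd jk; have [hS hT] := lowered_max Hd.
have [_ _ e1 e2] := Hd; have [b1 b2 b3 b4 m0] := size_bounds jk.
have f1 a : (\sum_v fb a v <= 1)%N by rewrite (rg_fb1 HR) (rg_dl1 HR).
have f2 v : (\sum_a fb a v <= 1)%N by rewrite (rg_fb2 HR) (rg_dl1 HR).
apply: (realizations_exist f1 f2 (m := m - j) _ _ hS hT).
- by rewrite -e1 addnK.
- by rewrite -e2 addnK.
rewrite -(ltr_nat R) !natrM natrB; last by rewrite -e1 leq_addl.
have mm : mu * m%:R <= 1 / 1000 * m%:R.
  by apply: ler_wpM2r; [exact: ltW | exact: (mu_le HR)].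
by move: b1 b4 m0 mm; lra_only.
Qed.

(** In [edge_pr_bound] the factor of P is at least m / 2, while the right side is at most 1.03 mu
    m. *)
Lemma edge_pr_rough j d a v : low j d -> (j <= k)%N ->
  edge_pr R fb d a v <= 3 * mu.
Proof.
move=> Hd jk; have [hS hT] := lowered_max Hd.
have [_ _ e1 e2] := Hd; have [b1 b2 b3 b4 m0] := size_bounds jk.
have f1 a' : (\sum_v fb a' v <= 1)%N by rewrite (rg_fb1 HR) (rg_dl1 HR).
have f2 v' : (\sum_a fb a v' <= 1)%N by rewrite (rg_fb2 HR) (rg_dl1 HR).
have dm : (\sum_a d.1 a = m - j)%N by rewrite -e1 addnK.
have := @edge_pr_bound R _ _ fb d a v Sm Tm (m - j) f1 f2 hS hT dm (lowered_real Hd jk).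
rewrite natrB; last by rewrite -e1 leq_addl.
rewrite -![_.+1%:R]natr1 => H.
have mm : mu * m%:R <= 1 / 1000 * m%:R.
  by apply: ler_wpM2r; [exact: ltW | exact: (mu_le HR)].
have half : m%:R / 2 <= m%:R - j%:R - (Sm%:R + 1) * Tm%:R - (Tm%:R + 1) * Sm%:R :> R.
  by move: b1 b2 b3 b4 m0 mm; lra_only.
have h1 := ler_wpM2l (edge_pr_ge0 R fb d a v) half.
have m2 : 0 < m%:R / 2 :> R by rewrite divr_gt0.
rewrite -(ler_pM2r m2); apply: le_trans h1 _; apply: (le_trans H).
apply: (le_trans b1); have := mulr_gt0 (mu_gt0 HR) m0; lra_only.
Qed.

(** Edges are at most 3 mu and, by one use of [path_pr_rec], paths at most 9 mu^2 / (9/10) = 10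
    mu^2. Together with the sizes 3/2 and 5 of the explicit functions this stays below 70. *)
Lemma rough_approx j : (j < k)%N -> close_at m fb d0 mu tau tau' j 70.
Proof.
move=> jk; have jk' := ltnW jk; have mu0 := mu_gt0 HR; have ml := mu_le HR.
split=> [d a v Hd oa | d a b v Hd ab oa ob].
  have [_ ph] := edge_apx_le HR (row_dev_le HR a Hd jk') (col_dev_le HR v Hd jk')
    (z_le2 HR a) (w_le2 HR v).
  have := norm_mul_le (mu_norm_le HR) ph.
  have := edge_pr_rough a v Hd jk'; have := edge_pr_ge0 R fb d a v.
  by rewrite !ler_norml; move: mu0; lra_only.
have yh := path_apx_le HR (row_dev_le HR a Hd jk') (row_dev_le HR b Hd jk')
  (col_dev_le HR v Hd jk') (z_le2 HR a) (z_le2 HR b) (w_le2 HR v).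
have mu2n : `|mu ^+ 2| <= mu ^+ 2 by rewrite ger0_norm // sqr_ge0.
have yh2 := norm_mul_le mu2n yh.
have ba : b != a by rewrite eq_sym.
have rec := path_pr_rec R oa ba (degree1_gt0 HR a Hd jk') (degree2_gt0 HR v Hd jk')
  (lowered_real Hd jk').
have Hd1 := lowered_decr HR a v Hd jk'.
set d1 := decr d a v in rec Hd1.
have Pa := edge_pr_rough a v Hd jk'; have Pb := edge_pr_rough b v Hd1 jk.
have Pa1 := edge_pr_rough a v Hd1 jk.
have PP : path_pr R fb d a b v <= 10 * mu ^+ 2.
  have h1 : edge_pr R fb d a v * (edge_pr R fb d1 b v - path_pr R fb d1 a b v)
      <= 3 * mu * (3 * mu).
    apply: ler_pM => //; first exact: edge_pr_ge0.
      by rewrite subr_ge0 path_pr_le.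
    by apply: le_trans Pb; rewrite gerBl path_pr_ge0.
  have h2 : path_pr R fb d a b v * (9 / 10) <=
      path_pr R fb d a b v * (1 - edge_pr R fb d1 a v).
    by apply: ler_wpM2l; [exact: path_pr_ge0 | move: Pa1 ml; lra_only].
  by move: h1 h2; rewrite rec expr2; lra_only.
have := path_pr_ge0 R fb d a b v; move: yh2 PP (sqr_ge0 mu).
by rewrite !ler_norml; lra_only.
Qed.

Let Q : R := 64 * CA + 32 * (2 * CA + 93) + 34.
Notation ph a v := (edge_apx mu (row_msq d0 tau) (col_msq d0 tau') tau
  (X d0 a) (Y d0 v) (row_twin fb d0 tau' a) (col_twin fb d0 tau v)).

(** The q rounds give precision O(e^4) on levels 0 and 1; a last edge step from level 1 to [d0]
    supplies the additional factor mu. The constant 4 [CA] + 73 is 70 + (4 [CA] + 2) + 1. *)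
Lemma edge_pr_estimate q a v : (1 + q.*2 < k)%N -> 1 / 2 ^+ q <= e ^+ 4 ->
  mu * ((96 * Q + 4) * (70 + (4 * CA + 3))) <= 1 / 2 -> ~~ fb a v ->
  `|edge_pr R fb d0 a v - mu * ph a v|
  <= mu * (mu * (8 * Q * ((4 * CA + 73) * e ^+ 4))).
Proof.
move=> qk qe small oa.
have mu0 := mu_gt0 HR; have CA0 := CA_ge0 HR; have e40 := e_pow4_ge0 HR.
have e41 : e ^+ 4 <= 1.
  by rewrite exprn_ile1 //; [exact: ltW (e_gt0 HR) | have := e_le HR; lra_only].
have Q0 : 0 <= Q by rewrite /Q; move: CA0; lra_only.
have HE := @lowered_real.
have start i : (i <= 1 + q.*2)%N -> close_at m fb d0 mu tau tau' i 70.
  by move=> iq; apply: rough_approx; apply: leq_ltn_trans qk.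
have h70 : 0 <= 70 :> R by [].
have [EC PC] := close_iter HR HE start (ltnW qk) h70 small (leqnn 1).
set h := 70 / 2 ^+ q + (4 * CA + 2) * e ^+ 4 in EC PC.
have q0 : 0 <= 1 / 2 ^+ q :> R by rewrite divr_ge0 // exprn_ge0.
have CAe := mulr_ge0 CA0 e40.
have h0 : 0 <= h.
  have -> : h = 70 * (1 / 2 ^+ q) + (4 * CA + 2) * e ^+ 4 by rewrite /h mul1r.
  by move: q0 CAe e40; lra_only.
have hle : h + e ^+ 4 <= (4 * CA + 73) * e ^+ 4.
  have -> : h = 70 * (1 / 2 ^+ q) + (4 * CA + 2) * e ^+ 4 by rewrite /h mul1r.
  by move: qe; lra_only.
have k0 : (0 < k)%N by apply: leq_ltn_trans qk.
have hle2 := ler_wpM2l (mulr_ge0 (ltW mu0) Q0) hle.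
have c1 : (4 * CA + 73) * e ^+ 4 <= 4 * CA + 73.
  by rewrite ler_piMr //; move: CA0; lra_only.
have hle3 := ler_wpM2l (mulr_ge0 (ltW mu0) Q0) c1.
have small1 : mu * (8 * Q * (h + e ^+ 4)) <= 1.
  have m1 : 0 <= mu * (4 * CA + 73).
    by rewrite mulr_ge0 ?(ltW mu0) // addr_ge0 ?mulr_ge0.
  have m2 : 0 <= mu * (Q * (4 * CA + 73)).
    by rewrite !mulr_ge0 ?(ltW mu0) // addr_ge0 ?mulr_ge0.
  by move: small hle2 hle3 m1 m2; lra_only.
have final := edge_step HR HE k0 EC PC h0 small1.
apply: le_trans (final d0 a v (lowered0 HR) oa) _.
apply: ler_wpM2l; first exact: ltW.
by rewrite -/Q; move: hle2; lra_only.
Qed.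

(** The theorem has t / (l - t) and s / (n - s) where the approximation has mu / (1 - mu). They
    agree for [dl] = 0 and otherwise differ by O(mu / l) or O(mu / n), which becomes O(mu e^4) after
    multiplication by a deviation and a mean square, as 1/l and 1/n are at most e. *)
Lemma kap_shift (p q : R) : mu * (p - dl%:R) = q -> 1000 <= p ->
  `|mu * (1 - mu)^-1 - q / (p - q)| <= 4 * (mu * p^-1).
Proof.
move=> pq p1.
have mu0 := mu_gt0 HR; have ml := mu_le HR; have d1 := dl_le1R HR.
have d0' : 0 <= dl%:R :> R by [].
have p0 : 0 < p by move: p1; lra_only.
have pqE : p - q = p * (1 - mu) + mu * dl%:R by rewrite -pq; ring.
have md : 0 <= mu * dl%:R by rewrite mulr_ge0 // ltW.
have mn : 1 / 2 <= 1 - mu by move: ml; lra_only.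
have pm : p / 2 <= p - q.
  rewrite pqE; have := ler_wpM2l (ltW p0) mn; move: md; lra_only.
have pq0 : 0 < p - q by move: pm p0; lra_only.
have mn0 : 0 < 1 - mu by move: mn; lra_only.
have -> : mu * (1 - mu)^-1 - q / (p - q) =
   mu * dl%:R * ((1 - mu)^-1 * (p - q)^-1).
  have a1 : 1 - mu != 0 by rewrite gt_eqF.
  have a2 : p - q != 0 by rewrite gt_eqF.
  have -> : mu * dl%:R = mu * p - q by rewrite -pq; ring.
  by field; rewrite a1 a2.
have i1 : (1 - mu)^-1 <= 2 by rewrite invf_ple ?posrE //; move: mn; lra_only.
have i2 : (p - q)^-1 <= 2 * p^-1.
  have -> : 2 * p^-1 = (p / 2)^-1 by rewrite invfM invrK mulrC.
  by rewrite lef_pV2 ?posrE // divr_gt0.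
have n1 : `|(1 - mu)^-1| <= 2 by rewrite gtr0_norm ?invr_gt0.
have n2 : `|(p - q)^-1| <= 2 * p^-1 by rewrite gtr0_norm ?invr_gt0.
have n3 : `|mu * dl%:R| <= mu * 1.
  by rewrite ger0_norm //; apply: ler_wpM2l => //; exact: ltW.
apply: le_trans (norm_mul_le n3 (norm_mul_le n1 n2)) _.
lra_only.
Qed.

Lemma size_ge : [/\ 1000 <= l%:R :> R, 1000 <= n%:R :> R,
  l%:R^-1 <= e :> R & n%:R^-1 <= e :> R].
Proof.
have [g1 g2] := e2_small HR; have e0 := e_gt0 HR.
have t0 := t_gt0 HR; have s0 := s_gt0 HR.
have inv (x y p : R) : 0 < x -> x <= p -> x * y = 1 -> 0 < y <= e ^+ 2 ->
    1000 <= p /\ p^-1 <= e.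
  move=> x0 xp xy /andP[y0 ye]; have p0 := lt_le_trans x0 xp.
  have x1 : x^-1 = y by rewrite -[LHS]mulr1 -xy mulKf // gt_eqF.
  have le1 : p^-1 <= e ^+ 2 by apply: le_trans ye; rewrite -x1 lef_pV2.
  split; last by move: le1 g1 e0; lra_only.
  have : p * p^-1 = 1 by rewrite divff // gt_eqF.
  by have := ler_wpM2l (ltW p0) (le_trans le1 g2); lra_only.
have [? ?] := inv _ _ _ t0 t_le_l (rg_ttau HR) (rg_tau'_le HR).
have [? ?] := inv _ _ _ s0 s_le_n (rg_stau HR) (rg_tau_le HR).
by [].
Qed.

Lemma edge_pr_bracket q a v : (1 + q.*2 < k)%N -> 1 / 2 ^+ q <= e ^+ 4 ->
  mu * ((96 * Q + 4) * (70 + (4 * CA + 3))) <= 1 / 2 -> ~~ fb a v ->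
  let x := X d0 a in let y := Y d0 v in
  exists2 err : R, `|err| <= (16 * Q * (4 * CA + 73) + 32) * (mu * e ^+ 4) &
  edge_pr R fb d0 a v = mu * ((1 + x) * (1 + y)) *
    (1 - mu * (1 - mu)^-1 * (x * y)
       + x * col_msq d0 tau' * (t / (l%:R - t))
       + y * row_msq d0 tau * (s / (n%:R - s))
       + mu * tau * (row_twin fb d0 tau' a + col_twin fb d0 tau v) + err).
Proof.
move=> qk qe small oa x y; have H := edge_pr_estimate qk qe small oa.
rewrite -/x -/y in H.
have mu0 := mu_gt0 HR; have CA0 := CA_ge0 HR; have e40 := e_pow4_ge0 HR.
have e0 := e_gt0 HR; have el := e_le HR; have e20 := sqr_ge0 e.
have Q0 : 0 <= Q by rewrite /Q; move: CA0; lra_only.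
have x1 : `|x| <= e := rg_X0_le HR a; have y1 : `|y| <= e := rg_Y0_le HR v.
have [l1 n1 li ni] := size_ge.
have D0 : 1 / 2 <= (1 + x) * (1 + y).
  apply: (@le_trans _ _ (9 / 10 * (9 / 10))); first lra_only.
  by apply: ler_pM; try lra_only; move: x1 y1 el; rewrite !ler_norml; lra_only.
have D00 : 0 < (1 + x) * (1 + y) by move: D0; lra_only.
set br := 1 - _ + _ + _ + _.
(* The formula is solved for [err], so that only its size is at stake. As (1 + x) (1 + y) >= 1/2,
   isolating it doubles the constants. *)
pose err := edge_pr R fb d0 a v / (mu * ((1 + x) * (1 + y))) - br.
have nz : mu * ((1 + x) * (1 + y)) != 0 by rewrite gt_eqF // mulr_gt0.
exists err; last by rewrite /err (addrC br) subrK mulrC divfK.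
have S1 := Sx_range HR; have S2 := Sy_range HR.
have Sxn : `|row_msq d0 tau| <= e ^+ 2 by case/andP: S1 => ? ?; rewrite ger0_norm.
have Syn : `|col_msq d0 tau'| <= e ^+ 2 by case/andP: S2 => ? ?; rewrite ger0_norm.
have brE : `|(1 + mu * edge_corr mu (row_msq d0 tau) (col_msq d0 tau') tau x y
    (row_twin fb d0 tau' a) (col_twin fb d0 tau v)) - br| <= 8 * (mu * e ^+ 4).
  have -> : (1 + mu * edge_corr mu (row_msq d0 tau) (col_msq d0 tau') tau x y
    (row_twin fb d0 tau' a) (col_twin fb d0 tau v)) - br =
    x * col_msq d0 tau' * (mu * (1 - mu)^-1 - t / (l%:R - t)) +
    y * row_msq d0 tau * (mu * (1 - mu)^-1 - s / (n%:R - s)).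
    by rewrite /br /edge_corr; ring.
  have k1 := kap_shift (rg_mul HR) l1; have k2 := kap_shift (rg_mun HR) n1.
  apply: le_trans (norm_add_le (norm_mul_le (norm_mul_le x1 Syn) k1)
    (norm_mul_le (norm_mul_le y1 Sxn) k2)) _.
  have em : 0 <= e * e ^+ 2 * mu by rewrite !mulr_ge0 ?(ltW e0) // ltW.
  have := ler_wpM2l em li; have := ler_wpM2l em ni.
  by rewrite (_ : e ^+ 4 = e * e ^+ 2 * e); [lra_only | ring].
have errE : (mu * ((1 + x) * (1 + y))) * err =
   (edge_pr R fb d0 a v - mu * edge_apx mu (row_msq d0 tau) (col_msq d0 tau') tau x y
     (row_twin fb d0 tau' a) (col_twin fb d0 tau v)) +
   mu * ((1 + x) * (1 + y)) *
   ((1 + mu * edge_corr mu (row_msq d0 tau) (col_msq d0 tau') tau x y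
    (row_twin fb d0 tau' a) (col_twin fb d0 tau v)) - br).
  have DP : mu * ((1 + x) * (1 + y)) * (edge_pr R fb d0 a v / (mu * ((1 + x) * (1 + y))))
    = edge_pr R fb d0 a v by rewrite mulrC divfK.
  by rewrite /err [LHS]mulrBr DP /edge_apx; ring.
have D1 : `|(1 + x) * (1 + y)| <= 2.
  have b (r : R) : `|r| <= e -> `|1 + r| <= 11 / 10.
    by move: el; rewrite !ler_norml; lra_only.
  by apply: le_trans (norm_mul_le (b _ x1) (b _ y1)) _; lra_only.
have tot := norm_add_le H (norm_mul_le (norm_mul_le (mu_norm_le HR) D1) brE).
rewrite -errE normrM (gtr0_norm (_ : 0 < mu * ((1 + x) * (1 + y)))) in tot; last first.
  by rewrite mulr_gt0.
have h1 : mu * (1 / 2) * `|err| <= mu * ((1 + x) * (1 + y)) * `|err|.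
  by apply: ler_wpM2r => //; apply: ler_wpM2l => //; exact: ltW.
rewrite -(ler_pM2l mu0); move: h1 tot; lra_only.
Qed.

End EdgeEstimate.

(** * Asymptotics *)

Section ModelTranslation.
Variables (R : realType) (di : bool) (l n m : nat).
Hypothesis ln_eq : di -> l = n.

Definition prime_pair (a : 'I_l) (v : 'I_n) : bool := di && (val a == val v).

Lemma prime_pair_sum1 a : (\sum_v prime_pair a v)%N = di.
Proof.
rewrite /prime_pair; case: di ln_eq => [/(_ isT) E|_] /=; last by rewrite big1.
have an : (a < n)%N by rewrite -E.
rewrite (bigD1 (Ordinal an)) //= eqxx big1 // => v; rewrite -val_eqE /= eq_sym.
by move/negPf ->.
Qed.

Lemma prime_pair_sum2 v : (\sum_a prime_pair a v)%N = di.
Proof.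
rewrite /prime_pair; case: di ln_eq => [/(_ isT) E|_] /=; last by rewrite big1.
have vl : (v < l)%N by rewrite E.
rewrite (bigD1 (Ordinal vl)) //= eqxx big1 // => a; rewrite -val_eqE /=.
by move/negPf ->.
Qed.

(** The degree sequence already fixes the number of edges, so conditioning on it leaves the uniform
    distribution on realizations. *)
Lemma edge_cond_probE (d : degrees l n) a v : (\sum_a d.1 a)%N = m ->
  (0 < #|realizations prime_pair d|)%N ->
  edge_cond_prob R di m d a v = edge_pr R prime_pair d a v.
Proof.
move=> dm Nd; rewrite /edge_cond_prob /cond_prob /unif_prob.
set Om := graph_model di l n m.
have OmE (G : bigraph l n) : (G \in Om) && (degree_seq G == d) =
    (G \in realizations prime_pair d).
  rewrite !inE; have [Gd|] := eqVneq (degree_seq G) d; rewrite ?andbF // !andbT.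
  rewrite card_degree1 Gd dm eqxx /= /admissible /no_prime_edge /prime_pair.
  case: di => //=; apply/esym; apply/forallP => a'; apply/forallP => v' //.
have E1 : #|(Om :&: ([set G : bigraph l n | (a, v) \in G] :&:
    [set G : bigraph l n | degree_seq G == d]))%SET| =
    count_real prime_pair d (fun G => (a, v) \in G).
  apply: eq_card => G; rewrite !finset.in_setI [in RHS]finset.in_set -OmE -andbA.
  by congr (_ && _); rewrite !finset.in_set andbC.
have E2 : #|(Om :&: [set G : bigraph l n | degree_seq G == d])%SET| =
    #|realizations prime_pair d|.
  by apply: eq_card => G; rewrite finset.in_setI -OmE finset.in_set.
rewrite E1 E2 /edge_pr.
have Om0 : #|Om|%:R != 0 :> R.
  rewrite pnatr_eq0 -lt0n; apply: leq_trans Nd _; rewrite -E2.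
  by apply: subset_leq_card; apply: finset.subsetIl.
have N0 : #|realizations prime_pair d|%:R != 0 :> R by rewrite pnatr_eq0 -lt0n.
by field; rewrite Om0 N0.
Qed.

End ModelTranslation.

(** * From near-regular sequences to the regime of the recursion *)

Section FiniteEstimate.
Variables (R : realType) (di : bool) (l n m : nat).
Hypothesis ln_eq : di -> l = n.
Variables (phi : R) (d : degrees l n).
Hypothesis phi_range : 1 / 2 < phi < 3 / 5.
Hypothesis dreg : near_regular phi m d.

Let s : R := m%:R / l%:R.
Let t : R := m%:R / n%:R.
Let r : R := Num.min s t.
Let e : R := r `^ (phi - 1).
Let mu : R := s / (n%:R - di%:R).

Lemma le_powR_neg (x y p : R) : 0 < x -> x <= y -> p <= 0 -> y `^ p <= x `^ p.
Proof.
move=> x0 xy p0; rewrite -[p]opprK powRN [leRHS]powRN.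
rewrite lef_pV2 ?posrE ?powR_gt0 ?(lt_le_trans x0 xy) //.
by apply: ge0_ler_powR; rewrite ?oppr_ge0 ?nnegrE ?(ltW x0) // (le_trans (ltW x0)).
Qed.

Lemma expr_powR (x p : R) (q : nat) : (x `^ p) ^+ q = x `^ (q%:R * p).
Proof. by rewrite -powR_mulrn ?powR_ge0 // -powRrM mulrC. Qed.

(** With e = r^(phi - 1), phi > 1/2 yields 1/r <= e^2, and the degree bounds yield deviations x^(phi
    - 1) <= e for x = s, t. The conditions on k follow from k <= r^2 e^4 = r^(4 phi - 2), since r^2
    <= s t <= m mu, and from 4 phi - 3 <= phi - 1. *)
Lemma near_regular_regime (k : nat) (CA : R) : (0 < l)%N -> (di < n)%N ->
  1 <= r -> e <= 1 / 100 -> mu <= 1 / 1000 -> k%:R <= r `^ (4 * phi - 2) ->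
  0 <= CA ->
  (forall mu Sx Sy tau tau' : R, small_params e mu Sx Sy tau tau' di%:R ->
    formal_identities CA e mu Sx Sy tau tau' di%:R) ->
  regime m di k (@prime_pair di l n) d s t mu s^-1 t^-1 e CA.
Proof.
move=> l0 dn r1 e1 mu1 kr CA0 alg.
have [/andP[p1 p2] [dm1 dm2 ds dt]] := (phi_range, dreg).
have n0 : (0 < n)%N by apply: leq_ltn_trans dn.
have lR : 0 < l%:R :> R by rewrite ltr0n.
have nR : 0 < n%:R :> R by rewrite ltr0n.
have r0 : 0 < r by apply: lt_le_trans r1.
have rs : r <= s by rewrite /r ge_min lexx.
have rt : r <= t by rewrite /r ge_min lexx orbT.
have s0 : 0 < s := lt_le_trans r0 rs.
have t0 : 0 < t := lt_le_trans r0 rt.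
have e0 : 0 < e by rewrite powR_gt0.
have nd : 0 < n%:R - di%:R :> R by rewrite subr_gt0 ltr_nat.
have mu0 : 0 < mu by rewrite divr_gt0.
have ls : l%:R * s = m%:R by rewrite /s mulrC divfK // gt_eqF.
have nt : n%:R * t = m%:R by rewrite /t mulrC divfK // gt_eqF.
have stau : s * s^-1 = 1 by rewrite divff // gt_eqF.
have ttau : t * t^-1 = 1 by rewrite divff // gt_eqF.
have rinv : r^-1 = r `^ (-1) by rewrite powR_inv1 // ltW.
have e2E : e ^+ 2 = r `^ (2 * (phi - 1)) by rewrite expr_powR.
have e4E : e ^+ 4 = r `^ (4 * (phi - 1)) by rewrite expr_powR.
have inv_le x : r <= x -> 0 < x^-1 <= e ^+ 2.
  move=> rx; rewrite invr_gt0 (lt_le_trans r0 rx) /=.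
  apply: (@le_trans _ _ r^-1); first by rewrite lef_pV2 ?posrE // (lt_le_trans r0 rx).
  rewrite rinv e2E; apply: ler_powR => //; move: p1; lra_only.
have dev_le x (q : R) : r <= x -> `|q - x| <= x `^ phi -> `|q * x^-1 - 1| <= e.
  move=> rx H; have x0 := lt_le_trans r0 rx.
  have -> : q * x^-1 - 1 = (q - x) * x^-1 by rewrite mulrBl divff // gt_eqF.
  rewrite normrM [`|x^-1|]gtr0_norm ?invr_gt0 //.
  apply: (@le_trans _ _ (x `^ (phi - 1))); last first.
    by apply: le_powR_neg => //; move: p2; lra_only.
  rewrite powRD; last by rewrite (gt_eqF x0) implybT.
  by rewrite powR_inv1 ?(ltW x0) //; apply: ler_wpM2r; rewrite ?invr_ge0 ?(ltW x0).
have k_inv x : r <= x -> k%:R * x^-1 <= e.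
  move=> rx; have x0 := lt_le_trans r0 rx.
  apply: (@le_trans _ _ (r `^ (4 * phi - 2) * r^-1)).
    apply: ler_pM => //; first by rewrite invr_ge0 ltW.
    by rewrite lef_pV2.
  rewrite rinv -powRD; last by rewrite (gt_eqF r0) implybT.
  by apply: ler_powR => //; move: p2; lra_only.
have X0 a : `|row_dev s^-1 d a| <= e by apply: dev_le.
have Y0 v : `|col_dev t^-1 d v| <= e by apply: dev_le.
have mul : mu * (l%:R - di%:R) = t.
  rewrite /mu /t /s; case: di ln_eq nd => [/(_ isT) -> nd|_ nd].
    by rewrite divfK // gt_eqF.
  by rewrite !subr0 mulrAC divfK // gt_eqF.
have mun : mu * (n%:R - di%:R) = s by rewrite divfK // gt_eqF.
have st : r ^+ 2 <= m%:R * mu.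
  apply: (@le_trans _ _ (t * s)); first by rewrite expr2; apply: ler_pM => //; exact: ltW.
  have -> : m%:R * mu = t * (n%:R * mu) by rewrite -nt; ring.
  apply: ler_wpM2l; first exact: ltW.
  by rewrite -[leLHS]mun mulrC; apply: ler_wpM2r; [exact: ltW | rewrite gerBl].
have r2 : r ^+ 2 = r `^ 2 by rewrite powR_mulrn // ltW.
have re4 : r ^+ 2 * e ^+ 4 = r `^ (4 * phi - 2).
  rewrite r2 e4E -powRD; last by rewrite (gt_eqF r0) implybT.
  by congr (_ `^ _); ring.
have e40 : 0 <= e ^+ 4 by rewrite exprn_ge0 // ltW.
have small : small_params e mu (row_msq d s^-1) (col_msq d t^-1) s^-1 t^-1 di%:R.
  have sq (q : nat) (f : 'I_q -> R) : 0 < q%:R :> R -> (forall i, `|f i| <= e) ->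
      `|q%:R^-1 * \sum_i f i ^+ 2| <= 2 * e ^+ 2.
    move=> q0 fe; have := mean_sq_le q0 (ltW e0) fe; have := sqr_ge0 e.
    by rewrite ler_norml; lra_only.
  have inv2 x : r <= x -> `|x^-1| <= 2 * e ^+ 2.
    move=> /inv_le h; have := sqr_ge0 e; move: h; rewrite ler_norml; lra_only.
  split.
  - by rewrite e0 (le_trans e1) //; lra_only.
  - by rewrite mu0 (le_trans mu1) //; lra_only.
  - exact: sq.
  - exact: sq.
  - exact: inv2.
  - exact: inv2.
  - by rewrite expr0 mulr1 ger0_norm //; case: (di) => /=; lra_only.
split=> //.
- exact: prime_pair_sum1.
- exact: prime_pair_sum2.
- by case: (di).
- by rewrite e0.
- by rewrite mu0.
- exact: inv_le.
- exact: inv_le.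
- exact: k_inv.
- exact: k_inv.
- rewrite mulrA; apply: (le_trans kr); rewrite -re4.
  by apply: ler_wpM2r.
- apply: (@le_trans _ _ (r ^+ 2 * e ^+ 4 * (r^-1 * r^-1))).
    apply: ler_pM; rewrite ?re4 ?mulr_ge0 ?invr_ge0 ?(ltW s0) ?(ltW t0) //.
    by apply: ler_pM; rewrite ?invr_ge0 ?(ltW s0) ?(ltW t0) // lef_pV2.
  by rewrite -mulrA mulrCA -expr2 -exprMn divff ?expr1n ?mulr1 // gt_eqF.
- exact: alg.
Qed.

End FiniteEstimate.

(** * The formula of the theorem in terms of relative deviations *)

Section FormulaTranslation.
Variables (R : realType) (di : bool) (l n m : nat).
Hypothesis ln_eq : di -> l = n.
Variable d : degrees l n.

Let s : R := m%:R / l%:R.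
Let t : R := m%:R / n%:R.
Let mu : R := s / (n%:R - di%:R).
Notation fb := (@prime_pair di l n).

Lemma sigma2E k (f : {ffun 'I_k -> nat}) (c : R) : c != 0 ->
  sigma2 f c = c ^+ 2 * (k%:R^-1 * \sum_i ((f i)%:R * c^-1 - 1) ^+ 2).
Proof.
move=> c0; rewrite /sigma2 mulrCA; congr (_ * _); rewrite mulr_sumr.
by apply: eq_bigr => i _; field.
Qed.

(** Both sides vanish in the bipartite case. In the digraph case mu / s = 1 / (n - 1), and each twin
    sum has the vertex of equal index as its only term. *)
Lemma twin_terms (a : 'I_l) (v : 'I_n) : s != 0 -> t != 0 ->
  di%:R / (n%:R - 1) * (((at_index d.2 a)%:R - t) / t
     + ((at_index d.1 v)%:R - s) / s) =
  mu * s^-1 * (row_twin fb d t^-1 a + col_twin fb d s^-1 v) :> R.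
Proof.
move=> s0 t0; rewrite /mu /row_twin /col_twin /prime_pair.
case: (di) ln_eq => [/(_ isT) E|_] /=; last first.
  by rewrite !big_pred0_eq addr0 mulr0 !mul0r.
have an : (a < n)%N by rewrite -E.
have vl : (v < l)%N by rewrite E.
rewrite (big_pred1 (Ordinal an)); last first.
  by move=> u /=; apply/eqP/eqP => [h|->] //; apply/val_inj; rewrite /= -h.
rewrite (big_pred1 (Ordinal vl)); last first.
  by move=> b /=; apply/eqP/eqP => [h|->] //; apply/val_inj; rewrite /= h.
rewrite /at_index !insubT /= /row_dev /col_dev.
move: (_ - 1)^-1 => D.
by field; rewrite s0 t0.
Qed.

(** Rests on m - delta t = t (n - delta), which makes t s / (m - delta t - t s) equal to mu / (1 -
    mu). *)
Lemma edge_formulaE a v err : 0 < s -> 0 < t -> 0 < n%:R - di%:R :> R ->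
  mu < 1 -> t < l%:R -> s < n%:R ->
  edge_formula di m d a v err =
  mu * ((1 + row_dev s^-1 d a) * (1 + col_dev t^-1 d v)) *
    (1 - mu * (1 - mu)^-1 * (row_dev s^-1 d a * col_dev t^-1 d v)
       + row_dev s^-1 d a * col_msq d t^-1 * (t / (l%:R - t))
       + col_dev t^-1 d v * row_msq d s^-1 * (s / (n%:R - s))
       + mu * s^-1 * (row_twin fb d t^-1 a + col_twin fb d s^-1 v) + err).
Proof.
move=> s0 t0 nd mu1 tl sn; rewrite /edge_formula -/s -/t.
have s1 : s != 0 by rewrite gt_eqF.
have t1 : t != 0 by rewrite gt_eqF.
rewrite twin_terms // !sigma2E //.
have n0 : n%:R != 0 :> R.
  by rewrite gt_eqF // (lt_trans s0 sn).
have mE : m%:R - di%:R * t = t * (n%:R - di%:R).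
  by rewrite mulrBr /t divfK // [di%:R * _]mulrC.
rewrite !mE -/(row_msq d s^-1) -/(col_msq d t^-1).
have nd1 : n%:R - di%:R != 0 :> R by rewrite gt_eqF.
have m1 : 1 - mu != 0 by rewrite subr_eq0 gt_eqF.
have nds : n%:R - di%:R - s != 0.
  by rewrite subr_eq0 gt_eqF //; move: mu1; rewrite /mu ltr_pdivrMr // mul1r.
have c1 : l%:R - t != 0 by rewrite subr_eq0 gt_eqF.
have c2 : n%:R - s != 0 by rewrite subr_eq0 gt_eqF.
have kapE : mu * (1 - mu)^-1 = s / (n%:R - di%:R - s).
  by rewrite /mu; field; rewrite nds nd1.
have Xa : (d.1 a)%:R = s * (1 + row_dev s^-1 d a).
  by rewrite /row_dev addrC subrK mulrCA divff // mulr1.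
have Yv : (d.2 v)%:R = t * (1 + col_dev t^-1 d v).
  by rewrite /col_dev addrC subrK mulrCA divff // mulr1.
rewrite kapE Xa Yv; congr (_ * _); first by rewrite /mu; field; rewrite nd1.
congr (_ + _); congr (_ + _).
set x := row_dev _ _ _; set y := col_dev _ _ _.
set Sx := row_msq _ _; set Sy := col_msq _ _.
have c3 : t * (n%:R - di%:R) - t * s != 0 by rewrite -mulrBr mulf_neq0.
by field; rewrite nds c1 c2 c3 s1 t1.
Qed.

End FormulaTranslation.

(* q halvings of the error bring it down to the target size r^(4 phi - 4). *)
Lemma finite_estimate (R : realType) : exists2 mu1 : R, 0 < mu1 &
  exists2 C : R, 0 <= C &
  forall (di : bool) (l n m q : nat) (phi : R) (d : degrees l n),
  (di -> l = n) -> 1 / 2 < phi < 3 / 5 -> near_regular phi m d ->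
  (0 < l)%N -> (1 < n)%N ->
  let s : R := m%:R / l%:R in
  let t : R := m%:R / n%:R in
  let r : R := Num.min s t in
  m%:R / (n%:R * l%:R) < mu1 -> 1 <= r -> r `^ (phi - 1) <= 1 / 100 ->
  1 / 2 ^+ q <= r `^ (4 * phi - 4) -> (2 + q.*2)%N%:R <= r `^ (4 * phi - 2) ->
  forall (a : 'I_l) (v : 'I_n), (di -> val v != val a) ->
  exists2 err : R,
    `|err| <= C * (r `^ (4 * phi - 4) * (m%:R / (n%:R * l%:R))) &
    edge_cond_prob R di m d a v = edge_formula di m d a v err.
Proof.
have [CA CA0 alg] := formal_identities_uniform R.
pose Q : R := 64 * CA + 32 * (2 * CA + 93) + 34.
pose M : R := (96 * Q + 4) * (70 + (4 * CA + 3)).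
have Q0 : 0 <= Q by rewrite /Q; move: CA0; lra_only.
have M1 : 1000 <= M.
  rewrite /M /Q; have := mulr_ge0 CA0 CA0; move: CA0; lra_only.
have M0 : 0 < M by move: M1; lra_only.
(* Since n - 1 >= n / 2, mu is at most twice the density m / (n l). A density below 1 / (4 [M]) thus
   gives mu [M] <= 1/2, the smallness asked for by the iteration. *)
exists (1 / (4 * M)); first by rewrite divr_gt0 // mulr_gt0.
exists (2 * (16 * Q * (4 * CA + 73) + 32)).
  by rewrite mulr_ge0 // addr_ge0 // !mulr_ge0 // addr_ge0 // mulr_ge0.
move=> di l n m q phi d ln_eq phi_range dreg l0 n1 s t r mu_small r1 e1 qe kr a v av.
set e := r `^ (phi - 1) in e1.
pose mu : R := s / (n%:R - di%:R).
have dn : (di < n)%N by case: (di) => //; exact: ltnW.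
have lR : 0 < l%:R :> R by rewrite ltr0n.
have nR : 0 < n%:R :> R by rewrite ltr0n ltnW.
have r0 : 0 < r by apply: lt_le_trans r1.
have s0 : 0 < s by apply: (lt_le_trans r0); rewrite /r ge_min lexx.
have t0 : 0 < t by apply: (lt_le_trans r0); rewrite /r ge_min lexx orbT.
have nd : n%:R / 2 <= n%:R - di%:R :> R.
  have : 2 <= n%:R :> R by rewrite (ler_nat _ 2 n).
  have : di%:R <= 1 :> R by case: (di).
  by lra_only.
have nd0 : 0 < n%:R - di%:R :> R by apply: lt_le_trans nd; rewrite divr_gt0.
set den := m%:R / (n%:R * l%:R) in mu_small *.
have mu_den : mu <= 2 * den.
  have -> : 2 * den = s / (n%:R / 2) by rewrite /den /s; field; rewrite !gt_eqF.
  by apply: ler_wpM2l; [exact: ltW | rewrite lef_pV2 ?posrE // divr_gt0].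
have mu0 : 0 < mu by rewrite divr_gt0.
have muM : mu * M <= 1 / 2.
  have : den * M <= 1 / (4 * M) * M by apply: ler_wpM2r; exact: ltW.
  have -> : 1 / (4 * M) * M = 1 / 4 by field; rewrite gt_eqF.
  have := ler_wpM2r (ltW M0) mu_den; lra_only.
have mu1 : mu <= 1 / 1000.
  have := ler_wpM2l (ltW mu0) M1; move: muM; lra_only.
have reg : regime m di (2 + q.*2) (@prime_pair di l n) d s t mu s^-1 t^-1 e CA.
  by apply: near_regular_regime => // *; exact: alg.
have e4 : e ^+ 4 = r `^ (4 * phi - 4).
  by rewrite /e expr_powR; congr (_ `^ _); ring.
have ok : ~~ @prime_pair di l n a v.
  by rewrite /prime_pair; case: (di) av => //= /(_ isT); rewrite eq_sym.
rewrite -e4 in qe *.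
have [err errb errE] := edge_pr_bracket reg (ltnSn _) qe muM ok.
exists err.
  apply: (le_trans errb).
  have -> : 2 * (16 * Q * (4 * CA + 73) + 32) * (e ^+ 4 * den) =
    (16 * Q * (4 * CA + 73) + 32) * (2 * den * e ^+ 4) by ring.
  apply: ler_wpM2l.
    by rewrite addr_ge0 // !mulr_ge0 // addr_ge0 // mulr_ge0.
  by apply: ler_wpM2r => //; rewrite e4 powR_ge0.
have [dm _ _ _] := dreg.
have tl : t < l%:R.
  rewrite -(rg_mul reg); apply: (@le_lt_trans _ _ (1 / 1000 * l%:R)).
    apply: ler_pM => //; last by rewrite gerBl.
      by rewrite ltW.
    by rewrite -(pmulr_rge0 _ mu0) (rg_mul reg) ltW.
  by move: lR; lra_only.
have sn : s < n%:R.
  rewrite -(rg_mun reg); apply: (@le_lt_trans _ _ (1 / 1000 * n%:R)).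
    by apply: ler_pM => //; [exact: ltW | exact: ltW | rewrite gerBl].
  by move: nR; lra_only.
have Nd := lowered_real reg (lowered0 reg) (leq0n _).
have mu_lt1 : mu < 1 by apply: le_lt_trans mu1 _; lra_only.
by rewrite edge_cond_probE // errE edge_formulaE.
Qed.

(* The bound on (l + n)^(5 - 5 phi) forces n <= l^2, so that ln l and ln n have the
   same order, and r^(2 phi - 1) >= ln n / 2 by the choice of K. *)
Lemma growth_bounds (R : realType) (l n m : nat) (phi : R) :
  let s : R := m%:R / l%:R in
  let t : R := m%:R / n%:R in
  let r : R := Num.min s t in
  let K : R := (2 * phi - 1)^-1 in
  let q := (Num.truncn (4 * ln (n%:R : R))).+1 in
  1 / 2 < phi < 3 / 5 -> (0 < l)%N -> 40 <= ln (n%:R : R) ->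
  m%:R / (n%:R * l%:R) <= 1 :> R ->
  l%:R * ln n%:R `^ K + n%:R * ln l%:R `^ K <= m%:R :> R ->
  (l + n)%N%:R `^ (5 - 5 * phi) <= l%:R * n%:R * m%:R `^ (3 - 5 * phi) :> R ->
  [/\ 1 <= r, r `^ (phi - 1) <= 1 / 100,
      1 / 2 ^+ q <= r `^ (4 * phi - 4)
    & (2 + q.*2)%N%:R <= r `^ (4 * phi - 2)].
Proof.
move=> s t r K q /andP[p1 p2] l0 L40 mu1 logs pows.
pose L := ln (n%:R : R); rewrite -/L in L40 logs.
have qE : q = (Num.truncn (4 * L)).+1 by [].
clearbody q.
have n0 : (0 < n)%N.
  by rewrite lt0n; apply: contraTneq L40 => n0; rewrite /L n0 ln0 // -ltNge; lra_only.
have lR : 0 < l%:R :> R by rewrite ltr0n.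
have nR : 0 < n%:R :> R by rewrite ltr0n.
have K0 : 0 < K by rewrite invr_gt0; move: p1; lra_only.
have L0 : 0 < L by move: L40; lra_only.
have LK : 0 < L `^ K by rewrite powR_gt0.
have mR : 0 < m%:R :> R.
  apply: lt_le_trans logs; apply: ltr_pwDl; first exact: mulr_gt0.
  by rewrite mulr_ge0 ?powR_ge0 // ltW.
have sL : L `^ K <= s.
  rewrite /s ler_pdivlMr // mulrC; apply: le_trans logs.
  by rewrite lerDl mulr_ge0 ?powR_ge0 // ltW.
have tl : ln (l%:R : R) `^ K <= t.
  rewrite /t ler_pdivlMr // mulrC; apply: le_trans logs.
  by rewrite lerDr mulr_ge0 ?powR_ge0 // ltW.
have ml : m%:R <= n%:R * l%:R :> R.
  by move: mu1; rewrite ler_pdivrMr ?mul1r // mulr_gt0.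
have lnm : ln (m%:R : R) <= L + ln (l%:R : R).
  by rewrite -lnM ?posrE // ler_ln ?posrE // mulr_gt0.
have lnl0 : 0 <= ln (l%:R : R) by apply: ln_ge0; rewrite (ler_nat _ 1 l).
(* With m <= n l, the logarithm of the power hypothesis becomes L <= (4 - 5 phi) ln l. *)
have Ll : L <= 2 * ln (l%:R : R).
  have h1 : (5 - 5 * phi) * L <= ln ((l + n)%N%:R `^ (5 - 5 * phi) : R).
    rewrite ln_powR; apply: ler_wpM2l; first by move: p2; lra_only.
    by rewrite /L ler_ln ?posrE // ?ltr0n ?addn_gt0 ?l0 // ler_nat leq_addl.
  have h2 : ln ((l + n)%N%:R `^ (5 - 5 * phi) : R) <=
      ln (l%:R * n%:R * m%:R `^ (3 - 5 * phi) : R).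
    rewrite ler_ln // posrE; first by rewrite powR_gt0 // ltr0n addn_gt0 l0.
    by rewrite !mulr_gt0 // powR_gt0.
  have h3 : ln (l%:R * n%:R * m%:R `^ (3 - 5 * phi) : R) =
      ln (l%:R : R) + L + (3 - 5 * phi) * ln (m%:R : R).
    by rewrite !lnM ?posrE ?mulr_gt0 ?powR_gt0 // ln_powR.
  have c0 : 0 <= 3 - 5 * phi by move: p2; lra_only.
  have h4 := ler_wpM2l c0 lnm.
  have h5 : 0 <= (5 * phi - 2) * ln (l%:R : R).
    by rewrite mulr_ge0 //; move: p1; lra_only.
  by move: h1 h2 h4 h5; rewrite h3; lra_only.
have L2 : 1 <= L / 2 by move: L40; lra_only.
have L20 : 0 <= L / 2 by move: L40; lra_only.
have rL : (L / 2) `^ K <= r.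
  rewrite /r le_min; apply/andP; split.
    apply: le_trans sL; apply: ge0_ler_powR; rewrite ?nnegrE ?(ltW K0) ?(ltW L0) //.
    by move: L0; lra_only.
  apply: le_trans tl; apply: ge0_ler_powR; rewrite ?nnegrE ?(ltW K0) //.
  by move: Ll; lra_only.
have r1 : 1 <= r.
  apply: le_trans rL; rewrite -[leLHS](powRr0 (L / 2)).
  by apply: ler_powR => //; exact: ltW.
have r0 : 0 < r by apply: lt_le_trans r1.
have rphi : L / 2 <= r `^ (2 * phi - 1).
  have phi0 : 0 < 2 * phi - 1 by move: p1; lra_only.
  have {1}-> : L / 2 = ((L / 2) `^ K) `^ (2 * phi - 1).
    by rewrite -powRrM mulVf ?powRr1 // gt_eqF.
  by apply: ge0_ler_powR; rewrite ?nnegrE ?powR_ge0 ?(ltW phi0) ?(ltW r0).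
have r2phi : (L / 2) ^+ 2 <= r `^ (4 * phi - 2).
  have -> : r `^ (4 * phi - 2) = (r `^ (2 * phi - 1)) ^+ 2.
    by rewrite expr_powR; congr (_ `^ _); ring.
  by rewrite lerXn2r ?nnegrE ?powR_ge0.
have qL : q%:R <= 4 * L + 1.
  by rewrite qE -natr1 lerD2r truncn_le mulr_ge0 // ltW.
have Lq : 4 * L <= q%:R by apply: ltW; rewrite qE; exact: truncnS_gt.
split=> //.
(* Here phi < 3/5 enters, in the form 4 phi - 2 <= 1 - phi. *)
- have h : 100 <= r `^ (1 - phi).
    apply: (@le_trans _ _ ((L / 2) ^+ 2)).
      have : 20 * 20 <= L / 2 * (L / 2) by apply: ler_pM => //; move: L40; lra_only.
      by rewrite expr2; lra_only.
    apply: (le_trans r2phi); apply: ler_powR => //; move: p2; lra_only.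
  rewrite -opprB powRN div1r lef_pV2 ?posrE ?powR_gt0 //.
(* As exp(1/2) <= 2 and q >= 4 ln n, 2^q is at least n^2, hence at least r^2 and r^(4 - 4 phi). *)
- have eh : expR (1 / 2 : R) <= 2.
    have := expR_ge1Dx (- (1 / 2) : R); rewrite expRN => h.
    have h2 : 1 / 2 <= (expR (1 / 2))^-1 :> R by move: h; lra_only.
    by rewrite -[leLHS]invrK invf_ple ?posrE ?invr_gt0 ?expR_gt0 //; move: h2; lra_only.
  have n2 : n%:R ^+ 2 <= 2 ^+ q :> R.
    apply: (@le_trans _ _ (expR (1 / 2) ^+ q)); last by rewrite lerXn2r ?nnegrE ?expR_ge0.
    rewrite -expRM_natr -[n%:R]lnK ?posrE // -expRM_natr ler_expR -/L.
    by move: Lq; lra_only.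
  have rn : r <= n%:R.
    apply: (@le_trans _ _ s); first by rewrite /r ge_min lexx.
    by rewrite /s ler_pdivrMr.
  have h : r `^ (4 - 4 * phi) <= 2 ^+ q.
    apply: le_trans n2; apply: (@le_trans _ _ (r `^ 2)).
      by apply: ler_powR => //; move: p1; lra_only.
    by rewrite powR_mulrn ?(ltW r0) // lerXn2r ?nnegrE ?(ltW r0) ?(ltW nR).
  rewrite -opprB powRN div1r lef_pV2 ?posrE ?powR_gt0 ?exprn_gt0 //.
(* 2 + 2 q <= 8 L + 4 <= 10 L <= (L / 2)^2, the last because L >= 40. *)
- apply: le_trans r2phi; rewrite natrD -mul2n natrM.
  have : 40 * L <= L * L by apply: ler_wpM2r => //; exact: ltW.
  by move: qL L40; rewrite expr2; lra_only.
Qed.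

Local Open Scope classical_set_scope.

Theorem theorem1p5 (R : realType) :
  exists2 mu1 : R, 0 < mu1 &
  forall mu0 : R, 0 < mu0 <= mu1 ->
  forall phi : R, 1 / 2 < phi < 3 / 5 ->
  forall (di : bool) (l m : nat -> nat),
  (di -> forall n : nat, l n = n) ->
  (\forall n \near \oo, (m n)%:R / (n%:R * (l n)%:R) < mu0) ->
  (fun n : nat => (l n + n)%N%:R `^ (5 - 5 * phi) : R) =o_\oo
    (fun n : nat => (l n)%:R * n%:R * (m n)%:R `^ (3 - 5 * phi) : R) ->
  (forall K : R, 0 < K ->
    (fun n : nat => (l n)%:R * ln n%:R `^ K + n%:R * ln (l n)%:R `^ K : R)
      =o_\oo (fun n : nat => (m n)%:R : R)) ->
  exists C : R, \forall n \near \oo,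
  forall d : degrees (l n) n, near_regular phi (m n) d ->
  forall (a : 'I_(l n)) (v : 'I_n), (di -> val v != val a) ->
  let s : R := (m n)%:R / (l n)%:R in
  let t : R := (m n)%:R / n%:R in
  exists2 err : R,
    `|err| <= C * (Num.min s t `^ (4 * phi - 4)
                   * ((m n)%:R / (n%:R * (l n)%:R))) &
    edge_cond_prob R di (m n) d a v = edge_formula di (m n) d a v err.
Proof.
have [mu1 mu1_gt0 [C C0 estimate]] := finite_estimate R.
exists (Num.min mu1 1); first by rewrite lt_min mu1_gt0 ltr01.
move=> mu0 /andP[mu0_gt0 mu0_le] phi phi_range di l m ln_eq small pows logs.
(* This constant comes from [finite_estimate] before any sequence is given, which is the uniformity
   in d. *)
exists C.
have K0 : 0 < (2 * phi - 1)^-1.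
  by rewrite invr_gt0; case/andP: phi_range; lra_only.
have /eqoP/(_ 1 ltr01) logs1 := logs _ K0.
move/eqoP/(_ 1 ltr01): pows => pows1.
near=> n; move=> d dreg a v av.
have l_gt0 : (0 < l n)%N by apply: leq_ltn_trans (ltn_ord a).
have n_gt0 : (0 < n)%N by apply: leq_ltn_trans (ltn_ord v).
have mu_n : (m n)%:R / (n%:R * (l n)%:R) < mu0 by near: n.
have logs_n : `|(l n)%:R * ln n%:R `^ (2 * phi - 1)^-1
    + n%:R * ln (l n)%:R `^ (2 * phi - 1)^-1| <= 1 * `|(m n)%:R : R| by near: n.
have pows_n : `|(l n + n)%N%:R `^ (5 - 5 * phi)|
    <= 1 * `|(l n)%:R * n%:R * (m n)%:R `^ (3 - 5 * phi) : R| by near: n.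
have n_large : expR 40 <= n%:R :> R.
  by near: n; exact: nbhs_infty_ger.
have L40 : 40 <= ln (n%:R : R).
  by rewrite -[leLHS]expRK ler_ln ?posrE ?expR_gt0 // ltr0n.
have n_gt1 : (1 < n)%N.
  rewrite -(ltr_nat R); apply: lt_le_trans n_large.
  by have := expR_ge1Dx (40 : R); lra_only.
rewrite !mul1r !ger0_norm ?addr_ge0 ?mulr_ge0 ?powR_ge0 // in logs_n pows_n.
have mu_min := lt_le_trans mu_n mu0_le; rewrite lt_min in mu_min.
have /andP[mu_1 mu_le1] := mu_min.
have [r1 e1 qe kr] := growth_bounds phi_range l_gt0 L40 (ltW mu_le1) logs_n pows_n.
have ln_eq' : di -> l n = n by move/ln_eq; apply.
exact: (estimate _ _ _ _ _ _ _ ln_eq' phi_range dreg l_gt0 n_gt1 mu_1 r1 e1 qe kr a v av).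
Unshelve. all: by end_near.
Qed.
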